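(* Let $A=C^*_{\max}(F_\infty)$ and let $D$ be a separable unital exact $C^*$-algebra. Then the class of $K\in\mathrm{Ideal}(A)$ such that $A/K$ is $D$-absorbing is analytic.
   Context: $F_\infty$ is the free group on countably many generators and $C^*_{\max}(F_\infty)$ its full group $C^*$-algebra. $\mathrm{Ideal}(A)$ is the set of closed two-sided ideals of $A$, with the Wijsman topology (the coarsest topology making $K\mapsto d(x,K)$ continuous for each $x\in A$), which is Polish. A separable unital $C^*$-algebra $B$ is $D$-absorbing if $B\cong B\otimes_{\min} D$. *)

(* Defs.v *)
From HB Require Import structures.
From mathcomp Require Import all_boot all_order all_algebra.
From mathcomp Require Import all_classical all_reals all_analysis.
From mathcomp Require Import complex.

Set Implicit Arguments.
Unset Strict Implicit.
Unset Printing Implicit Defensive.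

Import Order.TTheory GRing.Theory Num.Theory.
Import numFieldNormedType.Exports.

Local Open Scope classical_set_scope.
Local Open Scope ring_scope.

(* Free group on X: reduced words over the letters x (= (x, true)) and
   x^-1 (= (x, false)); the product lets the letters of the first word act
   one by one on the second. *)

Definition fg_opp (X : choiceType) (a : X * bool) : X * bool := (a.1, ~~ a.2).

Definition fg_reduced (X : choiceType) (w : seq (X * bool)) : bool :=
  sorted (fun a b => b != fg_opp a) w.

Definition fg_act (X : choiceType) (a : X * bool) (w : seq (X * bool)) :=
  if w is b :: w' then if b == fg_opp a then w' else a :: w else [:: a].

Definition fg_mulw (X : choiceType) (w1 w2 : seq (X * bool)) :=
  foldr (@fg_act X) w2 w1.

Definition fg_invw (X : choiceType) (w : seq (X * bool)) :=
  rev (map (@fg_opp X) w).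

Record free_group (X : choiceType) := FreeGroup {
  fg_word :> seq (X * bool);
  fg_wordP : fg_reduced fg_word }.

HB.instance Definition _ (X : choiceType) := [isSub for @fg_word X].
HB.instance Definition _ (X : choiceType) := [Choice of free_group X by <:].

Lemma fg_oppK (X : choiceType) : involutive (@fg_opp X).
Proof. by case=> x b; rewrite /fg_opp /= negbK. Qed.

Lemma fg_act_reduced (X : choiceType) (a : X * bool) w :
  fg_reduced w -> fg_reduced (fg_act a w).
Proof.
case: w => [|b w] //= rw; case: eqP => [_|/eqP ne].
  exact: path_sorted rw.
by rewrite /fg_reduced /= ne.
Qed.

Lemma fg_mulw_reduced (X : choiceType) (w1 w2 : seq (X * bool)) :
  fg_reduced w2 -> fg_reduced (fg_mulw w1 w2).
Proof. by move=> r2; elim: w1 => //= a w1 IH; apply: fg_act_reduced. Qed.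

Lemma fg_actK (X : choiceType) (a : X * bool) w :
  fg_reduced w -> fg_act a (fg_act (fg_opp a) w) = w.
Proof.
case: w => [|b w] /= rw; first by rewrite eqxx.
rewrite fg_oppK; case: eqP => [eba|_] /=; last by rewrite eqxx.
move: rw; rewrite {}eba; case: w => [|c w] //=; rewrite /fg_reduced /=.
by case/andP=> /negPf->.
Qed.

Lemma fg_mulw_act (X : choiceType) (a : X * bool) w z :
  fg_reduced z -> fg_mulw (fg_act a w) z = fg_act a (fg_mulw w z).
Proof.
move=> rz; case: w => [|b w] //=.
case: eqP => [->|_] //=.
by rewrite fg_actK //; apply: fg_mulw_reduced.
Qed.

Lemma fg_mulwA (X : choiceType) (x y z : seq (X * bool)) :
  fg_reduced z -> fg_mulw x (fg_mulw y z) = fg_mulw (fg_mulw x y) z.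
Proof. by move=> rz; elim: x => //= a x ->; rewrite fg_mulw_act. Qed.

Lemma fg_mulw0 (X : choiceType) (x : seq (X * bool)) :
  fg_reduced x -> fg_mulw x [::] = x.
Proof.
elim: x => //= a x IH rx; rewrite IH; last exact: path_sorted rx.
by case: x rx {IH} => //= b x; rewrite /fg_reduced /= => /andP[/negPf->].
Qed.

Lemma fg_invw_reduced (X : choiceType) (w : seq (X * bool)) :
  fg_reduced w -> fg_reduced (fg_invw w).
Proof.
rewrite /fg_reduced /fg_invw rev_sorted sorted_map.
apply: sub_sorted => a b /=; rewrite fg_oppK.
by apply: contra => /eqP->.
Qed.

Lemma fg_invwK (X : choiceType) : involutive (@fg_invw X).
Proof.
by move=> w; rewrite /fg_invw map_rev revK -map_comp map_id_in // => a _ /=;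
   rewrite fg_oppK.
Qed.

Lemma fg_mulVw (X : choiceType) (w : seq (X * bool)) :
  fg_mulw (fg_invw w) w = [::].
Proof.
rewrite /fg_mulw /fg_invw; elim: w => //= a w IH.
by rewrite rev_cons foldr_rcons /= fg_oppK eqxx.
Qed.

Definition fg_one (X : choiceType) : free_group X :=
  @FreeGroup X [::] isT.
Definition fg_mul (X : choiceType) (x y : free_group X) : free_group X :=
  FreeGroup (fg_mulw_reduced x (fg_wordP y)).
Definition fg_inv (X : choiceType) (x : free_group X) : free_group X :=
  FreeGroup (fg_invw_reduced (fg_wordP x)).

Lemma fg_mulA (X : choiceType) : associative (@fg_mul X).
Proof. by move=> x y z; apply/val_inj/fg_mulwA/fg_wordP. Qed.
Lemma fg_mul1 (X : choiceType) : left_id (fg_one X) (@fg_mul X).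
Proof. by move=> x; apply/val_inj. Qed.
Lemma fg_mulr1 (X : choiceType) : right_id (fg_one X) (@fg_mul X).
Proof. by move=> x; apply/val_inj/fg_mulw0/fg_wordP. Qed.
Lemma fg_mulV (X : choiceType) : left_inverse (fg_one X) (@fg_inv X) (@fg_mul X).
Proof. by move=> x; apply/val_inj/fg_mulVw. Qed.
Lemma fg_mulrV (X : choiceType) :
  right_inverse (fg_one X) (@fg_inv X) (@fg_mul X).
Proof.
by move=> x; apply/val_inj => /=; rewrite -[X in fg_mulw X]fg_invwK fg_mulVw.
Qed.

HB.instance Definition _ (X : choiceType) :=
  isGroup.Build (free_group X) (@fg_mulA X) (@fg_mul1 X) (@fg_mulr1 X)
    (@fg_mulV X) (@fg_mulrV X).

(* The norm of a normed space over R[i] takes its values in R[i]. *)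
Definition rnorm (R : realType) (V : normedModType R[i]) (x : V) : R :=
  complex.Re `|x|.

Definition separable_space (T : topologicalType) : Prop :=
  exists2 S : set T, countable S & dense S.

(* C*-algebras, not necessarily unital *)

HB.mixin Record isCStarAlgebra (R : realType) A
    of CompleteNormedModule R[i] A := {
  cmul : A -> A -> A;
  cstar : A -> A;
  cmulA : associative cmul;
  cmulDl : left_distributive cmul +%R;
  cmulDr : right_distributive cmul +%R;
  cscaleAl : forall (c : R[i]) (x y : A), c *: cmul x y = cmul (c *: x) y;
  cscaleAr : forall (c : R[i]) (x y : A), c *: cmul x y = cmul x (c *: y);
  cstarK : involutive cstar;
  cstarD : {morph cstar : x y / x + y};
  cstarZ : forall (c : R[i]) (x : A), cstar (c *: x) = c^* *: cstar x;
  cstarM : forall x y : A, cstar (cmul x y) = cmul (cstar y) (cstar x);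
  cnormM : forall x y : A, `|cmul x y| <= `|x| * `|y|;
  cnorm_starM : forall x : A, `|cmul (cstar x) x| = `|x| ^+ 2 }.

#[short(type="cstarAlgType")]
HB.structure Definition CStarAlgebra (R : realType) :=
  {A of CompleteNormedModule R[i] A & isCStarAlgebra R A}.

Definition unital (R : realType) (A : cstarAlgType R) : Prop :=
  exists e : A, forall x : A, cmul e x = x /\ cmul x e = x.

Definition star_hom (R : realType) (A B : cstarAlgType R) (f : A -> B) : Prop :=
  [/\ linear f,
      (forall x y, f (cmul x y) = cmul (f x) (f y)) &
      (forall x, f (cstar x) = cstar (f x))].

Definition star_isomorphic (R : realType) (A B : cstarAlgType R) : Prop :=
  exists2 f : A -> B, star_hom f & bijective f.

(* Hilbert spaces (inner product linear in the first variable), operators and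
   representations *)

HB.mixin Record isHilbert (R : realType) H of CompleteNormedModule R[i] H := {
  inner : H -> H -> R[i];
  inner_linearl : forall (c : R[i]) (x y z : H),
    inner (c *: x + y) z = c * inner x z + inner y z;
  inner_conj : forall x y : H, inner y x = (inner x y)^*;
  inner_norm : forall x : H, inner x x = `|x| ^+ 2 }.

#[short(type="hilbertType")]
HB.structure Definition Hilbert (R : realType) :=
  {H of CompleteNormedModule R[i] H & isHilbert R H}.

Definition opnorm (R : realType) (H : hilbertType R) (f : H -> H) : R :=
  sup [set rnorm (f h) | h in [set h : H | rnorm h <= 1]].

Definition cstar_rep (R : realType) (A : cstarAlgType R) (H : hilbertType R)
    (p : A -> H -> H) : Prop :=
  [/\ forall a, linear (p a) /\ continuous (p a),
      forall (c : R[i]) a b h, p (c *: a + b) h = c *: p a h + p b h,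
      forall a b h, p (cmul a b) h = p a (p b h) &
      forall a h k, inner (p a h) k = inner h (p (cstar a) k)].

Definition unitary_rep (R : realType) (G : groupType) (H : hilbertType R)
    (p : G -> H -> H) : Prop :=
  [/\ forall g, linear (p g),
      forall h, p 1%g h = h,
      forall g g' h, p (g * g')%g h = p g (p g' h) &
      forall g h k, inner (p g h) (p g k) = inner h k].

(* Full group C*-algebra: a list s : seq (R[i] * G) stands for the element
   \sum_(y <- s) y.1 g_(y.2) of the group algebra R[i][G]. *)

Definition full_group_norm (R : realType) (G : groupType)
    (s : seq (R[i] * G)) : R :=
  sup [set r : R | exists (H : hilbertType R) (p : G -> H -> H),
    unitary_rep p /\ r = opnorm (fun h => \sum_(y <- s) y.1 *: p y.2 h)].

(* A is the completion of the *-algebra R[i][G] for full_group_norm, u being the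
   canonical embedding of G. *)
Definition is_full_group_cstar (R : realType) (G : groupType)
    (A : cstarAlgType R) (u : G -> A) : Prop :=
  [/\ forall g h, u (g * h)%g = cmul (u g) (u h),
      forall g, u (g^-1)%g = cstar (u g),
      dense (range (fun s : seq (R[i] * G) => \sum_(y <- s) y.1 *: u y.2)) &
      forall s : seq (R[i] * G),
        rnorm (\sum_(y <- s) y.1 *: u y.2) = full_group_norm s].

(* Minimal tensor product: lists s : seq (H * K) and x : seq (A * B) stand for
   the sums of elementary tensors \sum h (x) k and \sum a (x) b. *)

Definition htensor_norm (R : realType) (H K : hilbertType R)
    (s : seq (H * K)) : R :=
  Num.sqrt (complex.Re
    (\sum_(y <- s) \sum_(z <- s) inner y.1 z.1 * inner y.2 z.2)).

Definition tensor_act (R : realType) (A B : cstarAlgType R)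
    (H K : hilbertType R) (p : A -> H -> H) (q : B -> K -> K)
    (x : seq (A * B)) (s : seq (H * K)) : seq (H * K) :=
  [seq (p y.1 z.1, q y.2 z.2) | y <- x, z <- s].

(* Norm of (p (x) q)(x) on the Hilbert space tensor product of H and K, computed
   on the dense subspace of finite sums of elementary tensors. *)
Definition tensor_opnorm (R : realType) (A B : cstarAlgType R)
    (H K : hilbertType R) (p : A -> H -> H) (q : B -> K -> K)
    (x : seq (A * B)) : R :=
  sup [set htensor_norm (tensor_act p q x s) |
       s in [set s : seq (H * K) | htensor_norm s <= 1]].

Definition min_norm (R : realType) (A B : cstarAlgType R)
    (x : seq (A * B)) : R :=
  sup [set r : R | exists (H K : hilbertType R)
      (p : A -> H -> H) (q : B -> K -> K),
    [/\ cstar_rep p, cstar_rep q & r = tensor_opnorm p q x]].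

(* T is the completion of the algebraic tensor product of A and B for min_norm,
   t a b being the elementary tensor of a and b. *)
Definition is_min_tensor (R : realType) (A B T : cstarAlgType R)
    (t : A -> B -> T) : Prop :=
  [/\ (forall a, linear (t a)) /\ (forall b, linear (t^~ b)),
      forall a a' b b', cmul (t a b) (t a' b') = t (cmul a a') (cmul b b'),
      forall a b, cstar (t a b) = t (cstar a) (cstar b),
      dense (range (fun x : seq (A * B) => \sum_(y <- x) t y.1 y.2)) &
      forall x : seq (A * B), rnorm (\sum_(y <- x) t y.1 y.2) = min_norm x].

Definition absorbing (R : realType) (D B : cstarAlgType R) : Prop :=
  exists (T : cstarAlgType R) (t : B -> D -> T),
    is_min_tensor t /\ star_isomorphic B T.

Definition short_exact (R : realType) (J B C : cstarAlgType R)
    (i : J -> B) (q : B -> C) : Prop :=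
  [/\ star_hom i, star_hom q, injective i,
      range i = [set b | q b = 0] & range q = [set: C]].

(* D is exact: tensoring with D (for the minimal norm) preserves short exact
   sequences; i' and q' are the maps i (x) id_D and q (x) id_D. *)
Definition exact_cstar (R : realType) (D : cstarAlgType R) : Prop :=
  forall (J B C : cstarAlgType R) (i : J -> B) (q : B -> C),
    short_exact i q ->
  forall (TJ TB TC : cstarAlgType R)
    (tJ : J -> D -> TJ) (tB : B -> D -> TB) (tC : C -> D -> TC),
    is_min_tensor tJ -> is_min_tensor tB -> is_min_tensor tC ->
  forall (i' : TJ -> TB) (q' : TB -> TC),
    star_hom i' -> star_hom q' ->
    (forall a d, i' (tJ a d) = tB (i a) d) ->
    (forall b d, q' (tB b d) = tC (q b) d) ->
  short_exact i' q'.

Definition is_closed_ideal (R : realType) (A : cstarAlgType R) (K : set A) :=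
  [/\ closed K, K 0,
      forall (c : R[i]) x y, K x -> K y -> K (c *: x + y) &
      forall a x, K x -> K (cmul a x) /\ K (cmul x a)].

Record closed_ideal (R : realType) (A : cstarAlgType R) := ClosedIdeal {
  ideal_set :> set A;
  ideal_setP : is_closed_ideal ideal_set }.

HB.instance Definition _ (R : realType) (A : cstarAlgType R) :=
  gen_eqMixin (closed_ideal A).
HB.instance Definition _ (R : realType) (A : cstarAlgType R) :=
  gen_choiceMixin (closed_ideal A).

Definition dist_to (R : realType) (A : cstarAlgType R) (x : A) (K : set A) : R :=
  inf [set rnorm (x - k) | k in K].

Definition wijsman (R : realType) (A : cstarAlgType R) : Type :=
  sup_topology (fun x : A => Topological.class
    (initial_topology (fun K : closed_ideal A => dist_to x K : R))).

HB.instance Definition _ (R : realType) (A : cstarAlgType R) :=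
  Topological.copy (closed_ideal A) (wijsman A).

(* B, with the projection q, is the quotient C*-algebra A / K. *)
Definition is_quotient (R : realType) (A : cstarAlgType R) (K : set A)
    (B : cstarAlgType R) (q : A -> B) : Prop :=
  [/\ star_hom q, range q = [set: B], [set x | q x = 0] = K &
      forall x, rnorm (q x) = dist_to x K].

(* S is empty or a continuous image of a nonempty Polish space (library complete
   spaces are pointed, hence the separate empty case). *)
Definition analytic (R : realType) (X : topologicalType) (S : set X) : Prop :=
  S = set0 \/
  exists Y : completePseudoMetricType R,
    [/\ hausdorff_space Y, separable_space Y &
        exists2 f : Y -> X, continuous f & range f = S].

(* Main.v *)
(* A closed ideal K is coded by a seminorm L on A x E, where E is the minimal tensor
   product of A and D: L (a, s) stands for |q a - h s|, with q : A -> B = A / K the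
   projection and h : E -> B a surjective *-homomorphism. Exactness of D says that
   the kernel of E -> B (x) D is the closed span of the elementary tensors k (x) d
   with k in K, so B is isomorphic to B (x) D exactly when h can be chosen with that
   kernel. The algebraic requirements on L pass to pointwise limits. The remaining
   ones, surjectivity of q and h and the inclusion of the kernel of h in that closed
   span, become statements of the form "for all m there is n" about dense sequences
   once they are made quantitative by the open mapping theorem. Such an L is 1-Lipschitz,
   and the pairs (L, w), with w : nat -> nat listing the witnesses n, form a Polish
   space; K depends continuously on L because d(a, K) = L (a, 0). *)
Require Import Defs.
From HB Require Import structures.
From mathcomp Require Import all_boot all_order all_algebra.
From mathcomp Require Import all_classical all_reals all_analysis.
From mathcomp Require Import complex ring lra.

Set Implicit Arguments.
Unset Strict Implicit.
Unset Printing Implicit Defensive.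

Import Order.TTheory GRing.Theory Num.Theory.
Import numFieldNormedType.Exports.

Local Open Scope classical_set_scope.
Local Open Scope ring_scope.

(** * Real-valued norms *)

(** The obstacle is that the norm of the tensor product of [B = A / K] with [D] is a supremum over
    representations of [B], and [B] changes with [K]; such a norm gives no closed condition on [K].
    Hence everything is pulled back to the fixed algebra [E], and the tensor product of [B] with [D]
    is seen only through the kernel of its projection from [E]. Exactness serves twice: in producing
    a code from an absorbing quotient and in recovering the isomorphism from a code. One inclusion
    between the kernels is the closed condition [L (0, tau a d) <= L (a, 0) * rnorm d]. The other
    one, read literally, would be an implication from [L (0, s) = 0], which limits need not
    preserve. The open mapping constant [C] of [h] turns it into an estimate: [s] is within
    [C * L (0, s)] of sums of tensors that are nearly killed. The same estimate bounds approximate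
    preimages under [h], so that a dense range of [h] is already everything. [star_hom] contains no
    continuity, and exactness speaks of given completions, so contractivity of the maps involved and
    the existence and functoriality of minimal tensor products have to be established. *)

Definition cmod (R : realType) (c : R[i]) : R := complex.Re `|c|.

Section RealNorm.
Context {R : realType}.
Implicit Types (V : normedModType R[i]) (c : R[i]).

Lemma cmodE c : `|c| = (cmod c)%:C%C.
Proof. by rewrite /cmod RRe_real ?normr_real. Qed.

Lemma cmod_ge0 c : 0 <= cmod c.
Proof. by have := normr_ge0 c; rewrite cmodE ler0c. Qed.

Lemma cmodC (r : R) : 0 <= r -> cmod r%:C%C = r.
Proof. by move=> r0; rewrite /cmod ger0_norm ?ler0c. Qed.

Lemma cmodM c d : cmod (c * d) = cmod c * cmod d.
Proof. by apply: complexI; rewrite rmorphM /= -!cmodE normrM. Qed.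

Lemma cmodN1 : cmod (-1 : R[i]) = 1.
Proof. by rewrite /cmod normrN normr1. Qed.

Lemma rnormE V (x : V) : `|x| = (rnorm x)%:C%C.
Proof. by rewrite /rnorm RRe_real ?normr_real. Qed.

Lemma rnorm_ge0 V (x : V) : 0 <= rnorm x.
Proof. by have := normr_ge0 x; rewrite rnormE ler0c. Qed.

Lemma rnorm0 V : rnorm (0 : V) = 0.
Proof. by rewrite /rnorm normr0. Qed.

Lemma rnorm0_eq0 V (x : V) : rnorm x = 0 -> x = 0.
Proof. by move=> x0; apply/normr0_eq0; rewrite rnormE x0. Qed.

Lemma rnormN V (x : V) : rnorm (- x) = rnorm x.
Proof. by rewrite /rnorm normrN. Qed.

Lemma rnormBC V (x y : V) : rnorm (x - y) = rnorm (y - x).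
Proof. by rewrite /rnorm distrC. Qed.

Lemma rnormD V (x y : V) : rnorm (x + y) <= rnorm x + rnorm y.
Proof. by have := ler_normD x y; rewrite !rnormE -rmorphD lecR. Qed.

Lemma rnormB V (x y : V) : rnorm (x - y) <= rnorm x + rnorm y.
Proof. by rewrite -[in leRHS](rnormN y) rnormD. Qed.

Lemma rnormZ V c (x : V) : rnorm (c *: x) = cmod c * rnorm x.
Proof. by apply: complexI; rewrite rmorphM /= -cmodE -!rnormE normrZ. Qed.

Lemma rnorm_triangle V (y x z : V) : rnorm (x - z) <= rnorm (x - y) + rnorm (y - z).
Proof. by rewrite -[x - z](subrKA y) rnormD. Qed.

Lemma ler_rnorm_dist V (x y : V) : rnorm x <= rnorm y + rnorm (x - y).
Proof. by rewrite -{1}(subrK y x) addrC rnormD. Qed.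

Lemma rnorm_sum_le V (I : Type) (r : seq I) (F : I -> V) :
  rnorm (\sum_(i <- r) F i) <= \sum_(i <- r) rnorm (F i).
Proof.
elim: r => [|i r IH]; first by rewrite !big_nil rnorm0.
by rewrite !big_cons (le_trans (rnormD _ _))// lerD.
Qed.

Lemma rnorm_small_eq0 V (x : V) : (forall e, 0 < e -> rnorm x <= e) -> x = 0.
Proof.
move=> h; apply: rnorm0_eq0; apply/eqP; rewrite eq_le rnorm_ge0 andbT.
by apply/ler_addgt0Pr => e e0; rewrite add0r h.
Qed.

(** The balls of the library have radii in [R[i]]; a positive element there is real, so real radii
    suffice and later estimates take place in [R]. *)
Lemma nbhs_rnormP V (x : V) (U : set V) :
  nbhs x U <-> exists2 e : R, 0 < e & forall y, rnorm (x - y) < e -> U y.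
Proof.
split=> [/(nbhs_ballP (R := R[i]))[e /= e0 sU]|[e e0 sU]].
  have er : e = (complex.Re e)%:C%C by rewrite RRe_real// gtr0_real.
  exists (complex.Re e) => [|y xy]; first by rewrite -ltcR -er.
  by apply: sU; rewrite -ball_normE /ball_ /= rnormE er ltcR.
apply/(nbhs_ballP (R := R[i])); exists e%:C%C => /=; first by rewrite ltcR.
by move=> y; rewrite -ball_normE /ball_/= rnormE ltcR => /sU.
Qed.

Lemma open_rball V (x : V) (e : R) : open [set y | rnorm (x - y) < e].
Proof.
rewrite openE => y /= xy; apply/nbhs_rnormP; exists (e - rnorm (x - y)).
  by rewrite subr_gt0.
by move=> z yz /=; have := rnorm_triangle y x z; lra.
Qed.

Lemma dense_rnormP V (S : set V) :
  dense S <-> forall x e, 0 < e -> exists2 y, S y & rnorm (x - y) < e.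
Proof.
split=> [dS x e e0|h U [x Ux] oU].
  have [|y [xy Sy]] := dS _ _ (open_rball x e); last by exists y.
  by exists x; rewrite /= subrr rnorm0.
have /nbhs_rnormP[e e0 sU] : nbhs x U by exact: open_nbhs_nbhs.
by have [y Sy xy] := h x e e0; exists y; split=> //; exact: sU.
Qed.

Lemma closed_rnormP V (S : set V) :
  closed S <-> forall x, (forall e, 0 < e -> exists2 y, S y & rnorm (x - y) < e) -> S x.
Proof.
split=> [cS x h|h x cx].
  apply: cS => U /nbhs_rnormP[e e0 sU]; have [y Sy xy] := h e e0.
  by exists y; split=> //; exact: sU.
apply: h => e e0; have [|y [Sy xy]] := cx [set y | rnorm (x - y) < e].
  by apply/nbhs_rnormP; exists e.
by exists y.
Qed.

Definition rcauchy V (x : nat -> V) := forall e, 0 < e ->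
  exists M, forall n m, (M <= n)%N -> (M <= m)%N -> rnorm (x n - x m) < e.

Definition rcvg V (x : nat -> V) (l : V) := forall e, 0 < e ->
  exists M, forall n, (M <= n)%N -> rnorm (l - x n) < e.

Lemma rcauchy_rcvg (V : completeNormedModType R[i]) (x : nat -> V) :
  rcauchy x -> exists l, rcvg x l.
Proof.
move=> cx; have : cvg (x @ \oo).
  apply: cauchy_cvg; apply: cauchy_exP => e e0.
  have er : e = (complex.Re e)%:C%C by rewrite RRe_real// gtr0_real.
  have [|M hM] := cx (complex.Re e); first by rewrite -ltcR -er.
  exists (x M), M => // n /= Mn.
  by rewrite -ball_normE /ball_/= rnormE er ltcR hM.
move=> /cvg_ex[l xl]; exists l => e e0.
have [|M _ hM] := xl [set y | rnorm (l - y) < e].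
  by apply/nbhs_rnormP; exists e.
by exists M => n /hM.
Qed.

Lemma geometric_small (C r e : R) : 0 <= r < 1 -> 0 < e ->
  exists M, forall n, (M <= n)%N -> C * r ^+ n < e.
Proof.
move=> /andP[r0 r1] e0; have := @cvg_geometric R C r.
rewrite ger0_norm// => /(_ r1) /cvgr0Pnorm_lt /(_ e e0)[M _ hM].
exists M => n /hM /=; exact/le_lt_trans/ler_norm.
Qed.

Lemma geometric_rcvg (V : completeNormedModType R[i]) (x : nat -> V) (C r : R) :
  0 <= r < 1 -> (forall n, rnorm (x n - x n.+1) <= C * r ^+ n) ->
  exists2 l, rcvg x l & rnorm (x 0%N - l) <= C / (1 - r).
Proof.
move=> r01 hx; have /andP[r0 r1] := r01.
have C0 : 0 <= C by have := hx 0%N; rewrite expr0 mulr1; exact/le_trans/rnorm_ge0.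
have r1' : 0 < 1 - r by rewrite subr_gt0.
have Cr : 0 <= C / (1 - r) by rewrite divr_ge0// ltW.
(* With a difference of powers on the right the bound telescopes and the induction on [k] closes;
   [D'] then drops the negative term. *)
have D n k : rnorm (x n - x (n + k)%N) <= C / (1 - r) * (r ^+ n - r ^+ (n + k)).
  elim: k => [|k IH]; first by rewrite addn0 !subrr rnorm0 mulr0.
  rewrite addnS (le_trans (rnorm_triangle (x (n + k)%N) _ _))//.
  apply: le_trans (lerD IH (hx _)) _.
  rewrite exprS.
  have -> : C * r ^+ (n + k) = C / (1 - r) * ((1 - r) * r ^+ (n + k)).
    by field; rewrite gt_eqF.
  rewrite -mulrDr ler_wpM2l//.
  by rewrite mulrBl mul1r addrA subrK.
have D' n k : rnorm (x n - x (n + k)%N) <= C / (1 - r) * r ^+ n.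
  apply: le_trans (D n k) _; rewrite ler_wpM2l//.
  by rewrite lerBlDr lerDl exprn_ge0.
have cx : rcauchy x.
  move=> e e0; have [M hM] := geometric_small (C / (1 - r)) r01 (divr_gt0 e0 (ltr0Sn _ 1)).
  exists M => n m Mn Mm; have := hM M (leqnn _) => hMM.
  have h1 := D' M (n - M)%N; have h2 := D' M (m - M)%N.
  rewrite !subnKC// in h1 h2.
  have := rnorm_triangle (x M) (x n) (x m); rewrite (rnormBC (x n) (x M)); lra.
have [l xl] := rcauchy_rcvg cx; exists l => //.
apply/ler_addgt0Pr => e e0; have [M hM] := xl e e0.
have := hM M (leqnn _); have := D' 0%N M; rewrite add0n expr0 mulr1.
by have := rnorm_triangle (x M) (x 0%N) l; rewrite (rnormBC (x M) l); lra.
Qed.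

Lemma rcvg_approx V (x : nat -> V) l e : rcvg x l -> 0 < e -> exists n, rnorm (l - x n) < e.
Proof. by move=> xl e0; have [M hM] := xl e e0; exists M; exact: hM. Qed.

End RealNorm.

(** * Elementary C*-algebra arithmetic, and square roots without spectral theory *)

Section CStarBasics.
Context {R : realType}.
Implicit Types A B : cstarAlgType R.

Lemma rnormM A (x y : A) : rnorm (cmul x y) <= rnorm x * rnorm y.
Proof. by have := cnormM x y; rewrite !rnormE -rmorphM lecR. Qed.

Lemma rnorm_starM A (x : A) : rnorm (cmul (cstar x) x) = rnorm x ^+ 2.
Proof. by apply: complexI; rewrite rmorphXn /= -!rnormE cnorm_starM. Qed.

Lemma rnorm_star A (x : A) : rnorm (cstar x) = rnorm x.
Proof.
have le (y : A) : rnorm y <= rnorm (cstar y).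
  have [->|/eqP y0] := eqVneq (rnorm y) 0; first exact: rnorm_ge0.
  have yp : 0 < rnorm y by rewrite lt_neqAle eq_sym rnorm_ge0 andbT; apply/eqP.
  by have := rnormM (cstar y) y; rewrite rnorm_starM expr2 ler_pM2r.
by apply/eqP; rewrite eq_le le andbT; have := le (cstar x); rewrite cstarK.
Qed.

Lemma cmul0l A (x : A) : cmul 0 x = 0.
Proof. by apply: (addrI (cmul 0 x)); rewrite -cmulDl !addr0. Qed.
Lemma cmul0r A (x : A) : cmul x 0 = 0.
Proof. by apply: (addrI (cmul x 0)); rewrite -cmulDr !addr0. Qed.
Lemma cmulNl A (x y : A) : cmul (- x) y = - cmul x y.
Proof. by rewrite -scaleN1r -cscaleAl scaleN1r. Qed.
Lemma cmulNr A (x y : A) : cmul x (- y) = - cmul x y.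
Proof. by rewrite -scaleN1r -cscaleAr scaleN1r. Qed.
Lemma cmulBl A (x y z : A) : cmul (x - y) z = cmul x z - cmul y z.
Proof. by rewrite cmulDl cmulNl. Qed.
Lemma cmulBr A (x y z : A) : cmul z (x - y) = cmul z x - cmul z y.
Proof. by rewrite cmulDr cmulNr. Qed.
Lemma cstar0 A : cstar (0 : A) = 0.
Proof. by apply: (addrI (cstar 0)); rewrite -cstarD !addr0. Qed.
Lemma cstarN A (x : A) : cstar (- x) = - cstar x.
Proof. by rewrite -scaleN1r cstarZ rmorphN rmorph1 scaleN1r. Qed.
Lemma cstarB A (x y : A) : cstar (x - y) = cstar x - cstar y.
Proof. by rewrite cstarD cstarN. Qed.

Lemma cstarZr A (r : R) (x : A) : cstar (r%:C%C *: x) = r%:C%C *: cstar x.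
Proof. by rewrite cstarZ; congr (_ *: _); rewrite conj_Creal// complex_real. Qed.

Lemma cmul_dist A (x y x' y' : A) :
  rnorm (cmul x y - cmul x' y') <= rnorm x * rnorm (y - y') + rnorm (x - x') * rnorm y'.
Proof.
have -> : cmul x y - cmul x' y' = cmul x (y - y') + cmul (x - x') y'.
  by rewrite cmulBr cmulBl addrA subrK.
by rewrite (le_trans (rnormD _ _))// lerD// rnormM.
Qed.

Lemma star_hom0 A B (f : A -> B) : star_hom f -> f 0 = 0.
Proof. by case=> lf _ _; have := lf (-1) 0 0; rewrite scaler0 add0r scaleN1r addNr. Qed.
Lemma star_homD A B (f : A -> B) x y : star_hom f -> f (x + y) = f x + f y.
Proof. by case=> lf _ _; have := lf 1 x y; rewrite !scale1r. Qed.
Lemma star_homZ A B (f : A -> B) c x : star_hom f -> f (c *: x) = c *: f x.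
Proof. by move=> hf; have [lf _ _] := hf; have := lf c x 0; rewrite (star_hom0 hf) !addr0. Qed.
Lemma star_homN A B (f : A -> B) x : star_hom f -> f (- x) = - f x.
Proof. by move=> hf; rewrite -scaleN1r (star_homZ _ _ hf) scaleN1r. Qed.
Lemma star_homB A B (f : A -> B) x y : star_hom f -> f (x - y) = f x - f y.
Proof. by move=> hf; rewrite (star_homD _ _ hf) (star_homN _ hf). Qed.
Lemma star_homM A B (f : A -> B) x y : star_hom f -> f (cmul x y) = cmul (f x) (f y).
Proof. by case. Qed.
Lemma star_homS A B (f : A -> B) x : star_hom f -> f (cstar x) = cstar (f x).
Proof. by case. Qed.

(* The fixed point of [c |-> (w + c^2) / 2] on the ball of radius [|w|], that is
   [c = 1 - sqrt (1 - w)]. *)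
Lemma half_square_fixpoint A (w : A) : cstar w = w -> rnorm w < 1 ->
  exists c : A, [/\ cstar c = c, c + c = w + cmul c c &
    forall z, cmul z w = cmul w z -> cmul z c = cmul c z].
Proof.
move=> ws w1; set r := rnorm w; have r0 : 0 <= r := rnorm_ge0 w.
pose h : R[i] := (2^-1)%:C%C.
have hM (z : A) : rnorm (h *: z) = 2^-1 * rnorm z by rewrite rnormZ cmodC.
pose P c := h *: (w + cmul c c).
pose x n := iter n P (0 : A).
have xr n : rnorm (x n) <= r.
  elim: n => [|n IH] /=; first by rewrite rnorm0.
  rewrite hM; have := rnormD w (cmul (x n) (x n)); have := rnormM (x n) (x n).
  have := rnorm_ge0 (x n); rewrite -/r; nra.
(* On the ball of radius [r], |c^2 - d^2| / 2 <= r |c - d|, so [rnorm w < 1] makes [P] a strict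
   contraction there. *)
have Pd c d : rnorm c <= r -> rnorm d <= r -> rnorm (P c - P d) <= r * rnorm (c - d).
  move=> cr dr; rewrite /P -scalerBr hM opprD addrACA subrr add0r.
  have := cmul_dist c c d d; have := rnorm_ge0 (c - d); nra.
have [//||l xl _] := @geometric_rcvg R A x r r; first exact/andP.
  move=> n; elim: n => [|n IH].
    by rewrite expr0 mulr1 sub0r rnormN.
  rewrite /= (le_trans (Pd _ _ (xr n) (xr n.+1)))//.
  by rewrite exprS mulrCA ler_wpM2l.
have lr : rnorm l <= r.
  apply/ler_addgt0Pr => e e0; have [n ln] := rcvg_approx xl e0.
  by have := ler_rnorm_dist l (x n); have := xr n; lra.
exists l; split.
- have xs n : cstar (x n) = x n.
    by elim: n => [|n IH]; rewrite ?cstar0//= /P cstarZr cstarD cstarM IH ws.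
  apply/eqP; rewrite -subr_eq0; apply/eqP; apply: rnorm_small_eq0 => e e0.
  have [n ln] := rcvg_approx xl (divr_gt0 e0 (ltr0Sn _ 1)).
  have := rnorm_triangle (x n) (cstar l) l.
  by rewrite -{1}(xs n) -cstarB rnorm_star (rnormBC (x n) l); lra.
- have : P l = l.
    apply/eqP; rewrite -subr_eq0; apply/eqP; apply: rnorm_small_eq0 => e e0.
    have [M hM'] := xl _ (divr_gt0 e0 (ltr0Sn _ 1)).
    have := rnorm_triangle (x M.+1) (P l) l.
    have := Pd _ _ lr (xr M); rewrite (rnormBC (x M.+1) l) /=.
    have := hM' M (leqnn _); have := hM' M.+1 (leqnSn _) => /=.
    have := rnorm_ge0 (l - x M); nra.
  rewrite /P => {1 2}<-; rewrite -scalerDl.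
  have -> : h + h = 1 by rewrite /h -rmorphD/= -[RHS](rmorph1 (real_complex R)); congr (_%:C%C); lra.
  by rewrite scale1r.
(* Each iterate is a polynomial in [w], hence commutes with whatever commutes with [w]; this passes
   to the limit. *)
- move=> z zw; have xz n : cmul z (x n) = cmul (x n) z.
    elim: n => [|n IH]; first by rewrite cmul0l cmul0r.
    rewrite /= /P -cscaleAr -cscaleAl cmulDr cmulDl zw; congr (_ *: (_ + _)).
    by rewrite cmulA IH -cmulA IH cmulA.
  apply/eqP; rewrite -subr_eq0; apply/eqP; apply: rnorm_small_eq0 => e e0.
  have z0 := rnorm_ge0 z.
  have zp : 0 < 2 * rnorm z + 1 by lra.
  have [n] := rcvg_approx xl (divr_gt0 e0 zp); rewrite ltr_pdivlMr// => ln.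
  have -> : cmul z l - cmul l z = cmul z (l - x n) - cmul (l - x n) z.
    by rewrite cmulBr cmulBl xz opprB addrA subrK.
  have := rnormB (cmul z (l - x n)) (cmul (l - x n) z).
  have := rnormM z (l - x n); have := rnormM (l - x n) z.
  have := rnorm_ge0 (l - x n); nra.
Qed.

End CStarBasics.

(** * Linear maps between Banach spaces and *-homomorphisms *)

Section BanachMaps.
Context {R : realType}.

Lemma linear_sub (X Z : lmodType R[i]) (q : X -> Z) : linear q ->
  {morph q : x y / x - y}.
Proof. by move=> lq x y; rewrite -[x - y]addrC -scaleN1r lq scaleN1r addrC. Qed.

Lemma linear_add (X Z : lmodType R[i]) (q : X -> Z) : linear q ->
  {morph q : x y / x + y}.
Proof. by move=> lq x y; have := lq 1 x y; rewrite !scale1r. Qed.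

Lemma linear_scale (X Z : lmodType R[i]) (q : X -> Z) : linear q ->
  forall c x, q (c *: x) = c *: q x.
Proof.
move=> lq c x; have q0 : q 0 = 0 by rewrite -(subrr (0 : X)) (linear_sub lq) subrr.
by have := lq c x 0; rewrite q0 !addr0.
Qed.

(** Successive approximation: the residual is lifted approximately again and again with halved
    tolerances, and completeness of [X] sums the corrections. The constant [C] is preserved, which
    matters for [C = 1], where the conclusion identifies a quotient norm. *)
Lemma approx_lift (X : completeNormedModType R[i]) (Z : normedModType R[i])
    (q : X -> Z) (C : R) :
  linear q -> (forall x, rnorm (q x) <= rnorm x) -> 0 <= C ->
  (forall z e, 0 < e -> exists2 x, rnorm x <= C * rnorm z + e & rnorm (z - q x) <= e) ->
  forall z e, 0 < e -> exists2 x, q x = z & rnorm x <= C * rnorm z + e.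
Proof.
move=> lq cq C0 H z e e0.
have [G hG] : {G : Z * R -> X & forall ze, 0 < ze.2 ->
    rnorm (G ze) <= C * rnorm ze.1 + ze.2 /\ rnorm (ze.1 - q (G ze)) <= ze.2}.
  apply: (@choice _ _ (fun ze x => 0 < ze.2 ->
    rnorm x <= C * rnorm ze.1 + ze.2 /\ rnorm (ze.1 - q x) <= ze.2)) => -[z' e'].
  by have [e'0|] := ltP 0 e'; [have [x ? ?] := H z' e' e'0; exists x|exists 0].
have C3 : 0 < 2 * C + 3 by lra.
(* The first lift exceeds [C * rnorm z] by at most [d], and the later corrections add up to at most
   [2 * (C + 1) * d]. *)
pose d := e / (2 * C + 3); have d0 : 0 < d by rewrite divr_gt0.
have de : e = d * (2 * C + 3) by rewrite divfK// gt_eqF.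
pose dn n := d * 2^-1 ^+ n : R.
have dn0 n : 0 < dn n by rewrite mulr_gt0// exprn_gt0// invr_gt0.
have dnS n : dn n.+1 = dn n / 2 by rewrite /dn exprS; lra.
pose fix y n := if n is m.+1 then y m + G (z - q (y m), dn m.+1) else G (z, dn 0%N).
have yq n : rnorm (z - q (y n)) <= dn n.
  elim: n => [|n IH] /=; first by have [] := hG (z, dn 0%N) (dn0 _).
  have [_ /=] := hG (z - q (y n), dn n.+1) (dn0 _).
  by rewrite (linear_add lq) opprD addrA.
have [||l yl l0] := @geometric_rcvg R X y ((C + 1) * d) 2^-1.
- by apply/andP; split; lra.
- move=> n /=; rewrite opprD addrA subrr add0r rnormN -mulrA -/(dn n).
  have [/= h _] := hG (z - q (y n), dn n.+1) (dn0 _).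
  by have := dnS n; have := ler_wpM2l C0 (yq n); have := dn0 n; lra.
exists l.
  apply/esym/eqP; rewrite -subr_eq0; apply/eqP; apply: rnorm_small_eq0 => r r0.
  have [M1 hM1] := yl _ (divr_gt0 r0 (ltr0Sn _ 1)).
  have [||M2 hM2] := @geometric_small R d 2^-1 (r / 2); [by apply/andP; split; lra|by lra|].
  pose M := maxn M1 M2.
  have := hM1 M (leq_maxl _ _); have := hM2 M (leq_maxr _ _); have := yq M.
  have := cq (l - y M); rewrite (linear_sub lq).
  have := rnorm_triangle (q (y M)) z (q l); rewrite (rnormBC (q (y M)) (q l)) /dn; lra.
have [h _] := hG (z, dn 0%N) (dn0 _); move: h l0; rewrite /= {2}/dn expr0 mulr1 => h l0.
have := ler_rnorm_dist l (G (z, dn 0%N)); rewrite (rnormBC l).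
suff : (C + 1) * d / (1 - 2^-1) = 2 * (C + 1) * d by lra.
by field.
Qed.

(** The Baire half of the open mapping theorem, with nested balls in [Z]. It gives approximate
    preimages of controlled norm; [approx_lift] makes them exact when [X] is complete. *)
Lemma surjective_open (X : normedModType R[i]) (Z : completeNormedModType R[i])
    (h : X -> Z) :
  linear h -> (forall z, exists x, h x = z) ->
  exists2 C : R, 0 <= C & forall z e, 0 < e ->
    exists2 x, rnorm x <= C * rnorm z & rnorm (z - h x) <= e.
Proof.
move=> lh sh.
suff [n [b [r [r0 H]]]] : exists (n : nat) b r, 0 < r /\ forall b', rnorm (b - b') < r ->
    forall e, 0 < e -> exists2 x, rnorm x <= n%:R & rnorm (b' - h x) < e.
  (* With [k = r / (2 * rnorm z)], both [b] and [b + k z] lie in the good ball. Their approximate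
     preimages differ by at most [2 * n] in norm, and division by [k] yields the constant. *)
  exists (4 * n%:R / r); first by rewrite divr_ge0// ?(ltW r0)// mulr_ge0.
  move=> z e e0; have [z0|/eqP z0] := eqVneq (rnorm z) 0.
    exists 0; first by rewrite z0 rnorm0 mulr0.
    by rewrite (rnorm0_eq0 z0) -[X in h X](subrr 0) (linear_sub lh) !subrr rnorm0 ltW.
  have zp : 0 < rnorm z by rewrite lt_neqAle eq_sym rnorm_ge0 andbT; apply/eqP.
  pose k : R := r / (2 * rnorm z).
  have k0 : 0 < k by rewrite divr_gt0// mulr_gt0.
  have kge0 := ltW k0; have ki0 : 0 <= k^-1 by rewrite invr_ge0.
  have kz : k * rnorm z = r / 2 by rewrite /k; field; rewrite gt_eqF.
  have ek : 0 < e * k / 2 by rewrite divr_gt0// mulr_gt0.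
  have [|x1 x1n hx1] := H (b + k%:C%C *: z) _ _ ek.
    by rewrite opprD addrA subrr add0r rnormN rnormZ cmodC// kz; lra.
  have [|x2 x2n hx2] := H b _ _ ek; first by rewrite subrr rnorm0.
  exists ((k^-1)%:C%C *: (x1 - x2)); rewrite ?(linear_scale lh) ?(linear_sub lh).
    rewrite rnormZ cmodC//.
    have -> : 4 * n%:R / r * rnorm z = k^-1 * (2 * n%:R).
      by rewrite /k; field; rewrite !gt_eqF.
    by rewrite ler_pM2l ?invr_gt0//; have := rnormB x1 x2; lra.
  have -> : z - (k^-1)%:C%C *: (h x1 - h x2) =
      (k^-1)%:C%C *: ((b + k%:C%C *: z - h x1) - (b - h x2)).
    have kk : (k^-1)%:C%C *: (k%:C%C *: z) = z.
      by rewrite scalerA -rmorphM mulVf ?gt_eqF// rmorph1 scale1r.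
    rewrite -{1}kk -scalerBr; congr (_ *: _).
    by rewrite (addrC b) -!addrA; congr (_ + _); rewrite !opprB addrA (addrC (b - _)) subrKA.
  rewrite rnormZ cmodC// ler_pdivrMl// mulrC.
  by have := rnormB (b + k%:C%C *: z - h x1) (b - h x2); lra.
apply: contrapT => Hn.
have N n b r : 0 < r -> exists b', exists2 e, 0 < e & rnorm (b - b') < r /\
    forall x, rnorm x <= n%:R -> e <= rnorm (b' - h x).
  move=> r0; apply: contrapT => hb; apply: Hn; exists n, b, r; split=> // b' bb' e e0.
  apply: contrapT => hx; apply: hb; exists b', e => //; split=> // x xn.
  by rewrite leNgt; apply/negP => xe; apply: hx; exists x.
(* Balls are pairs of a centre and a radius. The new ball lies inside the old one, has at most half
   its radius, and even its closure misses the image of the ball of radius [t.1]; the strict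
   inequality is what the limit point needs. *)
pose Q (t : nat * (Z * R)) (u : Z * R) := 0 < t.2.2 ->
  [/\ 0 < u.2, rnorm (t.2.1 - u.1) + u.2 <= t.2.2, u.2 <= t.2.2 / 2 &
      forall x, rnorm x <= t.1%:R -> u.2 < rnorm (u.1 - h x)].
have [S hS] : {S & forall t, Q t (S t)}.
  apply: choice => -[n [b r]]; have [r0|] := ltP 0 r; last first.
    by move=> r0; exists (0, 0); rewrite /Q /= ltNge r0.
  have [b' [e e0 [bb' hb']]] := N n b r r0.
  exists (b', Num.min (e / 2) ((r - rnorm (b - b')) / 2)) => _ /=.
  have d0 := rnorm_ge0 (b - b').
  split; [|have : Num.min (e / 2) ((r - rnorm (b - b')) / 2) <= (r - rnorm (b - b')) / 2 by rewrite ge_min lexx orbT|have : Num.min (e / 2) ((r - rnorm (b - b')) / 2) <= (r - rnorm (b - b')) / 2 by rewrite ge_min lexx orbT|].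
  - by rewrite lt_min; apply/andP; split; lra.
  - by lra.
  - by lra.
  - move=> x xn; apply: lt_le_trans (hb' x xn); rewrite gt_min; apply/orP; left; lra.
pose fix y n := if n is m.+1 then S (m, y m) else (0, 1).
have y0 n : 0 < (y n).2.
  elim: n => [|n IH] /=; first by [].
  by have [] := hS (n, y n) IH.
have yr n : (y n).2 <= 2^-1 ^+ n.
  elim: n => [|n IH]; first by rewrite expr0.
  by have [_ _ + _] := hS (n, y n) (y0 n); rewrite exprS /=; lra.
have ynest n k : rnorm ((y n).1 - (y (n + k)%N).1) + (y (n + k)%N).2 <= (y n).2.
  elim: k => [|k IH]; first by rewrite addn0 subrr rnorm0 add0r.
  rewrite addnS; have [_ /= + _ _] := hS (n + k, y (n + k)%N)%N (y0 _).
  by have := rnorm_triangle (y (n + k)%N).1 (y n).1 (S ((n + k)%N, y (n + k)%N)).1; lra.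
have [||l yl _] := @geometric_rcvg R Z (fun n => (y n).1) 1 2^-1.
- by apply/andP; split; lra.
- move=> n; rewrite mul1r; apply: le_trans (yr n).
  by have := ynest n 1%N; rewrite addn1; have := y0 n.+1; lra.
have ln n : rnorm ((y n).1 - l) <= (y n).2.
  apply/ler_addgt0Pr => e e0; have [M hM] := yl e e0.
  have := hM (n + M)%N (leq_addl _ _); have := ynest n M; have := y0 (n + M)%N.
  have := rnorm_triangle (y (n + M)%N).1 (y n).1 l.
  by rewrite (rnormBC (y (n + M)%N).1 l); lra.
have [s hs] := sh l.
(* The ball [y n.+2] was chosen with index [n.+1], so it misses the image of a ball containing [s],
   although the limit [l = h s] belongs to it. *)
pose n := Num.truncn (rnorm s); have sn : rnorm s <= n.+1%:R by rewrite ltW// truncnS_gt.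
have [_ _ _ /(_ s sn)] := hS (n.+1, y n.+1) (y0 _).
by have := ln n.+2; rewrite hs /=; lra.
Qed.

End BanachMaps.

Section StarHoms.
Context {R : realType}.
Implicit Types A B : cstarAlgType R.

(** For self-adjoint [x] of norm below 1, [f x] is the mean of two adjoint elements of norm at most
    1, as x is the real part of the unitary x + i sqrt(1 - x^2). The C*-identity reduces a general
    [a] to the product of its adjoint with [a]. Surjectivity makes [f e] a unit of [B]. *)
Lemma surj_star_hom_contractive A B (f : A -> B) :
  unital A -> star_hom f -> (forall b, exists a, f a = b) ->
  forall a, rnorm (f a) <= rnorm a.
Proof.
move=> [e eu] hf sf.
pose v := f e.
have vl b : cmul v b = b by have [a <-] := sf b; rewrite -(star_homM _ _ hf) (eu a).1.
have vr b : cmul b v = b by have [a <-] := sf b; rewrite -(star_homM _ _ hf) (eu a).2.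
have vs : cstar v = v by have := congr1 cstar (vl (cstar v)); rewrite cstarM cstarK vl.
have v1 : rnorm v <= 1.
  have := rnorm_starM v; rewrite vs vl => vv.
  by have := rnorm_ge0 v; nra.
have sa (x : A) : cstar x = x -> rnorm x < 1 -> rnorm (f x) <= 1.
  move=> xs x1.
  have [||c [cs cc cz]] := @half_square_fixpoint R A (cmul x x).
  - by rewrite cstarM xs.
  - by have := rnormM x x; have := rnorm_ge0 x; nra.
  have xc : cmul x c = cmul c x by apply: cz; rewrite cmulA.
  (* Since 2c = x^2 + c^2 means (1 - c)^2 = 1 - x^2, [d] is the image of sqrt(1 - x^2); it is
     self-adjoint and commutes with [y]. *)
  pose y := f x; pose d := v - f c.
  have ys : cstar y = y by rewrite -(star_homS _ hf) xs.
  have ds : cstar d = d by rewrite cstarB vs -(star_homS _ hf) cs.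
  have yd : cmul y d = cmul d y.
    by rewrite cmulBr cmulBl vl vr -!(star_homM _ _ hf) xc.
  have yydd : cmul y y + cmul d d = v.
    rewrite cmulBr !cmulBl !vl vr -!(star_homM _ _ hf).
    have -> : f (cmul x x) = f c + f c - f (cmul c c).
      by rewrite -(star_homD _ _ hf) cc (star_homD _ _ hf) addrK.
    by rewrite addrC -(addrA (f c) (f c)) -(addrA v) -opprD subrK.
  pose u := y + 'i *: d; pose u' := y - 'i *: d.
  have us : cstar u = u'.
    by rewrite cstarD cstarZ ys ds conjCi scaleNr.
  have us' : cstar u' = u by rewrite -us cstarK.
  have uu : cmul u' u = v.
    rewrite cmulBl !cmulDr -!cscaleAr -!cscaleAl scalerA -expr2 sqrCi scaleN1r yd.
    by rewrite opprD opprK addrA addrK.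
  have un : rnorm u <= 1.
    by have := rnorm_starM u; rewrite us uu => ?; have := rnorm_ge0 u; nra.
  have un' : rnorm u' <= 1 by rewrite -us rnorm_star.
  have -> : f x = (2^-1)%:C%C *: (u + u').
    rewrite addrACA subrr addr0 -/y -[LHS]scale1r.
    rewrite -[y + y]mulr2n -(scaler_nat _ y) scalerA; congr (_ *: _).
    by have -> : (2%:R : R[i]) = (2%:R : R)%:C%C by [rewrite rmorph_nat]; rewrite -rmorphM mulVf ?pnatr_eq0// rmorph1.
  by rewrite rnormZ cmodC; have := rnormD u u'; lra.
have saZ (x : A) : cstar x = x -> rnorm (f x) <= rnorm x.
  move=> xs; apply/ler_addgt0Pr => r r0.
  have xr : 0 < rnorm x + r by have := rnorm_ge0 x; lra.
  have xri : 0 < (rnorm x + r)^-1 by rewrite invr_gt0.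
  have xri0 := ltW xri.
  have := sa (((rnorm x + r)^-1)%:C%C *: x).
  rewrite cstarZr xs rnormZ cmodC// (star_homZ _ _ hf) rnormZ cmodC//.
  rewrite ltr_pdivrMl// ler_pdivrMl// mulr1; apply=> //; lra.
move=> a; have := saZ (cmul (cstar a) a); rewrite cstarM cstarK => /(_ erefl).
rewrite (star_homM _ _ hf) (star_homS _ hf) !rnorm_starM.
by rewrite ler_pXn2r// nnegrE rnorm_ge0.
Qed.

(** A linear relation that relates 0 only to 0 is single-valued. The homomorphisms built below are
    known through approximations or chosen preimages, so they are introduced by their graphs. *)
Lemma star_hom_of_graph A B (G : A -> B -> Prop) :
  (forall x, exists y, G x y) ->
  (forall c x y x' y', G x y -> G x' y' -> G (c *: x + x') (c *: y + y')) ->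
  (forall x y x' y', G x y -> G x' y' -> G (cmul x x') (cmul y y')) ->
  (forall x y, G x y -> G (cstar x) (cstar y)) ->
  (forall y, G 0 y -> y = 0) ->
  exists2 f : A -> B, star_hom f & forall x, G x (f x).
Proof.
move=> Gt Gl Gm Gs G0; have [f hf] := choice Gt.
have fu x y : G x y -> f x = y.
  move=> xy; apply/eqP; rewrite -subr_eq0 addrC -scaleN1r; apply/eqP; apply: G0.
  by rewrite -(addNr x) -scaleN1r; exact: Gl.
exists f => //; split.
- by move=> c x y; apply: fu; exact: Gl.
- by move=> x y; apply: fu; exact: Gm.
- by move=> x; apply: fu; exact: Gs.
Qed.

End StarHoms.

(** * Completion of a pre-C*-algebra *)

Section Completeness.
Context {R : realType}.

(** A Cauchy filter has a member inside a ball of radius 2^-n for every n; the centres form a Cauchy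
    sequence, and its limit is a limit of the filter. *)
Lemma rcauchy_complete (V : normedModType R[i]) :
  (forall x : nat -> V, rcauchy x -> exists l, rcvg x l) ->
  forall F : set_system V, ProperFilter F -> cauchy F -> cvg F.
Proof.
move=> cV F FF /(@cauchyP R[i]) cF.
have near_ball (e : R) : 0 < e -> exists x, F [set y | rnorm (x - y) < e].
  move=> e0; have [|x Fx] := cF e%:C%C; first by rewrite ltcR.
  exists x; apply: filterS Fx => y; rewrite -ball_normE /ball_ /= rnormE ltcR.
  by [].
pose dn n : R := 2^-1 ^+ n.
have dn0 n : 0 < dn n by rewrite exprn_gt0// invr_gt0.
have [x hx] := choice (fun n => near_ball (dn n) (dn0 n)).
have dn_small e : 0 < e -> exists M, forall n, (M <= n)%N -> dn n < e.
  move=> e0; have [|//|M hM] := @geometric_small R 1 2^-1 e; first by apply/andP; split; lra.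
  by exists M => n /hM; rewrite mul1r.
have [|l xl] := cV x.
  move=> e e0; have [|M hM] := dn_small (e / 2); first by lra.
  exists M => n m Mn Mm; have [y [/= ny my]] := filter_ex (filterI (hx n) (hx m)).
  have := hM n Mn; have := hM m Mm; have := rnorm_triangle y (x n) (x m).
  by rewrite (rnormBC y); lra.
apply/cvg_ex; exists l => U /nbhs_rnormP[e e0 sU].
have [|M1 hM1] := xl (e / 2); first by lra.
have [|M2 hM2] := dn_small (e / 2); first by lra.
apply: filterS (hx (maxn M1 M2)) => y /= yx; apply: sU.
have := hM1 _ (leq_maxl M1 M2); have := hM2 _ (leq_maxr M1 M2).
by have := rnorm_triangle (x (maxn M1 M2)) l y; lra.
Qed.

End Completeness.

(* A *-algebra whose axioms hold up to the pseudo-distance [pcd], and whose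
   C*-seminorm is the distance to [pc0]. *)
Record preCStar (R : realType) := PreCStar {
  pcT :> Type;
  pc0 : pcT;
  pcD : pcT -> pcT -> pcT;
  pcZ : R[i] -> pcT -> pcT;
  pcM : pcT -> pcT -> pcT;
  pcS : pcT -> pcT;
  pcd : pcT -> pcT -> R;
  pcdxx : forall x, pcd x x = 0;
  pcd_sym : forall x y, pcd x y = pcd y x;
  pcd_tri : forall y x z, pcd x z <= pcd x y + pcd y z;
  pcdD : forall x y x' y', pcd (pcD x y) (pcD x' y') <= pcd x x' + pcd y y';
  pcdZ : forall c x y, pcd (pcZ c x) (pcZ c y) <= cmod c * pcd x y;
  pcdM : forall x y x' y',
    pcd (pcM x y) (pcM x' y') <= pcd x pc0 * pcd y y' + pcd x x' * pcd y' pc0;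
  pcdS : forall x y, pcd (pcS x) (pcS y) <= pcd x y;
  pc_addA : forall x y z, pcd (pcD x (pcD y z)) (pcD (pcD x y) z) = 0;
  pc_addC : forall x y, pcd (pcD x y) (pcD y x) = 0;
  pc_add0 : forall x, pcd (pcD pc0 x) x = 0;
  pc_addN : forall x, pcd (pcD (pcZ (-1) x) x) pc0 = 0;
  pc_scaleA : forall a b x, pcd (pcZ a (pcZ b x)) (pcZ (a * b) x) = 0;
  pc_scale1 : forall x, pcd (pcZ 1 x) x = 0;
  pc_scaleDr : forall a x y, pcd (pcZ a (pcD x y)) (pcD (pcZ a x) (pcZ a y)) = 0;
  pc_scaleDl : forall a b x, pcd (pcZ (a + b) x) (pcD (pcZ a x) (pcZ b x)) = 0;
  pc_mulA : forall x y z, pcd (pcM x (pcM y z)) (pcM (pcM x y) z) = 0;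
  pc_mulDl : forall x y z, pcd (pcM (pcD x y) z) (pcD (pcM x z) (pcM y z)) = 0;
  pc_mulDr : forall x y z, pcd (pcM z (pcD x y)) (pcD (pcM z x) (pcM z y)) = 0;
  pc_scaleAl : forall c x y, pcd (pcZ c (pcM x y)) (pcM (pcZ c x) y) = 0;
  pc_scaleAr : forall c x y, pcd (pcZ c (pcM x y)) (pcM x (pcZ c y)) = 0;
  pc_starK : forall x, pcd (pcS (pcS x)) x = 0;
  pc_starD : forall x y, pcd (pcS (pcD x y)) (pcD (pcS x) (pcS y)) = 0;
  pc_starZ : forall c x, pcd (pcS (pcZ c x)) (pcZ c^* (pcS x)) = 0;
  pc_starM : forall x y, pcd (pcS (pcM x y)) (pcM (pcS y) (pcS x)) = 0;
  pc_distB : forall x y, pcd (pcD x (pcZ (-1) y)) pc0 = pcd x y;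
  pc_normZ : forall c x, pcd (pcZ c x) pc0 = cmod c * pcd x pc0;
  pc_norm_starM : forall x, pcd (pcM (pcS x) x) pc0 = pcd x pc0 ^+ 2 }.

Section Completion.
Context {R : realType} (P : preCStar R).
Local Notation d := (@pcd R P).
Local Notation o := (@pc0 R P).
Implicit Types (c : nat -> P) (x y z : P).

Definition pcauchy c := forall e, 0 < e ->
  exists M, forall n m, (M <= n)%N -> (M <= m)%N -> d (c n) (c m) < e.

Definition pnull c c' := forall e, 0 < e ->
  exists M, forall n, (M <= n)%N -> d (c n) (c' n) < e.

Lemma pcd_ge0 x y : 0 <= d x y.
Proof. by have := pcd_tri y x x; rewrite pcdxx (pcd_sym y); lra. Qed.

Lemma pcauchy_cst x : pcauchy (fun=> x).
Proof. by move=> e e0; exists 0%N => n m _ _; rewrite pcdxx. Qed.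

Lemma pnull_sym c c' : pnull c c' -> pnull c' c.
Proof. by move=> h e /h[M hM]; exists M => n /hM; rewrite pcd_sym. Qed.

Lemma pnull_trans c' c c'' : pnull c c' -> pnull c' c'' -> pnull c c''.
Proof.
move=> h1 h2 e e0; have e2 : 0 < e / 2 by lra.
have [M1 hM1] := h1 _ e2; have [M2 hM2] := h2 _ e2.
exists (maxn M1 M2) => n; rewrite geq_max => /andP[/hM1 ? /hM2 ?].
by have := pcd_tri (c' n) (c n) (c'' n); lra.
Qed.

Lemma pnull_eq c c' : (forall n, d (c n) (c' n) = 0) -> pnull c c'.
Proof. by move=> h e e0; exists 0%N => n _; rewrite h. Qed.

Definition pclass c := [set c' | pcauchy c' /\ pnull c c'].

Definition completion := {F : set (nat -> P) | exists2 c, pcauchy c & F = pclass c}.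

Lemma completion_inj (u v : completion) : sval u = sval v -> u = v.
Proof. by case: u v => [F hF] [G hG] /= FG; exact: eq_exist. Qed.

Definition cpi_cauchy c (hc : pcauchy c) : completion :=
  exist _ (pclass c) (ex_intro2 _ _ c hc erefl).

(** Sequences that are not Cauchy go to the class of the constant sequence [o]; being total, [cpi]
    lets the operations be written without Cauchy proofs as arguments. *)
Definition cpi c : completion :=
  if pselect (pcauchy c) is left hc then cpi_cauchy hc
  else cpi_cauchy (@pcauchy_cst o).

Lemma cpi_val c : pcauchy c -> sval (cpi c) = pclass c.
Proof. by move=> hc; rewrite /cpi; case: pselect. Qed.

Lemma cpi_eq c c' : pcauchy c -> pcauchy c' -> pnull c c' -> cpi c = cpi c'.
Proof.
move=> hc hc' cc'; apply: completion_inj; rewrite !cpi_val//.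
apply/seteqP; split=> u [hu cu]; split=> //.
  by apply: (pnull_trans (c' := c)) => //; exact: pnull_sym.
exact: (pnull_trans (c' := c')).
Qed.

Lemma cpi_null c c' : pcauchy c -> pcauchy c' -> cpi c = cpi c' -> pnull c c'.
Proof.
move=> hc hc' /(congr1 sval); rewrite !cpi_val// => E.
have : pclass c' c' by split=> //; apply: pnull_eq => n; exact: pcdxx.
by rewrite -E => -[].
Qed.

Lemma cpi_surj (u : completion) : exists c, pcauchy c /\ cpi c = u.
Proof.
case: u => F [c hc FE]; exists c; split=> //; apply: completion_inj.
by rewrite cpi_val.
Qed.

Definition crep u := sval (cid (cpi_surj u)).
Lemma crep_cauchy u : pcauchy (crep u).
Proof. by rewrite /crep; case: cid => c []. Qed.
Lemma crepK u : cpi (crep u) = u.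
Proof. by rewrite /crep; case: cid => c []. Qed.
Lemma crep_null c : pcauchy c -> pnull (crep (cpi c)) c.
Proof. by move=> hc; apply: cpi_null => //; [exact: crep_cauchy|exact: crepK]. Qed.

Lemma completion_ind (Q : completion -> Prop) :
  (forall c, pcauchy c -> Q (cpi c)) -> forall u, Q u.
Proof. by move=> h u; have [c [hc <-]] := cpi_surj u; exact: h. Qed.

Lemma pcauchyD c c' : pcauchy c -> pcauchy c' -> pcauchy (fun n => pcD (c n) (c' n)).
Proof.
move=> h1 h2 e e0; have e2 : 0 < e / 2 by lra.
have [M1 hM1] := h1 _ e2; have [M2 hM2] := h2 _ e2.
exists (maxn M1 M2) => n m; rewrite !geq_max => /andP[n1 n2] /andP[m1 m2].
have := hM1 n m n1 m1; have := hM2 n m n2 m2.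
by have := pcdD (c n) (c' n) (c m) (c' m); lra.
Qed.

Lemma pnullD c1 c1' c2 c2' : pnull c1 c1' -> pnull c2 c2' ->
  pnull (fun n => pcD (c1 n) (c2 n)) (fun n => pcD (c1' n) (c2' n)).
Proof.
move=> h1 h2 e e0; have e2 : 0 < e / 2 by lra.
have [M1 hM1] := h1 _ e2; have [M2 hM2] := h2 _ e2.
exists (maxn M1 M2) => n; rewrite !geq_max => /andP[/hM1 ? /hM2 ?].
by have := pcdD (c1 n) (c2 n) (c1' n) (c2' n); lra.
Qed.

Lemma pcauchyZ a c : pcauchy c -> pcauchy (fun n => pcZ a (c n)).
Proof.
move=> h e e0; have a0 := cmod_ge0 a; have a1 : 0 < cmod a + 1 by lra.
have [M hM] := h _ (divr_gt0 e0 a1); exists M => n m Mn Mm.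
have := hM n m Mn Mm; rewrite ltr_pdivlMr//.
by have := pcdZ a (c n) (c m); have := pcd_ge0 (c n) (c m); nra.
Qed.

Lemma pnullZ a c c' : pnull c c' -> pnull (fun n => pcZ a (c n)) (fun n => pcZ a (c' n)).
Proof.
move=> h e e0; have a0 := cmod_ge0 a; have a1 : 0 < cmod a + 1 by lra.
have [M hM] := h _ (divr_gt0 e0 a1); exists M => n Mn.
have := hM n Mn; rewrite ltr_pdivlMr//.
by have := pcdZ a (c n) (c' n); have := pcd_ge0 (c n) (c' n); nra.
Qed.

Lemma pcauchyS c : pcauchy c -> pcauchy (fun n => pcS (c n)).
Proof.
move=> h e e0; have [M hM] := h e e0; exists M => n m Mn Mm.
exact: le_lt_trans (pcdS _ _) (hM n m Mn Mm).
Qed.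

Lemma pnullS c c' : pnull c c' -> pnull (fun n => pcS (c n)) (fun n => pcS (c' n)).
Proof.
by move=> h e e0; have [M hM] := h e e0; exists M => n /hM; exact/le_lt_trans/pcdS.
Qed.

Lemma pcauchy_bounded c : pcauchy c -> exists2 K, 0 < K & exists M, forall n, (M <= n)%N -> d (c n) o <= K.
Proof.
move=> h; have [M hM] := h 1 ltr01; have dM := pcd_ge0 (c M) o.
exists (d (c M) o + 1); first by lra.
exists M => n Mn; have := hM n M Mn (leqnn _).
by have := pcd_tri (c M) (c n) o; lra.
Qed.

(** [pcdM] weights the two increments by the sizes of [c1] and [c2'], whence these are the two
    sequences whose eventual bounds enter. *)
Lemma pnullM c1 c1' c2 c2' : pcauchy c1 -> pcauchy c2' -> pnull c1 c1' -> pnull c2 c2' ->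
  pnull (fun n => pcM (c1 n) (c2 n)) (fun n => pcM (c1' n) (c2' n)).
Proof.
move=> b1 b2 h1 h2 e e0.
have [K1 K10 [N1 hN1]] := pcauchy_bounded b1; have [K2 K20 [N2 hN2]] := pcauchy_bounded b2.
have K0 : 0 < K1 + K2 by lra.
have [M1 hM1] := h1 _ (divr_gt0 e0 K0); have [M2 hM2] := h2 _ (divr_gt0 e0 K0).
exists (maxn (maxn M1 M2) (maxn N1 N2)) => n.
rewrite !geq_max => /andP[/andP[/hM1 m1 /hM2 m2] /andP[/hN1 n1 /hN2 n2]].
move: m1 m2; rewrite !ltr_pdivlMr// => m1 m2.
have := pcdM (c1 n) (c2 n) (c1' n) (c2' n).
have := pcd_ge0 (c1 n) (c1' n); have := pcd_ge0 (c2 n) (c2' n).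
move: m1 m2 n1 n2 (pcd_ge0 (c1 n) o) (pcd_ge0 (c2' n) o).
move: (d (c1 n) (c1' n)) (d (c2 n) (c2' n)) (d (c1 n) o) (d (c2' n) o).
move=> a b p q; move: (d _ _) => t m1 m2 n1 n2 p0 q0 b0 a0 tle.
have : p * b <= K1 * b by rewrite ler_wpM2r.
have : a * q <= a * K2 by rewrite ler_wpM2l.
have E1 : K1 * b * (K1 + K2) < K1 * e by rewrite -mulrA ltr_pM2l.
have E2 : K2 * a * (K1 + K2) < K2 * e by rewrite -mulrA ltr_pM2l.
suff : (K1 * b + K2 * a) * (K1 + K2) < e * (K1 + K2) by rewrite ltr_pM2r//; lra.
by lra.
Qed.

Lemma pcauchyM c c' : pcauchy c -> pcauchy c' -> pcauchy (fun n => pcM (c n) (c' n)).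
Proof.
move=> h1 h2 e e0.
have [K1 K10 [N1 hN1]] := pcauchy_bounded h1; have [K2 K20 [N2 hN2]] := pcauchy_bounded h2.
have K0 : 0 < K1 + K2 by lra.
have [M1 hM1] := h1 _ (divr_gt0 e0 K0); have [M2 hM2] := h2 _ (divr_gt0 e0 K0).
exists (maxn (maxn M1 M2) (maxn N1 N2)) => n m.
rewrite !geq_max => /andP[/andP[n1 n2] /andP[/hN1 p1 _]] /andP[/andP[m1 m2] /andP[_ /hN2 q2]].
have := hM1 n m n1 m1; have := hM2 n m n2 m2; rewrite !ltr_pdivlMr// => l2 l1.
have := pcdM (c n) (c' n) (c m) (c' m).
have := pcd_ge0 (c n) (c m); have := pcd_ge0 (c' n) (c' m).
move: l1 l2 p1 q2 (pcd_ge0 (c n) o) (pcd_ge0 (c' m) o).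
move: (d (c n) (c m)) (d (c' n) (c' m)) (d (c n) o) (d (c' m) o).
move=> a b p q; move: (d _ _) => t l1 l2 p1 q2 p0 q0 b0 a0 tle.
have : p * b <= K1 * b by rewrite ler_wpM2r.
have : a * q <= a * K2 by rewrite ler_wpM2l.
have E1 : K1 * b * (K1 + K2) < K1 * e by rewrite -mulrA ltr_pM2l.
have E2 : K2 * a * (K1 + K2) < K2 * e by rewrite -mulrA ltr_pM2l.
suff : (K1 * b + K2 * a) * (K1 + K2) < e * (K1 + K2) by rewrite ltr_pM2r//; lra.
by lra.
Qed.

Definition cD u v := cpi (fun n => pcD (crep u n) (crep v n)).
Definition cZ a u := cpi (fun n => pcZ a (crep u n)).
Definition cM u v := cpi (fun n => pcM (crep u n) (crep v n)).
Definition cS u := cpi (fun n => pcS (crep u n)).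
Definition c0 := cpi (fun=> o).

Lemma cDE c c' : pcauchy c -> pcauchy c' -> cD (cpi c) (cpi c') = cpi (fun n => pcD (c n) (c' n)).
Proof.
move=> hc hc'; apply: cpi_eq; try exact: pcauchyD.
  by apply: pcauchyD; exact: crep_cauchy.
by apply: pnullD; exact: crep_null.
Qed.
Lemma cZE a c : pcauchy c -> cZ a (cpi c) = cpi (fun n => pcZ a (c n)).
Proof.
move=> hc; apply: cpi_eq; try exact: pcauchyZ.
  by apply: pcauchyZ; exact: crep_cauchy.
by apply: pnullZ; exact: crep_null.
Qed.
Lemma cSE c : pcauchy c -> cS (cpi c) = cpi (fun n => pcS (c n)).
Proof.
move=> hc; apply: cpi_eq; try exact: pcauchyS.
  by apply: pcauchyS; exact: crep_cauchy.
by apply: pnullS; exact: crep_null.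
Qed.
Lemma cME c c' : pcauchy c -> pcauchy c' -> cM (cpi c) (cpi c') = cpi (fun n => pcM (c n) (c' n)).
Proof.
move=> hc hc'; apply: cpi_eq; try exact: pcauchyM.
  by apply: pcauchyM; exact: crep_cauchy.
by apply: pnullM => //; try exact: crep_null; exact: crep_cauchy.
Qed.

Hint Resolve pcauchy_cst pcauchyD pcauchyZ pcauchyS pcauchyM : core.

Lemma cDA : associative cD.
Proof.
elim/completion_ind=> u hu; elim/completion_ind=> v hv; elim/completion_ind=> w hw.
rewrite !cDE; auto; apply: cpi_eq; auto.
by apply: pnull_eq => n; exact: pc_addA.
Qed.
Lemma cDC : commutative cD.
Proof.
elim/completion_ind=> u hu; elim/completion_ind=> v hv.
rewrite !cDE; auto; apply: cpi_eq; auto.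
by apply: pnull_eq => n; exact: pc_addC.
Qed.
Lemma c0D : left_id c0 cD.
Proof.
elim/completion_ind=> u hu; rewrite cDE; auto; apply: cpi_eq; auto.
by apply: pnull_eq => n; exact: pc_add0.
Qed.
Lemma cND : left_inverse c0 (cZ (-1)) cD.
Proof.
elim/completion_ind=> u hu; rewrite cZE; auto; rewrite cDE; auto; apply: cpi_eq; auto.
by apply: pnull_eq => n; exact: pc_addN.
Qed.

HB.instance Definition _ := gen_eqMixin completion.
HB.instance Definition _ := gen_choiceMixin completion.
HB.instance Definition _ := GRing.isZmodule.Build completion cDA cDC c0D cND.

Lemma cZA a b u : cZ a (cZ b u) = cZ (a * b) u.
Proof.
elim/completion_ind: u => u hu; rewrite !cZE; auto; apply: cpi_eq; auto.
by apply: pnull_eq => n; exact: pc_scaleA.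
Qed.
Lemma cZ1 : left_id 1 cZ.
Proof.
elim/completion_ind=> u hu; rewrite !cZE; auto; apply: cpi_eq; auto.
by apply: pnull_eq => n; exact: pc_scale1.
Qed.
Lemma cZDr : right_distributive cZ +%R.
Proof.
move=> a; elim/completion_ind=> u hu; elim/completion_ind=> v hv.
rewrite -![_ + _]/(cD _ _) cDE; auto; rewrite !cZE; auto; rewrite cDE; auto.
by apply: cpi_eq; auto; apply: pnull_eq => n; exact: pc_scaleDr.
Qed.
Lemma cZDl u : {morph cZ^~ u : a b / a + b}.
Proof.
elim/completion_ind: u => u hu a b.
rewrite -[cZ a _ + _]/(cD _ _) !cZE; auto; rewrite cDE; auto.
by apply: cpi_eq; auto; apply: pnull_eq => n; exact: pc_scaleDl.
Qed.

HB.instance Definition _ :=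
  GRing.Zmodule_isLmodule.Build R[i] completion cZA cZ1 cZDr cZDl.

Lemma pnorm_cvg c : pcauchy c -> cvg ((fun n => d (c n) o : R) @ \oo).
Proof.
move=> hc; apply: cauchy_cvg; apply: cauchy_exP => e e0.
have [M hM] := hc e e0; exists (d (c M) o), M => // n /= Mn.
rewrite /ball /= ltr_norml; have := hM M n (leqnn _) Mn.
have := pcd_tri (c M) (c n) o; have := pcd_tri (c n) (c M) o.
by rewrite (pcd_sym (c n) (c M)) => *; apply/andP; split; lra.
Qed.

Definition cnrm u : R := lim ((fun n => d (crep u n) o : R) @ \oo).

Lemma cnrm_cvg c : pcauchy c -> (fun n => d (c n) o : R) @ \oo --> cnrm (cpi c).
Proof.
move=> hc; have := pnorm_cvg (crep_cauchy (cpi c)).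
rewrite -/(cnrm (cpi c)) => /cvgrPdist_lt h; apply/cvgrPdist_lt => e e0.
have e2 : 0 < e / 2 by lra.
have [M1 _ hM1] := h _ e2; have [M2 hM2] := crep_null hc e2.
exists (maxn M1 M2) => // n /=; rewrite geq_max => /andP[/hM1 /= + /hM2].
rewrite !ltr_norml => /andP[a1 a2] a3.
have := pcd_tri (c n) (crep (cpi c) n) o; have := pcd_tri (crep (cpi c) n) (c n) o.
by rewrite (pcd_sym (c n) (crep _ n)) => *; rewrite -/(cnrm _) in a1 a2; apply/andP; split; lra.
Qed.

Lemma cnrm_uniq c r : pcauchy c -> (fun n => d (c n) o : R) @ \oo --> r -> cnrm (cpi c) = r.
Proof. by move=> /cnrm_cvg h h'; exact: cvg_unique h h'. Qed.

Lemma cnrm_le c e M : pcauchy c -> (forall n, (M <= n)%N -> d (c n) o <= e) ->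
  cnrm (cpi c) <= e.
Proof.
move=> hc h; apply: (ler_cvg_to (cnrm_cvg hc) (cvg_cst e)).
by exists M => // n /h.
Qed.

Lemma cnrmD u v : cnrm (u + v) <= cnrm u + cnrm v.
Proof.
elim/completion_ind: u => c hc; elim/completion_ind: v => c' hc'.
rewrite -[cpi c + _]/(cD _ _) cDE//.
apply: (ler_cvg_to (cnrm_cvg (pcauchyD hc hc')) (cvgD (cnrm_cvg hc) (cnrm_cvg hc'))).
apply: nearW => n; change (d (pcD (c n) (c' n)) o <= d (c n) o + d (c' n) o).
have := pcd_tri (pcD o o) (pcD (c n) (c' n)) o.
have := pcdD (c n) (c' n) o o; rewrite (pc_add0 o); lra.
Qed.

Lemma cnrmZ a u : cnrm (a *: u) = cmod a * cnrm u.
Proof.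
elim/completion_ind: u => c hc; rewrite -[a *: _]/(cZ _ _) cZE//.
apply: cnrm_uniq; first exact: pcauchyZ.
under eq_fun do rewrite pc_normZ.
exact: cvgMl_tmp (cnrm_cvg hc).
Qed.

Lemma cnrm0_eq0 u : cnrm u = 0 -> u = 0.
Proof.
elim/completion_ind: u => c hc c0'; apply: cpi_eq => //.
move=> e e0; have := cnrm_cvg hc; rewrite c0' => /cvgr0Pnorm_lt /(_ e e0)[M _ hM].
by exists M => n /hM /=; rewrite ger0_norm ?pcd_ge0.
Qed.

Let cnorm u : R[i] := (cnrm u)%:C%C.

Lemma cnorm_triangle u v : cnorm (u + v) <= cnorm u + cnorm v.
Proof. by rewrite /cnorm -rmorphD lecR cnrmD. Qed.
Lemma cnormZ a u : cnorm (a *: u) = `|a| * cnorm u.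
Proof. by rewrite /cnorm cnrmZ cmodE rmorphM. Qed.
Lemma cnorm0_eq0 u : cnorm u = 0 -> u = 0.
Proof. by move=> /complexI/cnrm0_eq0. Qed.

HB.instance Definition _ := Lmodule_isNormed.Build R[i] completion
  cnorm_triangle cnormZ cnorm0_eq0.

Lemma rnorm_cnrm u : rnorm u = cnrm u.
Proof. by []. Qed.

Definition cemb x : completion := cpi (fun=> x).

Lemma rnorm_cemb x : rnorm (cemb x) = d x o.
Proof. by rewrite rnorm_cnrm; apply: cnrm_uniq => //; exact: cvg_cst. Qed.

Lemma cembB_cpi x c : pcauchy c -> cpi c - cemb x = cpi (fun n => pcD (c n) (pcZ (-1) x)).
Proof.
by move=> hc; rewrite -scaleN1r -[_ *: _]/(cZ _ _) -[_ + _]/(cD _ _) /cemb cZE// cDE//; auto.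
Qed.

Lemma cemb_dense u e : 0 < e -> exists x, rnorm (u - cemb x) < e.
Proof.
elim/completion_ind: u => c hc e0.
have [|M hM] := hc (e / 2); first by lra.
exists (c M); rewrite cembB_cpi// rnorm_cnrm.
have hcM : pcauchy (fun n => pcD (c n) (pcZ (-1) (c M))) by auto.
apply: (@le_lt_trans _ _ (e / 2)); last by lra.
apply: (cnrm_le (M := M) hcM) => n Mn; by rewrite pc_distB ltW// hM.
Qed.

Lemma rnorm_cembB x y : rnorm (cemb x - cemb y) = d x y.
Proof.
rewrite {1}/cemb cembB_cpi; last exact: pcauchy_cst.
by rewrite (rnorm_cemb (pcD x (pcZ (-1) y))) pc_distB.
Qed.

(** Diagonal argument: points of [P] chosen within 2^-n of [u n] form a Cauchy sequence, and its
    class is the limit. *)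
Lemma completion_cauchy (u : nat -> completion) : rcauchy u -> exists l, rcvg u l.
Proof.
move=> hu; pose dn n : R := 2^-1 ^+ n.
have dn0 n : 0 < dn n by rewrite exprn_gt0// invr_gt0.
have [x hx] := choice (fun n => cemb_dense (u n) (dn0 n)).
have dn_small e : 0 < e -> exists M, forall n, (M <= n)%N -> dn n < e.
  move=> e0; have [|//|M hM] := @geometric_small R 1 2^-1 e; first by apply/andP; split; lra.
  by exists M => n /hM; rewrite mul1r.
have xc : pcauchy x.
  move=> e e0; have e3 : 0 < e / 3 by lra.
  have [M1 hM1] := hu _ e3; have [M2 hM2] := dn_small _ e3.
  exists (maxn M1 M2) => n m; rewrite !geq_max => /andP[n1 n2] /andP[m1 m2].
  rewrite -rnorm_cembB; have := hM1 n m n1 m1; have := hM2 n n2; have := hM2 m m2.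
  have := hx n; have := hx m; rewrite (rnormBC (u n) (cemb _)).
  have := rnorm_triangle (u n) (cemb (x n)) (cemb (x m)).
  by have := rnorm_triangle (u m) (u n) (cemb (x m)); lra.
exists (cpi x) => e e0; have e2 : 0 < e / 2 by lra.
have [M1 hM1] := xc _ (divr_gt0 e2 (ltr0Sn _ 1)); have [M2 hM2] := dn_small _ e2.
exists (maxn M1 M2) => n; rewrite geq_max => /andP[n1 n2].
have := hx n; have := hM2 n n2; rewrite (rnormBC (u n)).
have : rnorm (cpi x - cemb (x n)) <= e / 2 / 2.
  rewrite cembB_cpi// rnorm_cnrm.
  have hcM : pcauchy (fun m => pcD (x m) (pcZ (-1) (x n))) by auto.
  apply: (cnrm_le (M := M1) hcM) => m Mm; by rewrite pc_distB ltW// hM1.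
by have := rnorm_triangle (cemb (x n)) (cpi x) (u n); lra.
Qed.

HB.instance Definition _ := Uniform_isComplete.Build completion
  (rcauchy_complete completion_cauchy).

Lemma cMA : associative cM.
Proof.
elim/completion_ind=> u hu; elim/completion_ind=> v hv; elim/completion_ind=> w hw.
rewrite !cME; auto; apply: cpi_eq; auto.
by apply: pnull_eq => n; exact: pc_mulA.
Qed.
Lemma cMDl : left_distributive cM +%R.
Proof.
elim/completion_ind=> u hu; elim/completion_ind=> v hv; elim/completion_ind=> w hw.
rewrite -![_ + _]/(cD _ _) cDE; auto; rewrite !cME; auto; rewrite cDE; auto.
by apply: cpi_eq; auto; apply: pnull_eq => n; exact: pc_mulDl.
Qed.
Lemma cMDr : right_distributive cM +%R.
Proof.
elim/completion_ind=> w hw; elim/completion_ind=> u hu; elim/completion_ind=> v hv.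
rewrite -![_ + _]/(cD _ _) cDE; auto; rewrite !cME; auto; rewrite cDE; auto.
by apply: cpi_eq; auto; apply: pnull_eq => n; exact: pc_mulDr.
Qed.
Lemma cMZl (a : R[i]) (u v : completion) : a *: cM u v = cM (a *: u) v.
Proof.
elim/completion_ind: u => u hu; elim/completion_ind: v => v hv.
rewrite -![_ *: _]/(cZ _ _) cZE; auto; rewrite !cME; auto; rewrite cZE; auto.
by apply: cpi_eq; auto; apply: pnull_eq => n; exact: pc_scaleAl.
Qed.
Lemma cMZr (a : R[i]) (u v : completion) : a *: cM u v = cM u (a *: v).
Proof.
elim/completion_ind: u => u hu; elim/completion_ind: v => v hv.
rewrite -![_ *: _]/(cZ _ _) cZE; auto; rewrite !cME; auto; rewrite cZE; auto.
by apply: cpi_eq; auto; apply: pnull_eq => n; exact: pc_scaleAr.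
Qed.
Lemma cSK : involutive cS.
Proof.
elim/completion_ind=> u hu; rewrite !cSE; auto; apply: cpi_eq; auto.
by apply: pnull_eq => n; exact: pc_starK.
Qed.
Lemma cSD : {morph cS : u v / u + v}.
Proof.
elim/completion_ind=> u hu; elim/completion_ind=> v hv.
rewrite -![_ + _]/(cD _ _) cDE; auto; rewrite !cSE; auto; rewrite cDE; auto.
by apply: cpi_eq; auto; apply: pnull_eq => n; exact: pc_starD.
Qed.
Lemma cSZ (a : R[i]) (u : completion) : cS (a *: u) = a^* *: cS u.
Proof.
elim/completion_ind: u => u hu.
rewrite -![_ *: _]/(cZ _ _) cZE; auto; rewrite !cSE; auto; rewrite cZE; auto.
by apply: cpi_eq; auto; apply: pnull_eq => n; exact: pc_starZ.
Qed.
Lemma cSM u v : cS (cM u v) = cM (cS v) (cS u).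
Proof.
elim/completion_ind: u => u hu; elim/completion_ind: v => v hv.
rewrite (cSE hu) (cSE hv) (cME hu hv) cSE; auto; rewrite cME; auto.
by apply: cpi_eq; auto; apply: pnull_eq => n; exact: pc_starM.
Qed.

Lemma pnormM x y : d (pcM x y) o <= d x o * d y o.
Proof.
(* That [o] annihilates is no axiom. But [o o] is at distance 0 from [o (0 o)], hence from
   [0 (o o)], whose seminorm vanishes by [pc_normZ]. *)
have M0 : d (pcM o o) o = 0.
  have h1 := pcdM o o o (pcZ 0 o); rewrite pcdxx !mul0r addr0 in h1.
  have h2 := pc_scaleAr 0 o o; rewrite pcd_sym in h2.
  have h3 := pc_normZ 0 (pcM o o).
  have c0 : cmod (0 : R[i]) = 0 by rewrite /cmod normr0.
  rewrite c0 mul0r in h3.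
  have h4 := pcd_tri (pcM o (pcZ 0 o)) (pcM o o) o.
  have h5 := pcd_tri (pcZ 0 (pcM o o)) (pcM o (pcZ 0 o)) o.
  by apply/eqP; rewrite eq_le pcd_ge0 andbT; lra.
have := pcdM x y o o; have := pcd_tri (pcM o o) (pcM x y) o.
by rewrite M0 pcdxx; lra.
Qed.

Lemma cnrmM u v : cnrm (cM u v) <= cnrm u * cnrm v.
Proof.
elim/completion_ind: u => c hc; elim/completion_ind: v => c' hc'.
rewrite cME//.
apply: (ler_cvg_to (cnrm_cvg (pcauchyM hc hc')) (cvgM (cnrm_cvg hc) (cnrm_cvg hc'))).
apply: nearW => n; exact: pnormM.
Qed.

Lemma cnrm_starM u : cnrm (cM (cS u) u) = cnrm u ^+ 2.
Proof.
elim/completion_ind: u => c hc; rewrite cSE// cME; auto.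
apply: cnrm_uniq; first by auto.
under eq_fun do rewrite pc_norm_starM expr2.
by rewrite expr2; exact: cvgM (cnrm_cvg hc) (cnrm_cvg hc).
Qed.

Lemma cnormM_completion (u v : completion) : `|cM u v| <= `|u| * `|v|.
Proof. by rewrite !rnormE -rmorphM lecR; exact: cnrmM. Qed.

Lemma cnorm_starM_completion (u : completion) : `|cM (cS u) u| = `|u| ^+ 2.
Proof. by rewrite !rnormE -rmorphXn !rnorm_cnrm cnrm_starM. Qed.

HB.instance Definition _ := isCStarAlgebra.Build R completion
  cMA cMDl cMDr cMZl cMZr cSK cSD cSZ cSM cnormM_completion cnorm_starM_completion.

Lemma cstar_completion : exists (C : cstarAlgType R) (i : P -> C),
  [/\ forall x y, i (pcD x y) = i x + i y, forall a x, i (pcZ a x) = a *: i x,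
      forall x y, i (pcM x y) = cmul (i x) (i y), forall x, i (pcS x) = cstar (i x) &
      (forall x, rnorm (i x) = d x o) /\
      forall u e, 0 < e -> exists x, rnorm (u - i x) < e].
Proof.
exists (completion : cstarAlgType R), cemb; split; last 1 first.
- by split; [exact: rnorm_cemb|exact: cemb_dense].
- by move=> x y; rewrite -[RHS]/(cD _ _) cDE.
- by move=> a x; rewrite -[RHS]/(cZ _ _) cZE.
- by move=> x y; rewrite -[RHS]/(cM _ _) cME.
- by move=> x; rewrite -[RHS]/(cS _) cSE.
Qed.

End Completion.

(** * Tensor products of Hilbert spaces *)

Section InnerProduct.
Context {R : realType}.
Implicit Types H : hilbertType R.

Lemma innerDl H (x y z : H) : inner (x + y) z = inner x z + inner y z.
Proof. by have := inner_linearl 1 x y z; rewrite scale1r mul1r. Qed.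
Lemma inner0l H (z : H) : inner 0 z = 0.
Proof. by apply: (addrI (inner 0 z)); rewrite -innerDl !addr0. Qed.
Lemma innerZl H c (x z : H) : inner (c *: x) z = c * inner x z.
Proof. by have := inner_linearl c x 0 z; rewrite inner0l !addr0. Qed.
Lemma innerBl H (x y z : H) : inner (x - y) z = inner x z - inner y z.
Proof. by rewrite innerDl -scaleN1r innerZl mulN1r. Qed.
Lemma innerDr H (x y z : H) : inner z (x + y) = inner z x + inner z y.
Proof. by rewrite inner_conj innerDl rmorphD /= -!inner_conj. Qed.
Lemma inner0r H (z : H) : inner z 0 = 0.
Proof. by rewrite inner_conj inner0l rmorph0. Qed.
Lemma innerZr H c (x z : H) : inner z (c *: x) = c^* * inner z x.
Proof. by rewrite inner_conj innerZl rmorphM /= -inner_conj. Qed.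
Lemma innerBr H (x y z : H) : inner z (x - y) = inner z x - inner z y.
Proof. by rewrite inner_conj innerBl rmorphB /= -!inner_conj. Qed.
Lemma inner_suml H (I : Type) (r : seq I) (F : I -> H) z :
  inner (\sum_(i <- r) F i) z = \sum_(i <- r) inner (F i) z.
Proof. by elim: r => [|i r IH]; rewrite ?big_nil ?inner0l// !big_cons innerDl IH. Qed.
Lemma inner_sumr H (I : Type) (r : seq I) (F : I -> H) z :
  inner z (\sum_(i <- r) F i) = \sum_(i <- r) inner z (F i).
Proof. by elim: r => [|i r IH]; rewrite ?big_nil ?inner0r// !big_cons innerDr IH. Qed.
Lemma inner_ge0 H (x : H) : 0 <= inner x x.
Proof. by rewrite inner_norm exprn_ge0. Qed.
Lemma inner_eq0 H (x : H) : inner x x = 0 -> x = 0.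
Proof. by rewrite inner_norm => /eqP; rewrite expf_eq0 /= => /eqP/normr0_eq0. Qed.

End InnerProduct.

Section TensorForm.
Context {R : realType} {H K : hilbertType R}.
Implicit Types s t : seq (H * K).

(** The inner product of the Hilbert space tensor product, evaluated on lists. Different lists can
    stand for the same tensor; instead of a quotient, lists are compared by their values under this
    form. *)
Definition tform s t : R[i] :=
  \sum_(y <- s) \sum_(z <- t) inner y.1 z.1 * inner y.2 z.2.

Definition tscale (X Y : lmodType R[i]) (c : R[i]) (s : seq (X * Y)) :=
  [seq (c *: y.1, y.2) | y <- s].

Lemma tform_catl s s' t : tform (s ++ s') t = tform s t + tform s' t.
Proof. by rewrite /tform big_cat. Qed.

Lemma tform_conj s t : tform t s = (tform s t)^*.
Proof.
rewrite /tform exchange_big rmorph_sum /=; apply: eq_bigr => y _.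
rewrite rmorph_sum /=; apply: eq_bigr => z _.
by rewrite rmorphM /= -!inner_conj.
Qed.

Lemma tform_catr s t t' : tform s (t ++ t') = tform s t + tform s t'.
Proof. by rewrite tform_conj tform_catl rmorphD /= -!tform_conj. Qed.

Lemma tform_scalel c s t : tform (tscale c s) t = c * tform s t.
Proof.
rewrite /tform big_map mulr_sumr; apply: eq_bigr => y _.
by rewrite mulr_sumr; apply: eq_bigr => z _; rewrite innerZl mulrA.
Qed.

Lemma tform_scaler c s t : tform s (tscale c t) = c^* * tform s t.
Proof. by rewrite tform_conj tform_scalel rmorphM /= -tform_conj. Qed.

(* Schur's product theorem: splitting off the component of every [y.2] along the
   first one, [k], leaves a nonnegative rank one term and a shorter list. *)
Lemma tform_ge0 s : 0 <= tform s s.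
Proof.
have [n sn] := ubnP (size s); elim: n s sn => // n IH [|[h k] s] /= sn.
  by rewrite /tform big_nil.
pose S := (h, k) :: s; pose al (y : H * K) := inner y.2 k / inner k k.
have alE (y : H * K) : inner y.2 k = al y * inner k k.
  have [k0|k0] := eqVneq (inner k k) 0; last by rewrite /al divfK.
  by rewrite (inner_eq0 k0) !inner0r mulr0.
have alE' (y : H * K) : inner k y.2 = (al y)^* * inner k k.
  by rewrite inner_conj alE rmorphM /= -inner_conj.
pose pr (y : H * K) := y.2 - al y *: k.
have prE (y z : H * K) : inner y.2 z.2 = al y * (al z)^* * inner k k + inner (pr y) (pr z).
  rewrite /pr innerBl !innerBr !innerZl !innerZr alE alE'; ring.
have pr0 : pr (h, k) = 0.
  rewrite /pr /al /=; have [k0|k0] := eqVneq (inner k k) 0.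
    by rewrite (inner_eq0 k0) scaler0 subrr.
  by rewrite divff// scale1r subrr.
pose v := \sum_(y <- S) al y *: y.1.
pose s' := [seq (y.1, pr y) | y <- s].
suff -> : tform S S = inner k k * inner v v + tform s' s'.
  by rewrite addr_ge0 ?mulr_ge0 ?inner_ge0// IH ?size_map.
have -> : tform S S = \sum_(y <- S) \sum_(z <- S)
    inner k k * (al y * (al z)^* * inner y.1 z.1) +
    \sum_(y <- S) \sum_(z <- S) inner y.1 z.1 * inner (pr y) (pr z).
  rewrite -big_split /=; apply: eq_bigr => y _; rewrite -big_split /=.
  by apply: eq_bigr => z _; rewrite prE; ring.
congr (_ + _).
  rewrite /v inner_suml mulr_sumr; apply: eq_bigr => y _.
  rewrite inner_sumr mulr_sumr; apply: eq_bigr => z _.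
  by rewrite innerZl innerZr; ring.
rewrite big_cons big1 ?add0r => [|z _]; last by rewrite pr0 inner0l mulr0.
rewrite /tform big_map; apply: eq_bigr => y _.
by rewrite big_cons pr0 inner0r mulr0 add0r big_map.
Qed.

Local Notation hn := (@htensor_norm R H K).

Lemma hn_ge0 s : 0 <= hn s. Proof. exact: sqrtr_ge0. Qed.

Lemma hn_sqr s : tform s s = (hn s ^+ 2)%:C%C.
Proof.
have s0 := tform_ge0 s; rewrite /htensor_norm sqr_sqrtr.
  by rewrite -/(tform s s) RRe_real// ger0_real.
by move: s0; rewrite lecE => /andP[].
Qed.

Lemma hn_sqrE s : hn s ^+ 2 = complex.Re (tform s s).
Proof. by rewrite hn_sqr. Qed.

Lemma hn_le s s' : complex.Re (tform s s) <= complex.Re (tform s' s') -> hn s <= hn s'.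
Proof. by rewrite -!hn_sqrE ler_pXn2r ?nnegrE ?hn_ge0. Qed.

Lemma hn_scale c s : hn (tscale c s) = cmod c * hn s.
Proof.
apply/eqP; rewrite -(eqrXn2 (n := 2)) ?hn_ge0 ?mulr_ge0 ?cmod_ge0 ?hn_ge0//; apply/eqP.
apply: complexI; rewrite -hn_sqr tform_scalel tform_scaler hn_sqr mulrA -normCK.
by rewrite cmodE exprMn [RHS]rmorphM; congr (_ * _); rewrite rmorphXn.
Qed.

Lemma tform_CS s t : cmod (tform s t) <= hn s * hn t.
Proof.
set m := cmod _; set S := hn s; set T := hn t.
(* Nonnegativity of the form at s - l <s, t> t for real [l]. *)
have P (l : R) : 0 <= S ^+ 2 - 2 * l * m ^+ 2 + l ^+ 2 * m ^+ 2 * T ^+ 2.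
  pose c : R[i] := - (l%:C%C * tform s t).
  have mE : tform s t * (tform s t)^* = (m ^+ 2)%:C%C by rewrite -normCK cmodE rmorphXn.
  have lc : (l%:C%C)^* = l%:C%C by rewrite conj_Creal// complex_real.
  have := tform_ge0 (s ++ tscale c t).
  rewrite tform_catl !tform_catr !tform_scalel !tform_scaler !hn_sqr.
  have -> : tform t s = (tform s t)^* by rewrite tform_conj.
  rewrite /c !rmorphN !rmorphM /= lc -/S -/T.
  set z := tform s t in mE *; set zc := z^* in mE *.
  rewrite [X in 0 <= X](_ : _ = (S ^+ 2)%:C%C - 2 * (l%:C%C * (z * zc)) +
      l%:C%C * l%:C%C * (z * zc) * (T ^+ 2)%:C%C); last by ring.
  rewrite mE.
  have -> : (S ^+ 2)%:C%C - 2 * (l%:C%C * (m ^+ 2)%:C%C) + l%:C%C * l%:C%C * (m ^+ 2)%:C%C * (T ^+ 2)%:C%C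
    = (S ^+ 2 - 2 * l * m ^+ 2 + l ^+ 2 * m ^+ 2 * T ^+ 2)%:C%C :> R[i].
    move: (S ^+ 2) (m ^+ 2) (T ^+ 2) => a b e; rewrite expr2.
    by apply/eqP; rewrite eq_complex /=; apply/andP; split; apply/eqP; ring.
  by rewrite ler0c.
have m0 : 0 <= m := cmod_ge0 _; have S0 : 0 <= S := hn_ge0 s; have T0 : 0 <= T := hn_ge0 t.
rewrite -(ler_pXn2r (n := 2))// ?nnegrE ?mulr_ge0// exprMn.
have [->|mn] := eqVneq m 0; first by rewrite expr0n /= mulr_ge0// sqr_ge0.
have mp : 0 < m ^+ 2 by rewrite exprn_gt0// lt_neqAle eq_sym mn.
(* The form may be degenerate. When [T = 0], the chosen [l] turns [P] into [0 <= -1]; otherwise the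
   minimiser [T ^- 2] gives the inequality. *)
have [T1|Tn] := eqVneq T 0.
  have := P ((S ^+ 2 + 1) / (2 * m ^+ 2)); rewrite T1 expr0n /= mulr0 addr0.
  have -> : 2 * ((S ^+ 2 + 1) / (2 * m ^+ 2)) * m ^+ 2 = S ^+ 2 + 1.
    by field; rewrite mn.
  by lra.
have Tp : 0 < T ^+ 2 by rewrite exprn_gt0// lt_neqAle eq_sym Tn.
have := P (T ^- 2).
have -> : S ^+ 2 - 2 * T ^- 2 * m ^+ 2 + T ^- 2 ^+ 2 * m ^+ 2 * T ^+ 2 =
  (S ^+ 2 * T ^+ 2 - m ^+ 2) / T ^+ 2 by field; rewrite Tn.
by rewrite pmulr_lge0 ?invr_gt0// subr_ge0.
Qed.

Lemma hn_cat s t : hn (s ++ t) <= hn s + hn t.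
Proof.
rewrite -(ler_pXn2r (n := 2))// ?nnegrE ?addr_ge0 ?hn_ge0// hn_sqrE.
rewrite tform_catl !tform_catr (tform_conj s t) !hn_sqr.
have := tform_CS s t; have : complex.Re (tform s t) <= cmod (tform s t).
  have := normc_ge_Re (tform s t); rewrite cmodE lecR; exact/le_trans/ler_norm.
have -> : complex.Re ((hn s ^+ 2)%:C%C + tform s t + ((tform s t)^* + (hn t ^+ 2)%:C%C))
   = hn s ^+ 2 + 2 * complex.Re (tform s t) + hn t ^+ 2.
  by case: (tform s t) => a b /=; ring.
nra.
Qed.

Lemma hn_ext s s' : (forall t, tform s t = tform s' t) -> hn s = hn s'.
Proof.
move=> E; have E' : tform s s = tform s' s' by rewrite E tform_conj E -tform_conj.
by rewrite /htensor_norm -/(tform s s) E'.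
Qed.

Lemma hn_nil : hn [::] = 0.
Proof. by rewrite /htensor_norm big_nil sqrtr0. Qed.

(** The hypothesis is f*f + g*g = 1 in weak form. It splits the squared norm of [s] into those of
    its images under f and g acting on the first leg, both nonnegative. *)
Lemma hn_contract1 (f g : H -> H) s :
  (forall h h', inner (f h) (f h') + inner (g h) (g h') = inner h h') ->
  hn [seq (f y.1, y.2) | y <- s] <= hn s.
Proof.
move=> fg; apply: hn_le.
have -> : tform s s = tform [seq (f y.1, y.2) | y <- s] [seq (f y.1, y.2) | y <- s] +
    tform [seq (g y.1, y.2) | y <- s] [seq (g y.1, y.2) | y <- s].
  rewrite /tform !big_map -big_split /=; apply: eq_bigr => y _.
  rewrite !big_map -big_split /=; apply: eq_bigr => z _.
  by rewrite -mulrDl fg.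
by rewrite !hn_sqr -rmorphD /= lerDl sqr_ge0.
Qed.

Lemma hn_contract2 (f g : K -> K) s :
  (forall h h', inner (f h) (f h') + inner (g h) (g h') = inner h h') ->
  hn [seq (y.1, f y.2) | y <- s] <= hn s.
Proof.
move=> fg; apply: hn_le.
have -> : tform s s = tform [seq (y.1, f y.2) | y <- s] [seq (y.1, f y.2) | y <- s] +
    tform [seq (y.1, g y.2) | y <- s] [seq (y.1, g y.2) | y <- s].
  rewrite /tform !big_map -big_split /=; apply: eq_bigr => y _.
  rewrite !big_map -big_split /=; apply: eq_bigr => z _.
  by rewrite -mulrDr fg.
by rewrite !hn_sqr -rmorphD /= lerDl sqr_ge0.
Qed.

End TensorForm.

(** * The minimal tensor norm *)

Section Representations.
Context {R : realType} {A : cstarAlgType R} {H : hilbertType R} {p : A -> H -> H}.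
Hypothesis rp : cstar_rep p.

Lemma repD a b h : p (a + b) h = p a h + p b h.
Proof. by case: rp => _ /(_ 1 a b h) + _ _; rewrite !scale1r. Qed.
Lemma rep0 h : p 0 h = 0.
Proof. by apply: (addrI (p 0 h)); rewrite -repD !addr0. Qed.
Lemma repZ c a h : p (c *: a) h = c *: p a h.
Proof. by case: rp => _ /(_ c a 0 h) + _ _; rewrite rep0 !addr0. Qed.
Lemma repM a b h : p (cmul a b) h = p a (p b h).
Proof. by case: rp. Qed.
Lemma repS a h k : inner (p a h) k = inner h (p (cstar a) k).
Proof. by case: rp. Qed.

(** The map g is 1 - p c with c = 1 - sqrt(1 - a*a), so that g*g = 1 - p(a)*p(a). A complement g of
    this kind is what makes the action on one tensor leg contractive. *)
Lemma rep_contractive a : rnorm a < 1 -> exists g : H -> H,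
  forall h h', inner (p a h) (p a h') + inner (g h) (g h') = inner h h'.
Proof.
move=> a1; have [||c [cs cc _]] := @half_square_fixpoint R A (cmul (cstar a) a).
- by rewrite cstarM cstarK.
- by rewrite rnorm_starM; have := rnorm_ge0 a; nra.
exists (fun h => h - p c h) => h h'.
rewrite innerBl !innerBr !repS !cs -!repM.
have := congr1 (fun x => inner h (p x h')) cc; rewrite !repD !innerDr => E.
have -> : inner h (p (cmul (cstar a) a) h') =
  inner h (p c h') + inner h (p c h') - inner h (p (cmul c c) h') by rewrite E addrK.
ring.
Qed.

End Representations.

Section TensorAction.
Context {R : realType} {A B : cstarAlgType R}.
Implicit Types x y z : seq (A * B).

Definition tmul x y : seq (A * B) :=
  [seq (cmul u.1 v.1, cmul u.2 v.2) | u <- x, v <- y].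
Definition tstar x : seq (A * B) := [seq (cstar u.1, cstar u.2) | u <- x].

Section OneRepresentation.
Context {H K : hilbertType R} {p : A -> H -> H} {q : B -> K -> K}.
Hypotheses (rp : cstar_rep p) (rq : cstar_rep q).
Implicit Types s t : seq (H * K).
Local Notation act := (tensor_act p q).

Lemma tform_act x s t : tform (act x s) t =
  \sum_(u <- x) \sum_(y <- s) \sum_(z <- t) inner (p u.1 y.1) z.1 * inner (q u.2 y.2) z.2.
Proof. by rewrite /tform /tensor_act big_allpairs_dep. Qed.

Lemma tform_adj x s t : tform (act x s) t = tform s (act (tstar x) t).
Proof.
rewrite tform_act /tform exchange_big; apply: eq_bigr => y _.
rewrite /tensor_act big_allpairs_dep big_map; apply: eq_bigr => u _.
by apply: eq_bigr => z _ /=; rewrite (repS rp) (repS rq).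
Qed.

Lemma tform_actD x y s t :
  tform (act (x ++ y) s) t = tform (act x s) t + tform (act y s) t.
Proof. by rewrite !tform_act big_cat. Qed.

Lemma tform_act0 s t : tform (act [::] s) t = 0.
Proof. by rewrite tform_act big_nil. Qed.

Lemma tform_actZ c x s t : tform (act (tscale c x) s) t = c * tform (act x s) t.
Proof.
rewrite !tform_act big_map mulr_sumr; apply: eq_bigr => u _.
rewrite mulr_sumr; apply: eq_bigr => y _; rewrite mulr_sumr; apply: eq_bigr => z _ /=.
by rewrite (repZ rp) innerZl mulrA.
Qed.

Lemma tform_actM x y s t : tform (act (tmul x y) s) t = tform (act x (act y s)) t.
Proof.
rewrite !tform_act big_allpairs_dep; apply: eq_bigr => u _.
rewrite /tensor_act big_allpairs_dep; apply: eq_bigr => v _; apply: eq_bigr => w _.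
by apply: eq_bigr => z _ /=; rewrite (repM rp) (repM rq).
Qed.

Lemma tform_actM' x y s t :
  tform (act (tmul x y) s) t = tform (act y s) (act (tstar x) t).
Proof. by rewrite tform_actM tform_adj. Qed.

Lemma tform_actS x s t : tform (act (tstar x) s) t = (tform (act x t) s)^*.
Proof. by rewrite tform_conj -tform_adj. Qed.

(** [rep_contractive] asks for norm strictly below 1, so [a] is rescaled by an arbitrary [r] above
    its norm, and [r] then decreases to it. *)
Lemma hn_act1 a s : htensor_norm [seq (p a w.1, w.2) | w <- s] <= rnorm a * htensor_norm s.
Proof.
have hs := hn_ge0 s.
suff h r : rnorm a < r -> htensor_norm [seq (p a w.1, w.2) | w <- s] <= r * htensor_norm s.
  apply/ler_addgt0Pr => e e0; have hs1 : 0 < htensor_norm s + 1 by lra.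
  apply: le_trans (h (rnorm a + e / (htensor_norm s + 1)) _) _.
    by rewrite ltrDl divr_gt0.
  rewrite mulrDl lerD2l mulrAC ler_pdivrMr// ler_wpM2l ?(ltW e0)//; lra.
move=> ar; have r0 : 0 < r := le_lt_trans (rnorm_ge0 a) ar.
have ri0 : 0 <= r^-1 by rewrite invr_ge0 ltW.
have [|g hg] := rep_contractive rp (a := (r^-1)%:C%C *: a).
  by rewrite rnormZ cmodC// ltr_pdivrMl// mulr1.
have := hn_contract1 s hg.
have -> : [seq (p ((r^-1)%:C%C *: a) w.1, w.2) | w <- s] =
    tscale (r^-1)%:C%C [seq (p a w.1, w.2) | w <- s].
  by rewrite /tscale -map_comp; apply: eq_map => y /=; rewrite (repZ rp).
by rewrite hn_scale cmodC// ler_pdivrMl.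
Qed.

Lemma hn_act2 b s : htensor_norm [seq (w.1, q b w.2) | w <- s] <= rnorm b * htensor_norm s.
Proof.
have hs := hn_ge0 s.
suff h r : rnorm b < r -> htensor_norm [seq (w.1, q b w.2) | w <- s] <= r * htensor_norm s.
  apply/ler_addgt0Pr => e e0; have hs1 : 0 < htensor_norm s + 1 by lra.
  apply: le_trans (h (rnorm b + e / (htensor_norm s + 1)) _) _.
    by rewrite ltrDl divr_gt0.
  rewrite mulrDl lerD2l mulrAC ler_pdivrMr// ler_wpM2l ?(ltW e0)//; lra.
move=> br; have r0 : 0 < r := le_lt_trans (rnorm_ge0 b) br.
have ri0 : 0 <= r^-1 by rewrite invr_ge0 ltW.
have [|g hg] := rep_contractive rq (a := (r^-1)%:C%C *: b).
  by rewrite rnormZ cmodC// ltr_pdivrMl// mulr1.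
have := hn_contract2 s hg.
have -> : htensor_norm [seq (w.1, q ((r^-1)%:C%C *: b) w.2) | w <- s] =
    htensor_norm (tscale (r^-1)%:C%C [seq (w.1, q b w.2) | w <- s]).
  apply: hn_ext => t; rewrite tform_scalel /tform !big_map mulr_sumr.
  apply: eq_bigr => y _; rewrite mulr_sumr; apply: eq_bigr => z _ /=.
  by rewrite (repZ rq) innerZl mulrCA.
by rewrite hn_scale cmodC// ler_pdivrMl.
Qed.

Definition cross_norm x : R := \sum_(u <- x) rnorm u.1 * rnorm u.2.

Lemma hn_act_le x s : htensor_norm (act x s) <= cross_norm x * htensor_norm s.
Proof.
rewrite /cross_norm; elim: x => [|u x IH].
  by rewrite big_nil mul0r /tensor_act /= hn_nil.
rewrite big_cons mulrDl; apply: le_trans (hn_cat _ _) (lerD _ IH).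
have -> : [seq (p u.1 w.1, q u.2 w.2) | w <- s] =
  [seq (p u.1 w.1, w.2) | w <- [seq (w.1, q u.2 w.2) | w <- s]].
  by rewrite -map_comp.
apply: le_trans (hn_act1 _ _) _; rewrite -mulrA ler_wpM2l ?rnorm_ge0//.
exact: hn_act2.
Qed.

Lemma tensor_opnormP x : has_sup [set htensor_norm (act x s) |
       s in [set s : seq (H * K) | htensor_norm s <= 1]].
Proof.
split; first by exists (htensor_norm (act x [::])), [::]; rewrite //= hn_nil.
exists (cross_norm x) => _ [s /= s1 <-]; apply: le_trans (hn_act_le x s) _.
rewrite ler_piMr// sumr_ge0// => u _; rewrite mulr_ge0 ?rnorm_ge0//.
Qed.

Lemma tensor_opnorm_le x M : 0 <= M ->
  (forall s, htensor_norm (act x s) <= M * htensor_norm s) -> tensor_opnorm p q x <= M.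
Proof.
move=> M0 h; apply: ge_sup; first by have [] := tensor_opnormP x.
by move=> _ [s /= s1 <-]; apply: le_trans (h s) _; rewrite ler_piMr.
Qed.

Lemma act_tscale c x s t : tform (act x (tscale c s)) t = tform (tscale c (act x s)) t.
Proof.
rewrite tform_adj tform_scalel -tform_adj //; first by rewrite tform_scalel.
Qed.

Lemma tensor_opnorm_ub x s : htensor_norm (act x s) <= tensor_opnorm p q x * htensor_norm s.
Proof.
(* A null list cannot be normalised; the crude bound [hn_act_le] already shows that its image is
   null. *)
have [s0|sn] := eqVneq (htensor_norm s) 0.
  by have := hn_act_le x s; rewrite s0 !mulr0.
have sp : 0 < htensor_norm s by rewrite lt_neqAle eq_sym sn hn_ge0.
have si : 0 <= (htensor_norm s)^-1 by rewrite invr_ge0 hn_ge0.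
have : htensor_norm (act x (tscale ((htensor_norm s)^-1)%:C%C s)) <= tensor_opnorm p q x.
  apply: ub_le_sup; first by have [] := tensor_opnormP x.
  by exists (tscale ((htensor_norm s)^-1)%:C%C s) => //=; rewrite hn_scale cmodC// mulVf.
rewrite (hn_ext (act_tscale _ x s)) hn_scale cmodC// ler_pdivrMl//.
by rewrite mulrC.
Qed.

End OneRepresentation.

Lemma cross_norm_ge0 x : 0 <= cross_norm x.
Proof. by rewrite sumr_ge0// => u _; rewrite mulr_ge0 ?rnorm_ge0. Qed.

Lemma min_norm_le x M : 0 <= M ->
  (forall (H K : hilbertType R) (p : A -> H -> H) (q : B -> K -> K),
    cstar_rep p -> cstar_rep q -> forall s,
    htensor_norm (tensor_act p q x s) <= M * htensor_norm s) -> min_norm x <= M.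
Proof.
move=> M0 h; rewrite /min_norm; set S := [set r | _].
(* The supremum of the empty set is 0, so [0 <= M] settles that case without exhibiting a
   representation. *)
have [[r Sr]|S0] := pselect (S !=set0).
  apply: ge_sup; first by exists r.
  by move=> _ [H [K [p [q [rp rq ->]]]]]; apply: tensor_opnorm_le => //; exact: h.
by rewrite sup_out// => -[].
Qed.

Lemma min_norm_ub x (H K : hilbertType R) (p : A -> H -> H) (q : B -> K -> K) :
  cstar_rep p -> cstar_rep q -> forall s,
  htensor_norm (tensor_act p q x s) <= min_norm x * htensor_norm s.
Proof.
move=> rp rq s; apply: le_trans (tensor_opnorm_ub rp rq x s) _.
rewrite ler_wpM2r ?hn_ge0//; apply: ub_le_sup; last by exists H, K, p, q.
exists (cross_norm x) => _ [H' [K' [p' [q' [rp' rq' ->]]]]].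
by apply: tensor_opnorm_le => //; [exact: cross_norm_ge0|exact: hn_act_le].
Qed.

Lemma min_norm_ge0 x : 0 <= min_norm x.
Proof.
rewrite /min_norm; set S := [set r | _].
have [[r Sr]|S0] := pselect (S !=set0); last by rewrite sup_out// => -[].
have bS : has_ubound S.
  exists (cross_norm x) => _ [H' [K' [p' [q' [rp' rq' ->]]]]].
  by apply: tensor_opnorm_le => //; [exact: cross_norm_ge0|exact: hn_act_le].
apply: le_trans (ub_le_sup bS Sr); case: Sr => H [K [p [q [rp rq ->]]]].
apply: (@le_trans _ _ (htensor_norm (tensor_act p q x [::]))); first exact: hn_ge0.
apply: ub_le_sup; first by have [] := tensor_opnormP rp rq x.
by exists [::]; rewrite //= hn_nil.
Qed.

Lemma min_norm_cross x : min_norm x <= cross_norm x.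
Proof. by apply: min_norm_le; [exact: cross_norm_ge0|move=> *; exact: hn_act_le]. Qed.

(** This replaces the bilinear relations of the algebraic tensor product: two lists are identified
    when no pair of representations separates them. *)
Definition tequiv x y := forall (H K : hilbertType R) (p : A -> H -> H) (q : B -> K -> K),
  cstar_rep p -> cstar_rep q -> forall s t,
  tform (tensor_act p q x s) t = tform (tensor_act p q y s) t.

Lemma min_norm_ext x y : tequiv x y -> min_norm x = min_norm y.
Proof.
have le x' y' : tequiv x' y' -> min_norm x' <= min_norm y'.
  move=> E; apply: min_norm_le; first exact: min_norm_ge0.
  move=> H K p q rp rq s; rewrite (hn_ext (E H K p q rp rq s)).
  exact: min_norm_ub.
move=> E; apply/eqP; rewrite eq_le !le// => H K p q rp rq s t.
by rewrite E.
Qed.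

Lemma min_norm0 : min_norm ([::] : seq (A * B)) = 0.
Proof.
apply/eqP; rewrite eq_le min_norm_ge0 andbT; apply: le_trans (min_norm_cross _) _.
by rewrite /cross_norm big_nil.
Qed.

Lemma min_normD x y : min_norm (x ++ y) <= min_norm x + min_norm y.
Proof.
apply: min_norm_le; first by rewrite addr_ge0 ?min_norm_ge0.
move=> H K p q rp rq s; rewrite mulrDl /tensor_act map_cat flatten_cat.
apply: le_trans (hn_cat _ _) _.
by rewrite lerD//; exact: (min_norm_ub _ rp rq).
Qed.

Lemma hn_actZ c x (H K : hilbertType R) (p : A -> H -> H) (q : B -> K -> K) s :
  cstar_rep p -> cstar_rep q ->
  htensor_norm (tensor_act p q (tscale c x) s) = cmod c * htensor_norm (tensor_act p q x s).
Proof.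
move=> rp rq; rewrite -hn_scale; apply: hn_ext => t.
by rewrite tform_actZ// tform_scalel.
Qed.

Lemma min_normZ c x : min_norm (tscale c x) = cmod c * min_norm x.
Proof.
have le c' x' : min_norm (tscale c' x') <= cmod c' * min_norm x'.
  apply: min_norm_le; first by rewrite mulr_ge0 ?cmod_ge0 ?min_norm_ge0.
  move=> H K p q rp rq s; rewrite hn_actZ// -mulrA ler_wpM2l ?cmod_ge0//.
  exact: min_norm_ub.
apply/eqP; rewrite eq_le le /=.
have [->|c0] := eqVneq c 0; first by rewrite /cmod normr0 mul0r min_norm_ge0.
have cV : cmod c^-1 * cmod c = 1 by rewrite -cmodM mulVf// /cmod normr1.
have := le c^-1 (tscale c x).
have -> : tscale c^-1 (tscale c x) = x.
  rewrite /tscale -map_comp -[RHS]map_id; apply: eq_map => -[a b] /=.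
  by rewrite scalerA mulVf// scale1r.
move=> h; rewrite -[leRHS]mul1r -cV (mulrC _ (cmod c)) -mulrA ler_wpM2l ?cmod_ge0//.
Qed.

Lemma min_normM x y : min_norm (tmul x y) <= min_norm x * min_norm y.
Proof.
apply: min_norm_le; first by rewrite mulr_ge0 ?min_norm_ge0.
move=> H K p q rp rq s; rewrite (hn_ext (tform_actM rp rq x y s)).
apply: le_trans (min_norm_ub _ rp rq _) _.
by rewrite -mulrA ler_wpM2l ?min_norm_ge0//; exact: min_norm_ub.
Qed.

(** With u = x* s, |u|^2 = <s, x u> <= |s| |x| |u|, and a factor |u| cancels. *)
Lemma min_norm_star_le x : min_norm (tstar x) <= min_norm x.
Proof.
apply: min_norm_le; first exact: min_norm_ge0.
move=> H K p q rp rq s; set u := tensor_act p q (tstar x) s.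
have [->|un] := eqVneq (htensor_norm u) 0; first by rewrite mulr_ge0 ?min_norm_ge0 ?hn_ge0.
have up : 0 < htensor_norm u by rewrite lt_neqAle eq_sym un hn_ge0.
rewrite -(ler_pM2l up) -expr2.
have -> : htensor_norm u ^+ 2 = cmod (tform s (tensor_act p q x u)).
  by rewrite (tform_conj (tensor_act p q x u) s) -tform_actS// -/u hn_sqr cmodC ?sqr_ge0.
apply: le_trans (tform_CS _ _) _.
have := min_norm_ub x rp rq u; have := hn_ge0 s; nra.
Qed.

Lemma tstarK : involutive tstar.
Proof.
move=> x; rewrite /tstar -map_comp -[RHS]map_id; apply: eq_map => -[a b] /=.
by rewrite !cstarK.
Qed.

(** Each pair of representations satisfies |x s|^2 = <x*x s, s> <= |x*x| |s|^2, which survives the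
    supremum; the converse is submultiplicativity. *)
Lemma min_norm_starM x : min_norm (tmul (tstar x) x) = min_norm x ^+ 2.
Proof.
have m0 := min_norm_ge0 x; apply/eqP; rewrite eq_le; apply/andP; split.
  apply: le_trans (min_normM _ _) _; rewrite expr2 ler_wpM2r//.
  exact: min_norm_star_le.
set M := min_norm (tmul _ _); have M0 : 0 <= M := min_norm_ge0 _.
rewrite -[leRHS](sqr_sqrtr M0) ler_pXn2r ?nnegrE ?sqrtr_ge0//.
apply: min_norm_le; first exact: sqrtr_ge0.
move=> H K p q rp rq s; rewrite -(ler_pXn2r (n := 2)) ?nnegrE ?mulr_ge0 ?sqrtr_ge0 ?hn_ge0//.
rewrite exprMn (sqr_sqrtr M0).
have -> : htensor_norm (tensor_act p q x s) ^+ 2 =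
    cmod (tform (tensor_act p q (tmul (tstar x) x) s) s).
  rewrite tform_actM' // tstarK hn_sqr cmodC ?sqr_ge0//.
apply: le_trans (tform_CS _ _) _; rewrite expr2 mulrA ler_wpM2r ?hn_ge0//.
exact: min_norm_ub.
Qed.

Definition tdist x y : R := min_norm (x ++ tscale (-1) y).

Lemma tequiv_dist0 x y : tequiv x y -> tdist x y = 0.
Proof.
move=> E; rewrite -min_norm0; apply: min_norm_ext => H K p q rp rq s t.
by rewrite tform_actD tform_actZ// tform_act0 E// mulN1r subrr.
Qed.

End TensorAction.

(** * Existence and functoriality of the minimal tensor product *)

Section MinTensor.
Context {R : realType}.

Section PreTensor.
Variables A B : cstarAlgType R.
Implicit Types x y z : seq (A * B).

Lemma tdist0 x : tdist x [::] = min_norm x.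
Proof. by rewrite /tdist cats0. Qed.

Lemma tdist_ext x y z : tequiv (x ++ tscale (-1) y) z -> tdist x y = min_norm z.
Proof. exact: min_norm_ext. Qed.

Lemma tdist_triangle y x z : tdist x z <= tdist x y + tdist y z.
Proof.
rewrite (@tdist_ext _ _ ((x ++ tscale (-1) y) ++ (y ++ tscale (-1) z))) ?min_normD//.
by move=> H K p q rp rq s t; rewrite !tform_actD !tform_actZ//; ring.
Qed.

Lemma tdist_sym x y : tdist x y = tdist y x.
Proof.
rewrite (@tdist_ext _ _ (tscale (-1) (y ++ tscale (-1) x))).
  by rewrite min_normZ cmodN1 mul1r.
by move=> H K p q rp rq s t; rewrite !(tform_actD, tform_actZ)//; ring.
Qed.

Lemma tdistD x y x' y' : tdist (x ++ y) (x' ++ y') <= tdist x x' + tdist y y'.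
Proof.
rewrite (@tdist_ext _ _ ((x ++ tscale (-1) x') ++ (y ++ tscale (-1) y'))) ?min_normD//.
by move=> H K p q rp rq s t; rewrite !(tform_actD, tform_actZ)//; ring.
Qed.

Lemma tdistZ c x y : tdist (tscale c x) (tscale c y) <= cmod c * tdist x y.
Proof.
rewrite (@tdist_ext _ _ (tscale c (x ++ tscale (-1) y))) ?min_normZ//.
by move=> H K p q rp rq s t; rewrite !(tform_actD, tform_actZ)//; ring.
Qed.

Lemma tdistM x y x' y' : tdist (tmul x y) (tmul x' y') <=
  tdist x [::] * tdist y y' + tdist x x' * tdist y' [::].
Proof.
rewrite !tdist0 (@tdist_ext _ _ (tmul x (y ++ tscale (-1) y') ++ tmul (x ++ tscale (-1) x') y')).
  by apply: le_trans (min_normD _ _) _; rewrite lerD// min_normM.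
move=> H K p q rp rq s t.
(* [tform_actD] splits only the outermost acting list. A sum in the right factor is brought there by
   moving the left factor across the form as an adjoint. *)
rewrite !(tform_actD, tform_actZ)// (tform_actM' _ _ x (_ ++ _))//.
rewrite (tform_actM _ _ (_ ++ _))// !(tform_actD, tform_actZ)//.
by rewrite -!tform_actM'// -!tform_actM//; ring.
Qed.

Lemma tdistS x y : tdist (tstar x) (tstar y) <= tdist x y.
Proof.
rewrite (@tdist_ext _ _ (tstar (x ++ tscale (-1) y))); first exact: min_norm_star_le.
move=> H K p q rp rq s t.
rewrite !(tform_actD, tform_actZ, tform_actS)// rmorphD rmorphM /= rmorphN rmorph1.
by [].
Qed.

(** Lists with concatenation as addition satisfy the algebraic axioms only up to [tdist]; each of
    them follows from an identity of [tform] in every pair of representations. *)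
Definition tensor_pre : preCStar R.
Proof.
refine (@PreCStar R (seq (A * B)) [::] cat (@tscale R A B) tmul tstar tdist
  _ tdist_sym tdist_triangle tdistD tdistZ tdistM tdistS _ _ _ _ _ _ _ _ _ _ _ _ _ _ _ _ _ _ _ _).
- by move=> x; exact: tequiv_dist0.
- by move=> x y z; apply: tequiv_dist0; rewrite catA.
- by move=> x y; apply: tequiv_dist0 => H K p q rp rq s t; rewrite !tform_actD addrC.
- by move=> x; exact: tequiv_dist0.
- move=> x; apply: tequiv_dist0 => H K p q rp rq s t.
  by rewrite !(tform_actD, tform_actZ, tform_act0)//; ring.
- move=> a b x; apply: tequiv_dist0 => H K p q rp rq s t.
  by rewrite !tform_actZ// mulrA.
- move=> x; apply: tequiv_dist0 => H K p q rp rq s t.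
  by rewrite !tform_actZ// mul1r.
- move=> a x y; apply: tequiv_dist0 => H K p q rp rq s t.
  by rewrite !(tform_actD, tform_actZ)// mulrDr.
- move=> a b x; apply: tequiv_dist0 => H K p q rp rq s t.
  by rewrite !(tform_actD, tform_actZ)// mulrDl.
- move=> x y z; apply: tequiv_dist0 => H K p q rp rq s t.
  by rewrite tform_actM'// tform_actM// [RHS]tform_actM// [RHS]tform_actM'.
- move=> x y z; apply: tequiv_dist0 => H K p q rp rq s t.
  by rewrite tform_actD !tform_actM// tform_actD.
- move=> x y z; apply: tequiv_dist0 => H K p q rp rq s t.
  by rewrite tform_actD !tform_actM'// tform_actD.
- move=> c x y; apply: tequiv_dist0 => H K p q rp rq s t.
  by rewrite tform_actZ// !tform_actM// tform_actZ.
- move=> c x y; apply: tequiv_dist0 => H K p q rp rq s t.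
  by rewrite tform_actZ// !tform_actM'// tform_actZ.
- by move=> x; apply: tequiv_dist0; rewrite tstarK.
- move=> x y; apply: tequiv_dist0 => H K p q rp rq s t.
  by rewrite !(tform_actS, tform_actD)// rmorphD.
- move=> c x; apply: tequiv_dist0 => H K p q rp rq s t.
  by rewrite !(tform_actS, tform_actZ)// rmorphM.
- move=> x y; apply: tequiv_dist0 => H K p q rp rq s t.
  rewrite tform_actS// tform_actM// tform_actM// tform_actS//.
  by rewrite tform_adj// (tform_conj (tensor_act p q y t)) tform_conj.
- by move=> x y; rewrite tdist0.
- by move=> c x; rewrite !tdist0 min_normZ.
- by move=> x; rewrite !tdist0 min_norm_starM.
Defined.

Lemma min_tensor_exists : exists (T : cstarAlgType R) (t : A -> B -> T), is_min_tensor t.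
Proof.
have [T [i [iD iZ iM iS [iN idense]]]] := cstar_completion tensor_pre.
have iE x y : tequiv x y -> i x = i y.
  move=> xy; apply/eqP; rewrite -subr_eq0 -scaleN1r -iZ -iD; apply/eqP.
  by apply: rnorm0_eq0; rewrite iN /= tdist0 -/(tdist x y) tequiv_dist0.
have isum x : \sum_(y <- x) i [:: (y.1, y.2)] = i x.
  elim: x => [|[a b] x IH]; rewrite ?big_nil ?big_cons.
    by apply/esym/rnorm0_eq0; rewrite iN /= tdist0 min_norm0.
  by rewrite IH -iD.
exists T, (fun a b => i [:: (a, b)]); split.
- split=> [a c b b'|b c a a'].
    rewrite -iZ -iD; apply: iE => H K p q rp rq s t /=.
    rewrite !tform_act !big_cons !big_nil !addr0 -big_split /=.
    apply: eq_bigr => y _; rewrite -big_split /=; apply: eq_bigr => z _.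
    by rewrite (repD rq) (repZ rq) (repZ rp) innerDl !innerZl; ring.
  rewrite -iZ -iD; apply: iE => H K p q rp rq s t /=.
  rewrite !tform_act !big_cons !big_nil !addr0 -big_split /=.
  apply: eq_bigr => y _; rewrite -big_split /=; apply: eq_bigr => z _.
  by rewrite (repD rp) (repZ rp) innerDl innerZl; ring.
- by move=> a a' b b'; rewrite -iM.
- by move=> a b; rewrite -iS.
- apply/dense_rnormP => u e e0; have [x hx] := idense u e e0.
  by exists (i x) => //; exists x.
- by move=> x; rewrite isum iN /= tdist0.
Qed.

End PreTensor.

Section TensorSums.
Context {A B T : cstarAlgType R} {t : A -> B -> T}.
Hypothesis ht : is_min_tensor t.
Implicit Types x y : seq (A * B).

Definition tsum x : T := \sum_(y <- x) t y.1 y.2.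

Lemma tsum_norm x : rnorm (tsum x) = min_norm x.
Proof. by case: ht => _ _ _ _; exact. Qed.

Lemma tsum_dense u e : 0 < e -> exists x, rnorm (u - tsum x) < e.
Proof.
case: ht => _ _ _ /dense_rnormP td _ e0; have [_ [x _ <-] ux] := td u e e0.
by exists x.
Qed.

Lemma tsumD x y : tsum (x ++ y) = tsum x + tsum y.
Proof. by rewrite /tsum big_cat. Qed.

Lemma tsumZ c x : tsum (tscale c x) = c *: tsum x.
Proof.
case: ht => -[_ tl] _ _ _ _; rewrite /tsum big_map scaler_sumr.
by apply: eq_bigr => u _ /=; rewrite (linear_scale (tl u.2)).
Qed.

Lemma tsumM x y : tsum (tmul x y) = cmul (tsum x) (tsum y).
Proof.
case: ht => _ tm _ _ _; rewrite /tsum big_allpairs_dep /=.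
elim: x => [|u x IH]; first by rewrite !big_nil cmul0l.
rewrite !big_cons cmulDl IH; congr (_ + _).
elim: y {IH} => [|v y IH]; first by rewrite !big_nil cmul0r.
by rewrite !big_cons cmulDr IH tm.
Qed.

Lemma tsumS x : tsum (tstar x) = cstar (tsum x).
Proof.
case: ht => _ _ ts _ _; rewrite /tsum big_map.
by elim: x => [|u x IH]; rewrite ?big_nil ?cstar0// !big_cons cstarD IH ts.
Qed.

Lemma tsum1 a b : tsum [:: (a, b)] = t a b.
Proof. by rewrite /tsum big_seq1. Qed.

Lemma rnorm_tensor_le a b : rnorm (t a b) <= rnorm a * rnorm b.
Proof.
by rewrite -tsum1 tsum_norm (le_trans (min_norm_cross _))// /cross_norm big_seq1.
Qed.

End TensorSums.

(** Composition with [f] turns a representation of [Y] into one of [X], so the supremum for the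
    image is taken over fewer pairs. *)
Lemma min_norm_map (X Y D : cstarAlgType R) (f : X -> Y) (x : seq (X * D)) : star_hom f ->
  min_norm [seq (f u.1, u.2) | u <- x] <= min_norm x.
Proof.
move=> hf; apply: min_norm_le; first exact: min_norm_ge0.
move=> H K p q rp rq s.
have rpf : cstar_rep (fun a => p (f a)).
  case: rp => p1 p2 p3 p4; split=> //.
  - by move=> c a b h; rewrite (star_homD _ _ hf) (star_homZ _ _ hf) p2.
  - by move=> a b h; rewrite (star_homM _ _ hf) p3.
  - by move=> a h k; rewrite p4 (star_homS _ hf).
have -> : tensor_act p q [seq (f u.1, u.2) | u <- x] s =
    tensor_act (fun a => p (f a)) q x s.
  by rewrite /tensor_act -map_comp.
exact: min_norm_ub.
Qed.

Lemma rnorm_lin_dist (V : normedModType R[i]) c (a b a' b' : V) :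
  rnorm (c *: a + b - (c *: a' + b')) <= cmod c * rnorm (a - a') + rnorm (b - b').
Proof. by rewrite opprD addrACA -scalerBr -rnormZ rnormD. Qed.

Lemma min_tensor_map (X Y D TX TY : cstarAlgType R) (f : X -> Y)
    (tX : X -> D -> TX) (tY : Y -> D -> TY) :
  star_hom f -> is_min_tensor tX -> is_min_tensor tY ->
  exists g : TX -> TY, [/\ star_hom g, forall u, rnorm (g u) <= rnorm u &
    forall a d, g (tX a d) = tY (f a) d].
Proof.
move=> hf hX hY; pose fm (x : seq (X * D)) := [seq (f u.1, u.2) | u <- x].
pose SX x := @tsum _ _ _ tX x; pose SY x := @tsum _ _ _ tY (fm x).
have SYD x y : SY (x ++ y) = SY x + SY y by rewrite /SY /fm map_cat tsumD.
have SYZ c x : SY (tscale c x) = c *: SY x.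
  rewrite /SY -(tsumZ hY); congr tsum; rewrite /fm /tscale -!map_comp; apply: eq_map => u /=.
  by rewrite (star_homZ _ _ hf).
have SYM x y : SY (tmul x y) = cmul (SY x) (SY y).
  rewrite /SY -(tsumM hY); congr tsum; rewrite /fm /tmul map_allpairs allpairs_mapl.
  rewrite allpairs_mapr; apply: eq_allpairs => u v /=.
  by rewrite (star_homM _ _ hf).
have SYS x : SY (tstar x) = cstar (SY x).
  rewrite /SY -(tsumS hY); congr tsum; rewrite /fm /tstar -!map_comp; apply: eq_map => u /=.
  by rewrite (star_homS _ hf).
have SYn x : rnorm (SY x) <= rnorm (SX x).
  by rewrite /SY /SX !tsum_norm//; exact: min_norm_map.
have SYd x y : rnorm (SY x - SY y) <= rnorm (SX x - SX y).
  by rewrite -(scaleN1r (SY y)) -(scaleN1r (SX y)) -SYZ -SYD /SX -tsumZ// -tsumD SYn.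
(* The closure of the graph on finite sums: one and the same list must approximate [u] and, after
   [f], [w]. It is total because [TY] is complete and [SYd] carries Cauchy sequences over. *)
pose G u w := forall e, 0 < e -> exists x, rnorm (u - SX x) < e /\ rnorm (w - SY x) < e.
have Gn u w : G u w -> rnorm w <= rnorm u.
  move=> uw; apply/ler_addgt0Pr => e e0; have [|x [ux wx]] := uw (e / 2); first by lra.
  have := ler_rnorm_dist w (SY x); have := ler_rnorm_dist (SX x) u.
  by rewrite (rnormBC (SX x)); have := SYn x; lra.
have [] := @star_hom_of_graph _ _ _ G.
- move=> u; pose dn n : R := 2^-1 ^+ n.
  have dn0 n : 0 < dn n by rewrite exprn_gt0// invr_gt0.
  have [x hx] := choice (fun n => tsum_dense hX u (dn0 n)).
  have hx1 n : rnorm (u - SX (x n)) < dn n by exact: hx.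
  have hx' n : rnorm (SX (x n) - u) < dn n by rewrite rnormBC.
  have r01 : 0 <= (2^-1 : R) < 1 by apply/andP; split; lra.
  have [||w xw _] := @geometric_rcvg R TY (fun n => SY (x n)) 2 2^-1 => //.
    move=> n; apply: le_trans (SYd _ _) _.
    have := rnorm_triangle u (SX (x n)) (SX (x n.+1)); have := hx' n; have := hx1 n.+1.
    rewrite /dn exprS; have : 0 < 2^-1 ^+ n :> R := dn0 n.
    by move: (2^-1 ^+ n) (rnorm _) (rnorm _) (rnorm _) => *; lra.
  exists w => e e0; have [M1 hM1] := xw e e0.
  have [M2 hM2] := geometric_small 1 r01 e0.
  exists (x (maxn M1 M2)); split; last by apply: hM1; exact: leq_maxl.
  by apply: lt_trans (hx _) _; have := hM2 _ (leq_maxr M1 M2); rewrite mul1r.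
- move=> c u w u' w' uw uw' e e0.
  have c0 := cmod_ge0 c; have c1 : 0 < cmod c + 1 by lra.
  have e1 : 0 < e / (cmod c + 1) by rewrite divr_gt0.
  have [x [ux wx]] := uw _ e1; have [x' [ux' wx']] := uw' _ e1.
  exists (tscale c x ++ x').
  have E : e = cmod c * (e / (cmod c + 1)) + e / (cmod c + 1).
    by field; rewrite gt_eqF.
  rewrite /SX tsumD tsumZ// SYD SYZ.
  by split; apply: le_lt_trans (rnorm_lin_dist _ _ _ _ _) _; rewrite E;
    apply: ler_ltD => //; rewrite ler_wpM2l// ltW.
- move=> u w u' w' uw uw' e e0.
  have un := rnorm_ge0 u; have un' := rnorm_ge0 u'.
  have wn := Gn _ _ uw; have wn' := Gn _ _ uw'.
  (* A product moves by at most r |u| + r (|u'| + 1) = r M when both factors move by less than r <=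
     1. *)
  pose M := rnorm u + rnorm u' + 1; have M0 : 0 < M by rewrite /M; lra.
  pose r := Num.min 1 (e / M); have r0 : 0 < r by rewrite lt_min ltr01 divr_gt0.
  have rM : r * M <= e by rewrite -ler_pdivlMr// ge_min lexx orbT.
  have r1 : r <= 1 by rewrite ge_min lexx.
  have [x [ux wx]] := uw _ r0; have [x' [ux' wx']] := uw' _ r0.
  exists (tmul x x'); rewrite /SX tsumM// SYM -/(SX x) -/(SX x').
  have gen (V : cstarAlgType R) (a b a' b' : V) : rnorm a <= rnorm u -> rnorm b <= rnorm u' ->
      rnorm (a - a') < r -> rnorm (b - b') < r -> rnorm (cmul a b - cmul a' b') < e.
    move=> an bn aa bb.
    have := cmul_dist a b a' b'; have := ler_rnorm_dist b' b; rewrite (rnormBC b').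
    have := rnorm_ge0 (a - a'); have := rnorm_ge0 (b - b'); have := rnorm_ge0 a.
    have := rnorm_ge0 b'.
    move: an bn aa bb rM; rewrite /M.
    move: (rnorm a) (rnorm b) (rnorm b') (rnorm (a - a')) (rnorm (b - b')).
    move=> an bn bn' da db h1 h2 h3 h4 h5 h6 h7 h8 h9 h10 h11.
    have B' : bn' <= rnorm u' + 1 by lra.
    have E1 : an * db <= rnorm u * r by rewrite ler_pM// ltW.
    have E2 : da * bn' < r * (rnorm u' + 1) by nra.
    lra.
  by split; apply: gen.
- move=> u w uw e e0; have [x [ux wx]] := uw e e0; exists (tstar x).
  by rewrite /SX tsumS// SYS -!cstarB !rnorm_star.
- move=> w /Gn; rewrite rnorm0 => w0; apply: rnorm0_eq0.
  by apply/eqP; rewrite eq_le w0 rnorm_ge0.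
move=> g hg hG; exists g; split=> // [u|a d]; first exact: Gn.
have gu u w : G u w -> g u = w.
  move=> uw; apply/eqP; rewrite -subr_eq0; apply/eqP; apply: rnorm_small_eq0 => e e0.
  have [|x [ux wx]] := uw (e / 4); first by lra.
  have [|y [uy wy]] := hG u (e / 4); first by lra.
  have := rnorm_triangle (SY y) (g u) w; have := rnorm_triangle (SY x) (SY y) w.
  have := SYd y x; have := rnorm_triangle u (SX y) (SX x).
  by rewrite (rnormBC (SX y) u) (rnormBC (SY x) w); lra.
apply: gu => e e0; exists [:: (a, d)].
by rewrite /SX /SY /= !tsum1 !subrr !rnorm0.
Qed.

End MinTensor.

Arguments tsum {R A B T} t x.

(** Serves two purposes: [S] a closed ideal with the given norm makes the ideal a C*-algebra, and
    [S] everything with [N a = L (a, 0)] yields the quotient determined by a code. *)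
Lemma subquotient_cstar (R : realType) (A : cstarAlgType R) (S : set A) (N : A -> R) :
  S 0 -> (forall c x y, S x -> S y -> S (c *: x + y)) ->
  (forall x y, S x -> S y -> S (cmul x y)) -> (forall x, S x -> S (cstar x)) ->
  (forall x y, N (x + y) <= N x + N y) -> (forall c x, N (c *: x) = cmod c * N x) ->
  (forall x y, N (cmul x y) <= N x * N y) -> (forall x, N (cstar x) <= N x) ->
  (forall x, N x ^+ 2 <= N (cmul (cstar x) x)) ->
  exists (C : cstarAlgType R) (j : A -> C),
  [/\ forall c x y, S x -> S y -> j (c *: x + y) = c *: j x + j y,
      forall x y, S x -> S y -> j (cmul x y) = cmul (j x) (j y),
      forall x, S x -> j (cstar x) = cstar (j x),
      forall x, S x -> rnorm (j x) = N x &
      forall u e, 0 < e -> exists2 x, S x & rnorm (u - j x) < e].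
Proof.
move=> S0 Sl Sm Ss ND NZ NM NS NSM.
have SD x y : S x -> S y -> S (x + y).
  by move=> hx hy; have := Sl 1 x y hx hy; rewrite scale1r.
have SZ c x : S x -> S (c *: x).
  by move=> hx; have := Sl c x 0 hx S0; rewrite addr0.
have N0 : N 0 = 0 by rewrite -(scale0r 0) NZ /cmod normr0 mul0r.
have NB x y : N (x - y) = N (y - x) by rewrite -opprB -scaleN1r NZ cmodN1 mul1r.
have NSM' x : N (cmul (cstar x) x) = N x ^+ 2.
  have N_ge0 y : 0 <= N y.
    by have := ND y (- y); rewrite subrr N0 -scaleN1r NZ cmodN1 mul1r; lra.
  apply/eqP; rewrite eq_le NSM andbT (le_trans (NM _ _))// expr2 ler_wpM2r//.
pose P := {x : A | S x}.
pose mk x (hx : S x) : P := exist _ x hx.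
unshelve epose (pc := @PreCStar R P (mk 0 S0)
  (fun x y => mk (sval x + sval y) (SD _ _ (svalP x) (svalP y)))
  (fun c x => mk (c *: sval x) (SZ c _ (svalP x)))
  (fun x y => mk (cmul (sval x) (sval y)) (Sm _ _ (svalP x) (svalP y)))
  (fun x => mk (cstar (sval x)) (Ss _ (svalP x)))
  (fun x y => N (sval x - sval y))
  _ _ _ _ _ _ _ _ _ _ _ _ _ _ _ _ _ _ _ _ _ _ _ _ _ _ _); rewrite /mk /=.
- by move=> x; rewrite subrr.
- by move=> x y; exact: NB.
- by move=> y x z; rewrite -[_ - sval z](subrKA (sval y)).
- by move=> x y x' y'; rewrite opprD addrACA.
- by move=> c x y; rewrite -scalerBr NZ.
- move=> x y x' y'; rewrite !subr0.
  have -> : cmul (sval x) (sval y) - cmul (sval x') (sval y') =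
    cmul (sval x) (sval y - sval y') + cmul (sval x - sval x') (sval y').
    by rewrite cmulBr cmulBl addrA subrK.
  by rewrite (le_trans (ND _ _))// lerD.
- by move=> x y; rewrite -cstarB.
- by move=> x y z; rewrite addrA subrr.
- by move=> x y; rewrite (addrC (sval x)) subrr.
- by move=> x; rewrite add0r subrr.
- by move=> x; rewrite scaleN1r addNr subrr.
- by move=> a b x; rewrite scalerA subrr.
- by move=> x; rewrite scale1r subrr.
- by move=> a x y; rewrite scalerDr subrr.
- by move=> a b x; rewrite scalerDl subrr.
- by move=> x y z; rewrite cmulA subrr.
- by move=> x y z; rewrite cmulDl subrr.
- by move=> x y z; rewrite cmulDr subrr.
- by move=> c x y; rewrite cscaleAl subrr.
- by move=> c x y; rewrite cscaleAr subrr.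
- by move=> x; rewrite cstarK subrr.
- by move=> x y; rewrite cstarD subrr.
- by move=> c x; rewrite cstarZ subrr.
- by move=> x y; rewrite cstarM subrr.
- by move=> x y; rewrite subr0 scaleN1r.
- by move=> c x; rewrite !subr0 NZ.
- by move=> x; rewrite !subr0 NSM'.
have [C [i [iD iZ iM iS [iN idense]]]] := cstar_completion pc.
(* Outside [S] the value 0 is a filler; all conclusions about [j] are restricted to [S]. *)
pose j a : C := if pselect (S a) is left h then i (mk a h) else 0.
have jE a (h : S a) : j a = i (mk a h).
  by rewrite /j; case: pselect => // h'; congr i; exact: eq_exist.
exists C, j; split.
- move=> c x y hx hy; rewrite (jE _ hx) (jE _ hy) -iZ -iD (jE _ (Sl _ _ _ hx hy)).
  by congr i; exact: eq_exist.
- move=> x y hx hy; rewrite (jE _ hx) (jE _ hy) -iM (jE _ (Sm _ _ hx hy)).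
  by congr i; exact: eq_exist.
- move=> x hx; rewrite (jE _ hx) -iS (jE _ (Ss _ hx)).
  by congr i; exact: eq_exist.
- by move=> x hx; rewrite (jE _ hx) iN /= subr0.
- move=> u e e0; have [[x hx] ux] := idense u e e0; exists x => //.
  by rewrite (jE _ hx).
Qed.

(** * Polish spaces of Lipschitz functions *)

Section LipschitzFamilies.
Context {R : realType} {V : Type} {dist : V -> V -> R} {v : nat -> V}
  {W : (V -> R) -> (nat -> nat) -> Prop}.
Hypothesis v_dense : forall x e, 0 < e -> exists n, dist x (v n) < e.
Hypothesis W_lip : forall L w, W L w -> forall x y, `|L x - L y| <= dist x y.
Hypothesis W_closed : forall (L_ : nat -> V -> R) (w_ : nat -> nat -> nat) L w,
  (forall n, W (L_ n) (w_ n)) -> (forall x, L_ n x @[n --> \oo] --> L x) ->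
  (forall k, exists M, forall n, (M <= n)%N -> w_ n k = w k) -> W L w.

Definition lip_family := {x : (V -> R) * (nat -> nat) | W x.1 x.2}.
Variable base : lip_family.
Implicit Types x y z : lip_family.

Definition lval x : V -> R := (sval x).1.
Definition lwit x : nat -> nat := (sval x).2.

Lemma lval_lip x a b : `|lval x a - lval x b| <= dist a b.
Proof. exact: W_lip (svalP x) a b. Qed.

Definition invSn (n : nat) : R := n.+1%:R^-1.

Lemma invSn_gt0 n : 0 < invSn n. Proof. by rewrite invr_gt0. Qed.

(** Radius [e] tests only the finitely many indices [n] with [e <= 1 / (n + 1)], which yields
    pointwise convergence: of values on the dense sequence, and of witnesses as discrete data. *)
Definition lball x (e : R) y := forall n, e <= invSn n ->
  lwit x n = lwit y n /\ `|lval x (v n) - lval y (v n)| < e.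

Definition lent : set_system (lip_family * lip_family) := entourage_ lball.
Definition lnbhs x : set_system lip_family := nbhs_ lent x.

HB.instance Definition _ := gen_eqMixin lip_family.
HB.instance Definition _ := gen_choiceMixin lip_family.
HB.instance Definition _ := isPointed.Build lip_family base.
HB.instance Definition _ := hasNbhs.Build lip_family lnbhs.

Lemma lball_center x (e : R) : 0 < e -> lball x e x.
Proof. by move=> e0 n _; rewrite subrr normr0. Qed.

Lemma lball_sym x y (e : R) : lball x e y -> lball y e x.
Proof. by move=> h n /h[-> ?]; rewrite distrC. Qed.

(** A radius [e <= 0] tests index 0 and fails there. The triangle inequality needs this, since a
    larger radius must test fewer indices. *)
Lemma lball_gt0 x y e : lball x e y -> 0 < e.
Proof.
move=> h; rewrite ltNge; apply/negP => e0.
have [|_] := h 0%N; first by rewrite (le_trans e0)// ltW// invSn_gt0.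
by move=> h'; have := le_lt_trans (normr_ge0 _) h'; rewrite ltNge e0.
Qed.

Lemma lball_triangle x y z e1 e2 : lball x e1 y -> lball y e2 z -> lball x (e1 + e2) z.
Proof.
move=> h1 h2 n en; have e10 := lball_gt0 h1; have e20 := lball_gt0 h2.
have [|-> l1] := h1 n; first by lra.
have [|-> l2] := h2 n; first by lra.
by split=> //; apply: le_lt_trans (ler_distD (lval y (v n)) _ _) _; exact: ltrD.
Qed.

Lemma lentE : lent = entourage_ lball. Proof. by []. Qed.
Lemma lnbhsE : nbhs = nbhs_ lent. Proof. by []. Qed.

HB.instance Definition _ := @Nbhs_isPseudoMetric.Build R lip_family
  lent lnbhsE lball lball_center lball_sym lball_triangle lentE.

Lemma ballE x e y : ball x e y = lball x e y. Proof. by []. Qed.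

Lemma invSn_small (e : R) : 0 < e -> exists n, invSn n < e.
Proof.
move=> e0; exists (Num.truncn e^-1).
by rewrite /invSn -[ltRHS]invrK ltf_pV2 ?posrE ?invr_gt0// truncnS_gt.
Qed.

Lemma invSn_le (n m : nat) : (invSn n <= invSn m) = (m <= n)%N.
Proof. by rewrite /invSn lef_pV2 ?posrE// ler_nat ltnS. Qed.

Lemma lball_eval x y (a : V) (n : nat) (e : R) : lball x e y -> e <= invSn n ->
  `|lval x a - lval y a| < dist a (v n) + dist a (v n) + e.
Proof.
move=> xy en; have [_ l] := xy n en.
have := lval_lip x a (v n); have := lval_lip y a (v n).
move: l; rewrite !ltr_norml !ler_norml.
by move=> /andP[a1 a2] /andP[b1 b2] /andP[c1 c2]; apply/andP; split; lra.
Qed.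

Lemma lval_continuous a : continuous (fun x => lval x a : R).
Proof.
move=> x; apply/(@cvgrPdist_lt _ R _ (nbhs x) (nbhs_filter x)) => e e0.
have [|n an] := @v_dense a (e / 4); first by lra.
apply/nbhs_ballP; exists (Num.min (e / 4) (invSn n)) => /=.
  by rewrite lt_min invSn_gt0 andbT; lra.
move=> y; rewrite ballE => /(lball_eval a (n := n)) => /(_ _)/lt_trans; apply.
  by rewrite ge_min lexx orbT.
have : Num.min (e / 4) (invSn n) <= e / 4 by rewrite ge_min lexx.
by lra.
Qed.

Lemma lip_family_eq x y : (forall e, 0 < e -> lball x e y) -> x = y.
Proof.
move=> h; have hw n : lwit x n = lwit y n by have [] := h (invSn n) _ n (lexx _); rewrite ?invSn_gt0.
have hv a : lval x a = lval y a.
  apply/eqP; rewrite -subr_eq0 -normr_le0; apply/ler_addgt0Pr => e e0; rewrite add0r.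
  have [|n an] := @v_dense a (e / 4); first by lra.
  have r0 : 0 < Num.min (e / 4) (invSn n) :> R.
    by rewrite lt_min invSn_gt0 andbT; lra.
  have := @lball_eval _ _ a n _ (h _ r0); rewrite ge_min lexx orbT => /(_ isT).
  have : Num.min (e / 4) (invSn n) <= e / 4 by rewrite ge_min lexx.
  by lra.
case: x y hw hv {h} => [[L w] hx] [[L' w'] hy]; rewrite /lwit /lval /= => hw hv.
apply: eq_exist; congr (_, _); exact/funext.
Qed.

Lemma lip_family_hausdorff : hausdorff_space lip_family.
Proof.
move=> x y xy; apply: lip_family_eq => e e0; have e2 : 0 < e / 2 by lra.
have [z [xz yz]] := xy _ _ (nbhsx_ballx x _ e2) (nbhsx_ballx y _ e2).
by rewrite [e]splitr; exact: lball_triangle xz (lball_sym yz).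
Qed.

(** Along centres of balls of radius 1 / (n + 1), the witness [k] is constant from [n = k] on and
    the values converge by the Lipschitz bound; [W_closed] keeps the limit in the family. *)
Lemma lip_family_complete (F : set_system lip_family) :
  ProperFilter F -> cauchy F -> cvg F.
Proof.
move=> FF /(@cauchyP R) cF.
have [x hx] := choice (fun n => cF (invSn n) (invSn_gt0 n)).
have xx n m : lball (x n) (invSn n + invSn m) (x m).
  have [z [xz yz]] := filter_ex (filterI (hx n) (hx m)).
  exact: lball_triangle xz (lball_sym yz).
have xw k n : (k <= n)%N -> lwit (x n) k = lwit (x k) k.
  move=> kn; have [z [xz yz]] := filter_ex (filterI (hx n) (hx k)).
  have [|-> _] := xz k; first by rewrite invSn_le.
  by have [-> _] := yz k (lexx _).
have small e : 0 < e -> exists M, forall n, (M <= n)%N -> invSn n < e.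
  move=> /invSn_small[M hM]; exists M => n Mn.
  by apply: le_lt_trans hM; rewrite invSn_le.
have cvx a : cvg (lval (x n) a @[n --> \oo]).
  apply: cauchy_cvg; apply: cauchy_exP => e e0.
  have [|k ak] := @v_dense a (e / 4); first by lra.
  have [|M hM] := small (Num.min (e / 4) (invSn k) / 2).
    by rewrite divr_gt0// lt_min invSn_gt0 andbT; lra.
  exists (lval (x M) a), M => // n /= Mn; rewrite /ball /=.
  have m1 : Num.min (e / 4) (invSn k) <= e / 4 by rewrite ge_min lexx.
  have m2 : Num.min (e / 4) (invSn k) <= invSn k by rewrite ge_min lexx orbT.
  have := hM n Mn; have := hM M (leqnn _) => h1 h2.
  have := @lball_eval _ _ a k _ (xx M n).
  by move=> /(_ _)/lt_trans; apply; lra.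
pose L a : R := lim (lval (x n) a @[n --> \oo]).
pose w k := lwit (x k) k.
have hL : W L w.
  apply: (@W_closed (fun n => lval (x n)) (fun n => lwit (x n))).
  - by move=> n; exact: (svalP (x n)).
  - by move=> a; exact: cvx.
  - by move=> k; exists k => n; exact: xw.
pose l : lip_family := exist _ (L, w) hL.
apply/cvg_ex; exists l; apply/(@fcvg_ballP R) => e e0.
have [|M hM] := small (e / 8); first by lra.
apply: filterS (hx M) => z xz; suff : lball l e z by []; move=> k ek.
have MM := hM M (leqnn _); have Mk : invSn M <= invSn k by lra.
have [wz vz] := xz k Mk; split.
  by rewrite -wz -[LHS]/(w k) /w xw// -invSn_le.
have lM : `|L (v k) - lval (x M) (v k)| <= e / 4.
  have cM : (lval (x n) (v k) - lval (x M) (v k)) @[n --> \oo] --> L (v k) - lval (x M) (v k).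
    by apply: cvgB; [exact: cvx|exact: cvg_cst].
  apply: (ler_cvg_to (cvg_norm cM) (cvg_cst (e / 4))).
  exists M => // n /= Mn; have := hM n Mn => h.
  by have [|_] := xx n M k; lra.
apply: le_lt_trans (ler_distD (lval (x M) (v k)) _ _) _; rewrite -[lval l]/L; lra.
Qed.

HB.instance Definition _ := Uniform_isComplete.Build lip_family lip_family_complete.

Lemma lip_family_separable : separable_space lip_family.
Proof.
(* A countable set of patterns: a length, rational approximations of the first values, and the first
   witnesses. One member is chosen for each realised pattern; two members with the same pattern are
   close. *)
pose good (th : nat * seq rat * seq nat) x := forall k, (k < th.1.1)%N ->
  lwit x k = nth 0%N th.2 k /\ `|lval x (v k) - ratr (nth 0 th.1.2 k)| < invSn th.1.1.
have [g hg] : {g & forall th, (exists x, good th x) -> good th (g th)}.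
  apply: (@choice _ _ (fun th x => (exists x0, good th x0) -> good th x)) => th; have [[x hx]|h] := pselect (exists x, good th x); first by exists x.
  by exists base => /h.
exists (range g); first exact: sub_countable (card_image_le g setT) (countableP _).
move=> U [x Ux] oU.
have /(nbhs_ballP (R := R))[e /= e0 sU] : nbhs x U by exact: open_nbhs_nbhs.
have [|n hn] := @invSn_small (e / 2); first by lra.
have rk k : {q : rat | `|lval x (v k) - ratr q| < invSn n}.
  apply: cid; have [|q] := @rat_in_itvoo R (lval x (v k) - invSn n) (lval x (v k) + invSn n).
    by have := invSn_gt0 n; lra.
  by rewrite in_itv /= => /andP[q1 q2]; exists q; rewrite ltr_norml; apply/andP; split; lra.
pose th := (n, mkseq (fun k => sval (rk k)) n, mkseq (lwit x) n).
have gx : good th x.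
  by move=> k kn; rewrite /= !nth_mkseq//; split=> //; exact: svalP (rk k).
exists (g th); split; last by exists th.
apply: sU; suff : lball x e (g th) by []; move=> k ek; have kn : (k < n)%N.
  have : invSn n < invSn k :> R by lra.
  by rewrite /invSn ltf_pV2 ?posrE// ltr_nat ltnS.
have [g1 g2] := hg th (ex_intro _ x gx) k kn; have [x1 x2] := gx k kn.
split; first by rewrite g1.
by apply: le_lt_trans (ler_distD (ratr (nth 0 th.1.2 k)) _ _) _; rewrite (distrC (ratr _)); lra.
Qed.

Lemma polish_lip_family : exists Y : completePseudoMetricType R,
  [/\ hausdorff_space Y, separable_space Y &
    exists2 m : Y -> V -> R, forall a, continuous (fun u => m u a) &
      range m = [set L | exists w, W L w]].
Proof.
exists (lip_family : completePseudoMetricType R); split.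
- exact: lip_family_hausdorff.
- exact: lip_family_separable.
exists lval; first exact: lval_continuous.
apply/seteqP; split=> [_ [x _ <-]|L [w hw]]; first by exists (lwit x); exact: (svalP x).
by exists (exist _ (L, w) hw).
Qed.

End LipschitzFamilies.

(** * Kernels and exactness *)

(** Exactness quantifies over algebras, so [K] must become one. Being closed, [K] gains nothing in
    the completion, and [i] is the inverse of the map of [K] onto it. *)
Lemma ideal_cstar (R : realType) (A : cstarAlgType R) (K : set A) :
  is_closed_ideal K -> (forall x, K x -> K (cstar x)) ->
  exists (J : cstarAlgType R) (i : J -> A), [/\ star_hom i, injective i & range i = K].
Proof.
move=> [cK K0 Kl Km] Ks.
have [||||||J [j [jl jm js jN jd]]] := @subquotient_cstar R A K (@rnorm R A) K0 Kl _ Ks.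
- by move=> x y _ Ky; exact: (Km x y Ky).1.
- exact: rnormD.
- exact: rnormZ.
- exact: rnormM.
- by move=> x; rewrite rnorm_star.
- by move=> x; rewrite rnorm_starM.
have jB x y : K x -> K y -> rnorm (j x - j y) = rnorm (x - y).
  move=> Kx Ky; rewrite addrC -scaleN1r -jl// jN; last exact: Kl.
  by rewrite scaleN1r addrC.
have jsurj u : exists2 a, K a & j a = u.
  pose dn n : R := 2^-1 ^+ n.
  have dn0 n : 0 < dn n by rewrite exprn_gt0// invr_gt0.
  have jd' n : exists x, K x /\ rnorm (u - j x) < dn n.
    by have [x Kx ux] := jd u _ (dn0 n); exists x.
  have [x hx] := choice jd'.
  have r01 : 0 <= (2^-1 : R) < 1 by apply/andP; split; lra.
  have [//||a xa _] := @geometric_rcvg R A x 2 2^-1.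
    move=> n; have [K1 h1] := hx n; have [K2 h2] := hx n.+1.
    rewrite -jB//; have := rnorm_triangle u (j (x n)) (j (x n.+1)).
    rewrite (rnormBC (j (x n)) u); move: h1 h2; rewrite /dn exprS.
    have : 0 < 2^-1 ^+ n :> R := dn0 n.
    by move: (2^-1 ^+ n) (rnorm _) (rnorm _) (rnorm _) => *; lra.
  have Ka : K a.
    move/closed_rnormP: cK; apply=> e e0; have [n an] := rcvg_approx xa e0.
    by exists (x n) => //; exact: (hx n).1.
  exists a => //; apply/eqP; rewrite -subr_eq0; apply/eqP; apply: rnorm_small_eq0 => e e0.
  have e2 : 0 < e / 2 by lra.
  have [M1 hM1] := xa _ e2; have [M2 hM2] := geometric_small 1 r01 e2.
  pose n := maxn M1 M2; have [Kn hn] := hx n.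
  have := hM1 n (leq_maxl _ _); have := hM2 n (leq_maxr _ _); rewrite mul1r -/(dn n).
  rewrite -jB//; have := rnorm_triangle (j (x n)) (j a) u.
  by rewrite (rnormBC (j (x n)) u); lra.
have [] := @star_hom_of_graph R J A (fun u a => K a /\ j a = u).
- by move=> u; have [a Ka ja] := jsurj u; exists a.
- by move=> c u a u' a' [Ka <-] [Ka' <-]; split; [exact: Kl|rewrite jl].
- move=> u a u' a' [Ka <-] [Ka' <-]; split; [exact: (Km a a' Ka').1|by rewrite jm].
- by move=> u a [Ka <-]; split; [exact: Ks|rewrite js].
- move=> a [Ka ja]; apply: rnorm0_eq0; rewrite -(jN _ Ka) ja; exact: rnorm0.
move=> i hi iG; exists J, i; split=> //.
- by move=> u u' E; rewrite -(iG u).2 E (iG u').2.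
- apply/seteqP; split=> [_ [u _ <-]|a Ka]; first exact: (iG u).1.
  exists (j a) => //; have [Ki ji] := iG (j a).
  by apply/eqP; rewrite -subr_eq0; apply/eqP/rnorm0_eq0; rewrite -jB// ji subrr rnorm0.
Qed.

Lemma ker_closed_ideal (R : realType) (A B : cstarAlgType R) (q : A -> B) :
  star_hom q -> (forall a, rnorm (q a) <= rnorm a) -> is_closed_ideal [set x | q x = 0].
Proof.
move=> hq cq; split=> /=.
- apply/closed_rnormP => x h /=; apply: rnorm_small_eq0 => e e0.
  have [y /= qy xy] := h e e0; have := cq (x - y).
  by rewrite (star_homB _ _ hq) qy subr0 => /le_trans; apply; exact: ltW.
- exact: star_hom0.
- by move=> c x y x0 y0; rewrite (star_homD _ _ hq) (star_homZ _ _ hq) x0 y0 scaler0 addr0.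
- by move=> a x x0; rewrite !(star_homM _ _ hq) x0 cmul0l cmul0r.
Qed.

Section ExactKernel.
Context {R : realType} {A D B E T : cstarAlgType R} {K : set A} {q : A -> B}
  {tau : A -> D -> E} {t : B -> D -> T}.
Hypotheses (hD : exact_cstar D) (hq : is_quotient K q)
  (htau : is_min_tensor tau) (ht : is_min_tensor t).

Lemma quotient_contractive a : rnorm (q a) <= rnorm a.
Proof.
case: hq => hh _ kerq ->; apply: ge_inf.
  by exists 0 => _ [k _ <-]; exact: rnorm_ge0.
exists 0; last by rewrite subr0.
by rewrite -kerq /=; exact: star_hom0.
Qed.

(** The last clause is exactness in the middle: an element of the kernel comes from the tensor
    product of [K] with [D], where finite sums are dense, and each of their tensors has first leg
    killed by [q]. It is phrased by norms of [q] so that it can be read off [L]. *)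
Lemma exact_kernel : exists q' : E -> T,
  [/\ star_hom q', forall s, rnorm (q' s) <= rnorm s, forall w, exists s, q' s = w,
      forall x : seq (A * D),
        rnorm (q' (tsum tau x)) <= \sum_(u <- x) rnorm (q u.1) * rnorm u.2 &
      forall s, q' s = 0 -> forall e, 0 < e -> exists2 x : seq (A * D),
        rnorm (s - tsum tau x) < e & \sum_(u <- x) rnorm (q u.1) * rnorm u.2 = 0].
Proof.
have [hh rq kerq _] := hq.
have [q' [hq' cq' q'E]] := min_tensor_map hh htau ht.
have idK : is_closed_ideal K by rewrite -kerq; exact: ker_closed_ideal quotient_contractive.
have [|J [i [hi ii ri]]] := ideal_cstar idK.
  by move=> x; rewrite -kerq /= (star_homS _ hh) => ->; exact: cstar0.
have [TJ [tJ htJ]] := min_tensor_exists J D.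
have [i' [hi' ci' i'E]] := min_tensor_map hi htJ htau.
have se : short_exact i q by split=> //; rewrite ri kerq.
have [_ _ _ ri' rq'] :=
  hD se htJ htau ht hi' hq' i'E q'E.
have qsum x : q' (tsum tau x) = \sum_(u <- x) t (q u.1) u.2.
  rewrite /tsum; elim: x => [|u x IH]; first by rewrite !big_nil star_hom0.
  by rewrite !big_cons (star_homD _ _ hq') IH q'E.
exists q'; split=> //.
- by move=> w; have : [set: T] w by []; rewrite -rq' => -[s _ <-]; exists s.
- move=> x; rewrite qsum; apply: le_trans (rnorm_sum_le _ _) _.
  by apply: ler_sum => u _; exact: rnorm_tensor_le.
- move=> s s0 e e0; have : [set b | q' b = 0] s by [].
  rewrite -ri' => -[z _ <-]; have [x zx] := tsum_dense htJ z e0.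
  exists [seq (i u.1, u.2) | u <- x].
    have -> : tsum tau [seq (i u.1, u.2) | u <- x] = i' (tsum tJ x).
      rewrite /tsum big_map; elim: x {zx} => [|u x IH]; first by rewrite !big_nil star_hom0.
      by rewrite !big_cons (star_homD _ _ hi') IH i'E.
    by rewrite -(star_homB _ _ hi'); exact: le_lt_trans (ci' _) zx.
  rewrite big_map big1// => u _ /=.
  have : [set x | q x = 0] (i u.1) by rewrite kerq -ri; exists u.1.
  by move=> /= ->; rewrite rnorm0 mul0r.
Qed.

End ExactKernel.

(** * Coding quotients by seminorms *)

Section Coding.
Context {R : realType} {A D E : cstarAlgType R} (tau : A -> D -> E).

(* [L (a, s)] stands for [|q a - h s|], where [q] is the projection onto
   [B = A / K] and [h : E -> B] is a surjective *-homomorphism. *)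
Definition coding_seminorm (L : A * E -> R) : Prop :=
  [/\ [/\ forall a s, L (a, s) <= rnorm a + rnorm s,
          forall u v, L (u.1 + v.1, u.2 + v.2) <= L u + L v,
          forall c u, L (c *: u.1, c *: u.2) <= cmod c * L u &
          forall u, L (cstar u.1, cstar u.2) <= L u],
      forall u v, L (cmul u.1 v.1, cmul u.2 v.2) <= L u * rnorm v.2 + rnorm u.1 * L v,
      forall a b, L (cmul a b, 0) <= L (a, 0) * L (b, 0),
      forall a, L (a, 0) ^+ 2 <= L (cmul (cstar a) a, 0) &
      forall a d, L (0, tau a d) <= L (a, 0) * rnorm d].

(** In order: [h s] lies in the closure of the range of [q]; the range of [h] is dense in that of
    [q]; [L (a, 0)] is a distance to near-kernel elements; [s] is within [C * L (0, s)] of sums of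
    tensors that [q] nearly kills. *)
Definition coding_full (L : A * E -> R) (C : R) : Prop :=
  [/\ forall s e, 0 < e -> exists a, L (a, s) <= e,
      forall a e, 0 < e -> exists s, L (a, s) <= e,
      forall a e, 0 < e -> exists2 y, rnorm (a - y) <= L (a, 0) + e & L (y, 0) <= e &
      forall s e, 0 < e -> exists2 x : seq (A * D),
        rnorm (s - tsum tau x) <= C * L (0, s) + e &
        \sum_(u <- x) L (u.1, 0) * rnorm u.2 <= e].

Section Seminorm.
Context {L : A * E -> R}.
Hypothesis hL : coding_seminorm L.

Let L0 a s : L (a, s) <= rnorm a + rnorm s.
Proof. by case: hL => -[]. Qed.
Lemma codingD u v : L (u.1 + v.1, u.2 + v.2) <= L u + L v.
Proof. by case: hL => -[]. Qed.
Let LZ c u : L (c *: u.1, c *: u.2) <= cmod c * L u.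
Proof. by case: hL => -[]. Qed.

Lemma coding_ge0 u : 0 <= L u.
Proof.
have L00 : 0 <= L (0, 0) by have := codingD (0, 0) (0, 0); rewrite /= !addr0; lra.
have := codingD u (-1 *: u.1, -1 *: u.2); have := LZ (-1) u.
by rewrite cmodN1 /= !scaleN1r !subrr; lra.
Qed.

Lemma codingZ c u : L (c *: u.1, c *: u.2) = cmod c * L u.
Proof.
apply/eqP; rewrite eq_le LZ /=.
have [->|c0] := eqVneq c 0; first by rewrite /cmod normr0 mul0r coding_ge0.
have cV : cmod c * cmod c^-1 = 1 by rewrite -cmodM mulfV// /cmod normr1.
have := LZ c^-1 (c *: u.1, c *: u.2); rewrite /= !scalerA mulVf// !scale1r -surjective_pairing.
by move=> /(ler_wpM2l (cmod_ge0 c)); rewrite mulrA cV mul1r.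
Qed.

Lemma codingB u v : L (u.1 - v.1, u.2 - v.2) <= L u + L v.
Proof.
have := codingD u (-1 *: v.1, -1 *: v.2).
by rewrite codingZ cmodN1 mul1r /= !scaleN1r.
Qed.

Lemma coding_tri (b : A) (a : A) s s' : L (a, s + s') <= L (b, s) + L (a - b, s').
Proof. by have := codingD (b, s) (a - b, s'); rewrite /= addrC subrK. Qed.

Lemma coding_lip u v : `|L u - L v| <= rnorm (u.1 - v.1) + rnorm (u.2 - v.2).
Proof.
have h x y : L x - L y <= rnorm (x.1 - y.1) + rnorm (x.2 - y.2).
  have := codingD y (x.1 - y.1, x.2 - y.2); have := L0 (x.1 - y.1) (x.2 - y.2).
  by rewrite /= !(addrC y.1) !(addrC y.2) !subrK -surjective_pairing; lra.
rewrite ler_norml; have := h u v; have := h v u.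
by rewrite (rnormBC v.1) (rnormBC v.2) => *; apply/andP; split; lra.
Qed.

Section Quotient.
Hypothesis htau : is_min_tensor tau.
Hypothesis hDex : exact_cstar D.
Context {C : R}.
Hypotheses (C0 : 0 <= C) (hC : coding_full L C).
Let K : set A := [set a | L (a, 0) = 0].

Lemma coding_quotient :
  [/\ is_closed_ideal K, forall a, dist_to a K = L (a, 0) &
    exists (B : cstarAlgType R) (q : A -> B), is_quotient K q /\ absorbing D B].
Proof.
have [Ld Lr La Lk] := hC.
have [[_ _ _ LS] LM NM NSM Lt] := hL.
pose N a := L (a, 0).
have [|||||||||B [q [ql qm qs qN qd]]] := @subquotient_cstar R A setT N => //.
- by move=> x y; have := codingD (x, 0) (y, 0); rewrite /= addr0.
- by move=> c x; have := codingZ c (x, 0); rewrite /= scaler0.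
- by move=> x; have := LS (x, 0); rewrite /= cstar0.
have hq : star_hom q.
  by split; [move=> c x y; exact: ql|move=> x y; exact: qm|move=> x; exact: qs].
have {}qN a : rnorm (q a) = N a by exact: qN.
have qNB a b : rnorm (q a - q b) = N (a - b) by rewrite -(star_homB _ _ hq) qN.
have lq : linear q by case: hq.
have cq a : rnorm (q a) <= rnorm a by rewrite qN; have := L0 a 0; rewrite rnorm0 addr0.
have lift z e : 0 < e -> exists2 x, q x = z & rnorm x <= rnorm z + e.
  move=> e0; have [||x qx xz] := @approx_lift R A B q 1 lq cq _ _ z e e0; first by [].
    (* Subtracting a near-kernel [y] from [a] brings its norm down to about [N a] and hardly changes
       its image. *)
    move=> {}z {}e {}e0; have e4 : 0 < e / 4 by lra.
    have [a _ za] := qd z _ e4; have [y ay Ny] := La a _ e4.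
    exists (a - y).
      rewrite mul1r; have := ler_rnorm_dist (q a) z; rewrite (rnormBC (q a)) qN -/(N a).
      by rewrite -/(N a) in ay; lra.
    rewrite (star_homB _ _ hq) opprB addrA addrAC.
    by have := rnormD (z - q a) (q y); rewrite qN; rewrite -/(N y) in Ny; lra.
  by exists x => //; rewrite mul1r in xz.
have kerq : [set x | q x = 0] = K.
  apply/seteqP; split=> a /=.
    by move=> qa; rewrite /K /= -/(N a) -qN qa rnorm0.
  by move=> La0; apply: rnorm0_eq0; rewrite qN.
have dK a : dist_to a K = N a.
  apply/eqP; rewrite eq_le; apply/andP; split.
    apply/ler_addgt0Pr => e e0; have [x qx xa] := lift (q a) e e0.
    rewrite qN in xa; apply: le_trans xa; apply: ge_inf.
      by exists 0 => _ [k _ <-]; exact: rnorm_ge0.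
    exists (a - x); last by rewrite opprB addrC subrK.
    by rewrite -kerq /= (star_homB _ _ hq) qx subrr.
  apply: lb_le_inf; first by exists (rnorm (a - 0)), 0 => //; rewrite -kerq /=; exact: star_hom0.
  move=> _ [k Kk <-]; have {}Kk : q k = 0 by move: Kk; rewrite -kerq.
  by rewrite -qN -[q a]subr0 -Kk -(star_homB _ _ hq).
have isq : is_quotient K q.
  split=> //; last by move=> a; rewrite dK.
  by apply/seteqP; split=> // z _; have [x qx _] := lift z 1 ltr01; exists x.
split=> //; first by rewrite -kerq; exact: ker_closed_ideal.
exists B, q; split=> //.
(* The graph of [h]: [h s = q a] exactly when [L (a, s)] vanishes. Total because [q] is onto and
   approximate solutions [a] have Cauchy images. *)
pose G s b := exists2 a, q a = b & L (a, s) = 0.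
have GE s b a : G s b -> L (a, s) = rnorm (q a - b).
  move=> [a0 <- La0]; rewrite qNB; apply/eqP; rewrite eq_le; apply/andP; split.
    by have := coding_tri a0 a s 0; rewrite addr0 La0 add0r.
  by have := codingB (a, s) (a0, s); rewrite /= subrr La0 addr0.
have [] := @star_hom_of_graph R E B G.
- move=> s; pose dn n : R := 2^-1 ^+ n.
  have dn0 n : 0 < dn n by rewrite exprn_gt0// invr_gt0.
  have [x hx] := choice (fun n => Ld s _ (dn0 n)).
  have r01 : 0 <= (2^-1 : R) < 1 by apply/andP; split; lra.
  have [//||b xb _] := @geometric_rcvg R B (fun n => q (x n)) 2 2^-1.
    move=> n; rewrite qNB; have := codingB (x n, s) (x n.+1, s); rewrite /= subrr.
    have := hx n; have := hx n.+1; rewrite /N /dn exprS.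
    have : 0 < 2^-1 ^+ n :> R := dn0 n.
    by move: (2^-1 ^+ n) (L _) (L _) (L _) => *; lra.
  have [a qa _] := lift b 1 ltr01; exists b, a => //.
  apply/eqP; rewrite eq_le coding_ge0 andbT; apply/ler_addgt0Pr => e e0; rewrite add0r.
  have e2 : 0 < e / 2 by lra.
  have [M1 hM1] := xb _ e2; have [M2 hM2] := geometric_small 1 r01 e2.
  pose n := maxn M1 M2.
  have := hM1 n (leq_maxl _ _); have := hM2 n (leq_maxr _ _); rewrite mul1r -/(dn n).
  have := hx n; rewrite -qa qNB; have := coding_tri (x n) a s 0; rewrite addr0 -/(N _).
  by lra.
- move=> c s b s' b' [a <- La0] [a' <- La0']; exists (c *: a + a').
    by rewrite (star_homD _ _ hq) (star_homZ _ _ hq).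
  apply/eqP; rewrite eq_le coding_ge0 andbT.
  have := codingD (c *: a, c *: s) (a', s'); have := codingZ c (a, s) => /=.
  by rewrite La0 La0' mulr0 => ->; rewrite addr0.
- move=> s b s' b' [a <- La0] [a' <- La0']; exists (cmul a a').
    by rewrite (star_homM _ _ hq).
  apply/eqP; rewrite eq_le coding_ge0 andbT.
  by have := LM (a, s) (a', s'); rewrite /= La0 La0' mul0r mulr0 addr0.
- move=> s b [a <- La0]; exists (cstar a); first by rewrite (star_homS _ hq).
  by apply/eqP; rewrite eq_le coding_ge0 andbT; have := LS (a, s); rewrite /= La0.
- by move=> b [a <- La0]; apply: rnorm0_eq0; rewrite qN.
move=> h hh hG.
have hE a s : L (a, s) = rnorm (q a - h s) by exact: GE.
have hM s : rnorm (h s) = L (0, s) by rewrite hE (star_hom0 hq) sub0r rnormN.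
have hsum x : rnorm (h (tsum tau x)) <= \sum_(u <- x) L (u.1, 0) * rnorm u.2.
  rewrite /tsum; elim: x => [|u x IH]; first by rewrite !big_nil (star_hom0 hh) rnorm0.
  rewrite !big_cons (star_homD _ _ hh); apply: le_trans (rnormD _ _) (lerD _ IH).
  by rewrite hM Lt.
have lh : linear h by case: hh.
have ch s : rnorm (h s) <= rnorm s by rewrite hM; have := L0 0 s; rewrite rnorm0 add0r.
have hsurj z : exists s, h s = z.
  have [|s hs _] := @approx_lift R E B h C lh ch C0 _ z 1 ltr01; last by exists s.
  (* If [h s] is within [r] of [z], removing the sum [tsum tau x] leaves norm at most
     [C * (rnorm z + r) + r] and spoils the image by at most [r] more. *)
  move=> {}z e e0; pose r := e / (C + 2); have C2 : 0 < C + 2 by rewrite ltr_wpDl.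
  have r0 : 0 < r by rewrite divr_gt0.
  have er : e = C * r + 2 * r by rewrite -mulrDl mulrC divfK// gt_eqF.
  have Cr := mulr_ge0 C0 (ltW r0); clearbody r.
  have [a qa _] := lift z 1 ltr01; have [s Las] := Lr a _ r0; have [x sx Nx] := Lk s _ r0.
  rewrite hE qa in Las.
  have zs : rnorm (z - h (s - tsum tau x)) <= 2 * r.
    rewrite (star_homB _ _ hh) opprB addrA addrAC.
    by have := rnormD (z - h s) (h (tsum tau x)); have := hsum x; lra.
  exists (s - tsum tau x); last by lra.
  have : C * rnorm (h s) <= C * (rnorm z + r).
    rewrite ler_wpM2l//; have := ler_rnorm_dist (h s) z; rewrite (rnormBC (h s)); lra.
  by rewrite -hM in sx; lra.
have [T [t ht]] := min_tensor_exists B D.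
have [q' [hq' cq' sq' q'sum q'ker]] := exact_kernel hDex isq htau ht.
have qNsum (x : seq (A * D)) : \sum_(u <- x) rnorm (q u.1) * rnorm u.2 = \sum_(u <- x) L (u.1, 0) * rnorm u.2.
  by apply: eq_bigr => u _; rewrite qN.
(* [h] and [q'] have the same kernel: here by the fourth clause of [coding_full], in [kq] by
   exactness. As both are onto, [B] and [T] are isomorphic through [E]. *)
have kh s : h s = 0 -> q' s = 0.
  move=> hs; apply: rnorm_small_eq0 => e e0; have [|x sx Nx] := Lk s (e / 2); first by lra.
  rewrite -hM hs rnorm0 mulr0 add0r in sx.
  have := q'sum x; rewrite qNsum; have := cq' (s - tsum tau x).
  rewrite (star_homB _ _ hq'); have := ler_rnorm_dist (q' s) (q' (tsum tau x)); lra.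
have kq s : q' s = 0 -> h s = 0.
  move=> qs0; apply: rnorm_small_eq0 => e e0; have [x sx Nx] := q'ker s qs0 e e0.
  rewrite qNsum in Nx; have := hsum x; rewrite Nx; have := ch (s - tsum tau x).
  rewrite (star_homB _ _ hh); have := ler_rnorm_dist (h s) (h (tsum tau x)); lra.
have eqh s s' : q' s = q' s' -> h s = h s'.
  move=> E'; apply/eqP; rewrite -subr_eq0 -(star_homB _ _ hh); apply/eqP/kq.
  by rewrite (star_homB _ _ hq') E' subrr.
have eqq s s' : h s = h s' -> q' s = q' s'.
  move=> E'; apply/eqP; rewrite -subr_eq0 -(star_homB _ _ hq'); apply/eqP/kh.
  by rewrite (star_homB _ _ hh) E' subrr.
exists T, t; split=> //.
have [] := @star_hom_of_graph R B T (fun b w => exists2 s, h s = b & q' s = w).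
- by move=> b; have [s hs] := hsurj b; exists (q' s), s.
- move=> c b w b' w' [s <- <-] [s' <- <-]; exists (c *: s + s').
    by rewrite (star_homD _ _ hh) (star_homZ _ _ hh).
  by rewrite (star_homD _ _ hq') (star_homZ _ _ hq').
- move=> b w b' w' [s <- <-] [s' <- <-]; exists (cmul s s').
    by rewrite (star_homM _ _ hh).
  by rewrite (star_homM _ _ hq').
- move=> b w [s <- <-]; exists (cstar s).
    by rewrite (star_homS _ hh).
  by rewrite (star_homS _ hq').
- by move=> w [s hs <-]; exact: kh.
move=> f hf fG; exists f => //.
have [g gG] := choice sq'.
exists (fun w => h (g w)) => [b|w].
  by have [s <- fs] := fG b; apply: eqh; rewrite gG.
by have [s hs <-] := fG (h (g w)); rewrite -[RHS]gG; exact: eqq.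
Qed.

End Quotient.
End Seminorm.
End Coding.

(** Supplies the unital source that [surj_star_hom_contractive] asks for when the inverse
    isomorphism from [T] to [B] is bounded. The unit laws hold on finite sums and extend by
    density. *)
Lemma min_tensor_unital (R : realType) (A B T : cstarAlgType R) (t : A -> B -> T) :
  unital A -> unital B -> is_min_tensor t -> unital T.
Proof.
move=> [a ha] [b hb] ht; pose v := t a b; exists v.
have tm : forall a a' b b', cmul (t a b) (t a' b') = t (cmul a a') (cmul b b') by case: ht.
have vl x : cmul v (tsum t x) = tsum t x.
  rewrite /tsum; elim: x => [|u x IH]; first by rewrite !big_nil cmul0r.
  by rewrite !big_cons cmulDr IH tm (ha _).1 (hb _).1.
have vr x : cmul (tsum t x) v = tsum t x.
  rewrite /tsum; elim: x => [|u x IH]; first by rewrite !big_nil cmul0l.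
  by rewrite !big_cons cmulDl IH tm (ha _).2 (hb _).2.
move=> x; have v0 := rnorm_ge0 v; have v1 : 0 < rnorm v + 1 by lra.
split; apply/eqP; rewrite -subr_eq0; apply/eqP; apply: rnorm_small_eq0 => e e0.
  have [y xy] := tsum_dense ht x (divr_gt0 e0 v1); rewrite ltr_pdivlMr// in xy.
  have -> : cmul v x - x = cmul v (x - tsum t y) - (x - tsum t y).
    by rewrite cmulBr vl opprB addrA subrK.
  have := rnormB (cmul v (x - tsum t y)) (x - tsum t y); have := rnormM v (x - tsum t y); lra.
have [y xy] := tsum_dense ht x (divr_gt0 e0 v1); rewrite ltr_pdivlMr// in xy.
have -> : cmul x v - x = cmul (x - tsum t y) v - (x - tsum t y).
  by rewrite cmulBl vr opprB addrA subrK.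
have := rnormB (cmul (x - tsum t y) v) (x - tsum t y); have := rnormM (x - tsum t y) v; lra.
Qed.

Section CodingOfQuotient.
Context {R : realType} {A D E : cstarAlgType R} {tau : A -> D -> E}.
Hypotheses (uA : unital A) (uD : unital D) (htau : is_min_tensor tau) (hDex : exact_cstar D).

(** [h] is the projection of [E] onto [T] followed by the inverse of the given isomorphism, and [C]
    is its open mapping constant. *)
Lemma quotient_coding (K : set A) (B : cstarAlgType R) (q : A -> B) :
  is_quotient K q -> absorbing D B -> exists (L : A * E -> R) (C : R),
  [/\ coding_seminorm tau L, 0 <= C, coding_full tau L C & K = [set a | L (a, 0) = 0]].
Proof.
move=> isq [T [t [ht [f hf [g fg gf]]]]].
have [hq rq kerq dq] := isq.
have cq := quotient_contractive isq.
have sq b : exists a, q a = b.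
  by have : [set: B] b by []; rewrite -rq => -[a _ <-]; exists a.
have uB : unital B.
  have [e he] := uA; exists (q e) => b; have [a <-] := sq b.
  by rewrite -!(star_homM _ _ hq) (he a).1 (he a).2.
have uT := min_tensor_unital uB uD ht.
have hg : star_hom g.
  split=> [c x y|x y|x]; apply: (can_inj fg).
  - by rewrite (star_homD _ _ hf) (star_homZ _ _ hf) !gf.
  - by rewrite (star_homM _ _ hf) !gf.
  - by rewrite (star_homS _ hf) !gf.
have cg : forall w, rnorm (g w) <= rnorm w.
  by apply: surj_star_hom_contractive => // b; exists (f b).
have [q' [hq' cq' sq' q'sum q'ker]] := exact_kernel hDex isq htau ht.
pose h s := g (q' s).
have hh : star_hom h.
  split=> [c x y|x y|x]; rewrite /h.
  - by rewrite (star_homD _ _ hq') (star_homZ _ _ hq') (star_homD _ _ hg) (star_homZ _ _ hg).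
  - by rewrite (star_homM _ _ hq') (star_homM _ _ hg).
  - by rewrite (star_homS _ hq') (star_homS _ hg).
have ch s : rnorm (h s) <= rnorm s by exact: le_trans (cg _) (cq' _).
have sh b : exists s, h s = b.
  by have [s hs] := sq' (f b); exists s; rewrite /h hs fg.
have lh : linear h by case: hh.
have [C C0 hC] := surjective_open lh sh.
have h_lift z e : 0 < e -> exists2 s, h s = z & rnorm s <= C * rnorm z + e.
  apply: approx_lift => // {}z {}e e0; have [s sz zs] := hC z e e0.
  by exists s => //; lra.
pose L (u : A * E) := rnorm (q u.1 - h u.2).
have LN a : L (a, 0) = rnorm (q a) by rewrite /L /= (star_hom0 hh) subr0.
have LM s : L (0, s) = rnorm (h s) by rewrite /L /= (star_hom0 hq) sub0r rnormN.
exists L, C; split=> //.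
- split; first split.
  + by move=> a s; rewrite /L /= (le_trans (rnormB _ _))// lerD.
  + by move=> u v; rewrite /L /= (star_homD _ _ hq) (star_homD _ _ hh) opprD addrACA rnormD.
  + by move=> c u; rewrite /L /= (star_homZ _ _ hq) (star_homZ _ _ hh) -scalerBr rnormZ.
  + by move=> u; rewrite /L /= (star_homS _ hq) (star_homS _ hh) -cstarB rnorm_star.
  + move=> u v; rewrite /L /= (star_homM _ _ hq) (star_homM _ _ hh).
    apply: le_trans (cmul_dist _ _ _ _) _; rewrite addrC lerD//.
      by rewrite ler_wpM2l ?rnorm_ge0.
    by rewrite ler_wpM2r ?rnorm_ge0.
  + by move=> a b; rewrite !LN (star_homM _ _ hq) rnormM.
  + by move=> a; rewrite !LN (star_homM _ _ hq) (star_homS _ hq) rnorm_starM.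
  + move=> a d; rewrite LN LM; apply: le_trans (cg _) _.
    by have := q'sum [:: (a, d)]; rewrite tsum1 big_seq1.
- split.
  + move=> s e e0; have [a qa] := sq (h s); exists a.
    by rewrite /L /= qa subrr rnorm0 ltW.
  + move=> a e e0; have [s hs] := sh (q a); exists s.
    by rewrite /L /= hs subrr rnorm0 ltW.
  + move=> a e e0; have [|_ [k Kk <-] ak] := @inf_adherent _ [set rnorm (a - k) | k in K] e e0.
      split; last by exists 0 => _ [k _ <-]; exact: rnorm_ge0.
      by exists (rnorm (a - 0)), 0 => //; rewrite -kerq /=; exact: star_hom0.
    exists k; first by rewrite LN dq ltW.
    have {}Kk : q k = 0 by move: Kk; rewrite -kerq.
    by rewrite LN Kk rnorm0 ltW.
  + move=> s e e0; have e2 : 0 < e / 2 by lra.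
    (* A short lift [s1] of [h s] differs from [s] by an element of the kernel of [q'], as [g] is
       injective; that difference is approximated by tensors whose first leg [q] kills. *)
    have [s1 hs1 s1n] := h_lift (h s) _ e2.
    have [|x sx Nx] := q'ker (s - s1) _ _ e2.
      apply: (can_inj gf); rewrite -/(h _) (star_homB _ _ hh) hs1 subrr.
      by rewrite (star_hom0 hg).
    exists x.
      have := ler_rnorm_dist (s - tsum tau x) s1; rewrite LM addrAC; lra.
    under eq_bigr do rewrite LN.
    by rewrite Nx ltW.
- rewrite -kerq; apply/seteqP; split=> a /=; rewrite LN; first by move=> ->; exact: rnorm0.
  exact: rnorm0_eq0.
Qed.

End CodingOfQuotient.

(** * Replacing tensor sums by finite codes *)

Section CodedConditions.
Context {R : realType} {A D E : cstarAlgType R} {tau : A -> D -> E}.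
Hypothesis htau : is_min_tensor tau.
Context {aa : nat -> A} {dd : nat -> D}.
Hypotheses (aaP : forall x e, 0 < e -> exists n, rnorm (x - aa n) < e)
  (ddP : forall x e, 0 < e -> exists n, rnorm (x - dd n) < e).

Definition decode_pairs (c : seq (nat * nat)) : seq (A * D) :=
  [seq (aa u.1, dd u.2) | u <- c].

Lemma tensor_dist a d a' d' :
  rnorm (tau a d - tau a' d') <= rnorm (a - a') * rnorm d + rnorm a' * rnorm (d - d').
Proof.
case: htau => -[tr tl] _ _ _ _.
have -> : tau a d - tau a' d' = tau (a - a') d + tau a' (d - d').
  by rewrite (linear_sub (tl d)) (linear_sub (tr a')) addrA subrK.
by rewrite (le_trans (rnormD _ _))// lerD// rnorm_tensor_le.
Qed.

(** One code must serve the sum in [E] and the weighted sum of seminorms at once; the latter is no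
    function of the tensor, so density in [E] alone would not do. *)
Lemma approx_tsum (N : A -> R) (x : seq (A * D)) e :
  (forall a, 0 <= N a) -> (forall a a', N a' <= N a + rnorm (a - a')) -> 0 < e ->
  exists c, rnorm (tsum tau x - tsum tau (decode_pairs c)) < e /\
    \sum_(u <- decode_pairs c) N u.1 * rnorm u.2 < \sum_(u <- x) N u.1 * rnorm u.2 + e.
Proof.
move=> N0 Nl; elim: x e => [|[a d] x IH] e e0.
  by exists [::]; rewrite /tsum !big_nil subrr rnorm0 add0r.
have [|c [xc Nc]] := IH (e / 2); first by lra.
have an := rnorm_ge0 a; have dn := rnorm_ge0 d; have Nn := N0 a.
(* For r <= 1, replacing both legs up to [r] changes the tensor, and raises the weight, by at most
   [r * M]. *)
pose M := rnorm a + rnorm d + N a + 1; have M0 : 0 < M by rewrite /M; lra.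
pose r := Num.min 1 (e / (2 * M)).
have r0 : 0 < r by rewrite lt_min ltr01 divr_gt0// mulr_gt0.
have rM : r * M <= e / 2.
  have : r <= e / (2 * M) by rewrite ge_min lexx orbT.
  by rewrite ler_pdivlMr ?mulr_gt0//; lra.
have r1 : r <= 1 by rewrite ge_min lexx.
have [i ai] := aaP a r0; have [j dj] := ddP d r0.
exists ((i, j) :: c); rewrite /tsum /= !big_cons /=; split.
  rewrite opprD addrACA; apply: le_lt_trans (rnormD _ _) _; rewrite [e]splitr.
  apply: ler_ltD xc; apply: le_trans (tensor_dist _ _ _ _) _.
  have := ler_rnorm_dist (aa i) a; rewrite (rnormBC (aa i)).
  have := rnorm_ge0 (a - aa i); have := rnorm_ge0 (d - dd j); have := rnorm_ge0 (aa i).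
  move: ai dj rM; rewrite /M; clearbody r.
  move: (rnorm (a - aa i)) (rnorm (d - dd j)) (rnorm (aa i)) => p1 p2 p3 h1 h2 h3 h4 h5 h6 h7.
  have E1 : p1 * rnorm d <= r * rnorm d by rewrite ler_wpM2r// ltW.
  have E2 : p3 * p2 <= (rnorm a + 1) * r by rewrite ler_pM//; lra.
  have E3 : 0 <= r * N a by rewrite mulr_ge0// ltW.
  lra.
have Ni : N (aa i) <= N a + r by have := Nl a (aa i); lra.
have dj' : rnorm (dd j) <= rnorm d + r.
  by have := ler_rnorm_dist (dd j) d; rewrite (rnormBC (dd j)); lra.
have E1 : N (aa i) * rnorm (dd j) <= (N a + r) * (rnorm d + r) by rewrite ler_pM// ?rnorm_ge0.
have E2 : r * r <= r by rewrite ler_piMl// ltW.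
have E3 : 0 <= r * rnorm a by rewrite mulr_ge0// ltW.
by move: rM; rewrite /M; clearbody r; lra.
Qed.

End CodedConditions.

(** * Dense sequences and codes *)

Section DenseSequences.
Context {R : realType}.

Definition rdense (V : normedModType R[i]) (f : nat -> V) :=
  forall x e, 0 < e -> exists n, rnorm (x - f n) < e.

Lemma countType_rdense (V : normedModType R[i]) (I : countType) (F : I -> V) :
  (forall x e, 0 < e -> exists i, rnorm (x - F i) < e) -> exists f : nat -> V, rdense f.
Proof.
move=> hF; exists (fun n => if unpickle n is Some i then F i else 0) => x e e0.
by have [i xi] := hF x e e0; exists (pickle i); rewrite pickleK.
Qed.

Lemma separable_rdense (V : normedModType R[i]) :
  separable_space V -> exists f : nat -> V, rdense f.
Proof.
move=> [S /countable_injP[g] + /dense_rnormP dS] => gi.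
pose f n := xget 0 [set x | S x /\ g x = n].
exists f => x e e0; have [y Sy xy] := dS x e e0; exists (g y).
have [Sf gf] : [set x | S x /\ g x = g y] (f (g y)) by apply: (@xgetPex _ 0); exists y.
by rewrite (gi (f (g y)) y) ?inE.
Qed.

Lemma complex_rat_approx (c : R[i]) e : 0 < e ->
  exists r s : rat, cmod (c - (ratr r +i* ratr s)%C) < e.
Proof.
move=> e0; have ra (x : R) : exists r : rat, `|x - ratr r| < e / 2.
  have [|r] := @rat_in_itvoo R (x - e / 2) (x + e / 2); first by lra.
  by rewrite in_itv /= => /andP[q1 q2]; exists r; rewrite ltr_norml; apply/andP; split; lra.
case: c => a b; have [r ar] := ra a; have [s bs] := ra b; exists r, s.
rewrite /cmod normc_def /=; apply: le_lt_trans (_ : `|a - ratr r| + `|b - ratr s| < e).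
  rewrite -[leRHS]ger0_norm ?addr_ge0// -sqrtr_sqr ler_sqrt ?sqr_ge0//.
  rewrite -(real_normK (num_real (a - _))) -(real_normK (num_real (b - _))).
  move: (normr_ge0 (a - ratr r)) (normr_ge0 (b - ratr s)).
  by move: `|a - _| `|b - _| => x y x0 y0; nra.
by lra.
Qed.

End DenseSequences.

Section FullGroup.
Context {R : realType} {A : cstarAlgType R} {u : free_group nat -> A}.
Hypothesis hA : is_full_group_cstar u.

Lemma full_group_dense x e : 0 < e -> exists s : seq (R[i] * free_group nat),
  rnorm (x - \sum_(y <- s) y.1 *: u y.2) < e.
Proof.
case: hA => _ _ /dense_rnormP dA _ e0; have [_ [s _ <-] xs] := dA x e e0.
by exists s.
Qed.

Lemma full_group_unital : unital A.
Proof.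
case: hA => um _ _ _; pose v := u 1%g; exists v.
have vl s : cmul v (\sum_(y <- s) y.1 *: u y.2) = \sum_(y <- s) y.1 *: u y.2.
  elim: s => [|y s IH]; first by rewrite !big_nil cmul0r.
  by rewrite !big_cons cmulDr IH -cscaleAr -um mul1g.
have vr s : cmul (\sum_(y <- s) y.1 *: u y.2) v = \sum_(y <- s) y.1 *: u y.2.
  elim: s => [|y s IH]; first by rewrite !big_nil cmul0l.
  by rewrite !big_cons cmulDl IH -cscaleAl -um mulg1.
move=> x; have v0 := rnorm_ge0 v; have v1 : 0 < rnorm v + 1 by lra.
split; apply/eqP; rewrite -subr_eq0; apply/eqP; apply: rnorm_small_eq0 => e e0.
  have [s] := full_group_dense x (divr_gt0 e0 v1); rewrite ltr_pdivlMr//.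
  set y := \sum_(_ <- _) _ => xy.
  have -> : cmul v x - x = cmul v (x - y) - (x - y).
    by rewrite cmulBr vl opprB addrA subrK.
  have := rnormB (cmul v (x - y)) (x - y); have := rnormM v (x - y); lra.
have [s] := full_group_dense x (divr_gt0 e0 v1); rewrite ltr_pdivlMr//.
set y := \sum_(_ <- _) _ => xy.
have -> : cmul x v - x = cmul (x - y) v - (x - y).
  by rewrite cmulBl vr opprB addrA subrK.
have := rnormB (cmul (x - y) v) (x - y); have := rnormM (x - y) v; lra.
Qed.

(** Rational coefficients and words over a countable alphabet suffice; [insubd] reads a word that is
    not reduced as the identity. *)
Lemma full_group_rdense : exists f : nat -> A, rdense f.
Proof.
pose F (s : seq (rat * rat * seq (nat * bool))) : A :=
  \sum_(y <- s) (ratr y.1.1 +i* ratr y.1.2)%C *: u (insubd (fg_one nat) y.2).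
apply: (countType_rdense (F := F)) => x e e0.
have [|s xs] := full_group_dense x (e := e / 2); first by lra.
suff [c sc] : exists c, rnorm (\sum_(y <- s) y.1 *: u y.2 - F c) < e / 2.
  by exists c; have := rnorm_triangle (\sum_(y <- s) y.1 *: u y.2) x (F c); lra.
have e2 : 0 < e / 2 by lra.
elim: s (e / 2) e2 {xs} => [|[z g] s IH] r r0.
  by exists [::]; rewrite /F !big_nil subrr rnorm0.
have [|c sc] := IH (r / 2); first by lra.
have g0 := rnorm_ge0 (u g); have g1 : 0 < 2 * (rnorm (u g) + 1) by lra.
have [p [p' zp]] := complex_rat_approx z (divr_gt0 r0 g1); rewrite ltr_pdivlMr// in zp.
exists ((p, p', fg_word g) :: c); rewrite /F !big_cons /= valKd.
rewrite opprD addrACA -scalerBl; apply: le_lt_trans (rnormD _ _) _.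
rewrite rnormZ [r]splitr; apply: ler_ltD sc.
by have := cmod_ge0 (z - (ratr p +i* ratr p')%C); lra.
Qed.

End FullGroup.

Section Codes.
Context {R : realType} {A D E : cstarAlgType R} {tau : A -> D -> E}.
Hypothesis htau : is_min_tensor tau.
Context {aa : nat -> A} {dd : nat -> D} {ss : nat -> E}.
Hypotheses (aaP : rdense aa) (ddP : rdense dd) (ssP : rdense ss).
Local Notation dp := (@decode_pairs R A D aa dd).

(** [k] holds indices for [a], [s] and [y] and a code of [x], the witnesses of the four clauses of
    [coding_full]. The inequalities are non-strict and [C] is a natural number, so that limits keep
    them and [w] can store everything. *)
Definition coded_at (C j m : nat) (k : nat * nat * nat * seq (nat * nat)) (L : A * E -> R) :=
  [/\ L (aa k.1.1.1, ss j) <= invSn m, L (aa j, ss k.1.1.2) <= invSn m,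
      rnorm (aa j - aa k.1.2) <= L (aa j, 0) + invSn m /\ L (aa k.1.2, 0) <= invSn m,
      rnorm (ss j - tsum tau (dp k.2)) <= C%:R * L (0, ss j) + invSn m &
      \sum_(u <- dp k.2) L (u.1, 0) * rnorm u.2 <= invSn m].

Definition decode_wit (n : nat) : nat * nat * nat * seq (nat * nat) :=
  odflt (0%N, 0%N, 0%N, [::]) (unpickle n).

(* The constant of the open mapping theorem is [w 0]; the witnesses for the pair
   [(j, m)] are stored at [(pickle (j, m)).+1]. *)
Definition coded (L : A * E -> R) (w : nat -> nat) :=
  coding_seminorm tau L /\
  forall j m, coded_at (w 0%N) j m (decode_wit (w (pickle (j, m)).+1)) L.

Lemma coded_coding_full L w : coded L w -> coding_full tau L (w 0%N)%:R.
Proof.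
move=> [hL hw]; have small (e : R) : 0 < e -> exists m, invSn m < e by exact: invSn_small.
have lip1 a b s : L (a, s) <= L (b, s) + rnorm (a - b).
  have := coding_lip hL (a, s) (b, s); rewrite /= subrr rnorm0 addr0 ler_norml.
  by move=> /andP[_]; lra.
have lip2 a s s' : L (a, s) <= L (a, s') + rnorm (s - s').
  have := coding_lip hL (a, s) (a, s'); rewrite /= subrr rnorm0 add0r ler_norml.
  by move=> /andP[_]; lra.
split.
- move=> s e e0; have [|m hm] := small (e / 2); first by lra.
  have [|j sj] := @ssP s (e / 2); first by lra.
  have [h1 _ _ _ _] := hw j m; exists (aa (decode_wit (w (pickle (j, m)).+1)).1.1.1).
  by have := lip2 (aa (decode_wit (w (pickle (j, m)).+1)).1.1.1) s (ss j); lra.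
- move=> a e e0; have [|m hm] := small (e / 2); first by lra.
  have [|j aj] := @aaP a (e / 2); first by lra.
  have [_ h2 _ _ _] := hw j m; exists (ss (decode_wit (w (pickle (j, m)).+1)).1.1.2).
  by have := lip1 a (aa j) (ss (decode_wit (w (pickle (j, m)).+1)).1.1.2); lra.
- move=> a e e0; have [|m hm] := small (e / 4); first by lra.
  have [|j aj] := @aaP a (e / 4); first by lra.
  have [_ _ [h3 h4] _ _] := hw j m; exists (aa (decode_wit (w (pickle (j, m)).+1)).1.2); last by lra.
  have := rnorm_triangle (aa j) a (aa (decode_wit (w (pickle (j, m)).+1)).1.2).
  by have := lip1 (aa j) a 0; rewrite (rnormBC (aa j) a); lra.
- move=> s e e0; set C : R := (w 0%N)%:R; have C0 : 0 <= C by rewrite ler0n.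
  have C3 : 0 < C + 3 by lra.
  (* Passing from [s] to [ss j] costs [r] in the distance and [C * r] inside [L]; the tolerance
     [1 / (m + 1)] costs another [r]. *)
  pose r := e / (C + 3); have r0 : 0 < r by rewrite divr_gt0.
  have er : e = C * r + 3 * r by rewrite -mulrDl mulrC divfK// gt_eqF.
  have Cr := mulr_ge0 C0 (ltW r0).
  have [m hm] := small r r0; have [j sj] := @ssP s r r0; clearbody r.
  have [_ _ _ h5 h6] := hw j m; exists (dp (decode_wit (w (pickle (j, m)).+1)).2); last by lra.
  have := rnorm_triangle (ss j) s (tsum tau (dp (decode_wit (w (pickle (j, m)).+1)).2)).
  have : C * L (0, ss j) <= C * (L (0, s) + r).
    by rewrite ler_wpM2l//; have := lip2 0 (ss j) s; rewrite (rnormBC (ss j)); lra.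
  by rewrite -/C in h5; lra.
Qed.

Lemma coding_full_coded L C : 0 <= C -> coding_seminorm tau L -> coding_full tau L C ->
  exists w, coded L w.
Proof.
move=> C0 hL [F1 F2 F3 F4].
have lip1 a b s : L (a, s) <= L (b, s) + rnorm (a - b).
  have := coding_lip hL (a, s) (b, s); rewrite /= subrr rnorm0 addr0 ler_norml.
  by move=> /andP[_]; lra.
have lip2 a s s' : L (a, s) <= L (a, s') + rnorm (s - s').
  have := coding_lip hL (a, s) (a, s'); rewrite /= subrr rnorm0 add0r ler_norml.
  by move=> /andP[_]; lra.
(* The constant may be enlarged, as it multiplies the nonnegative [L (0, s)]. In each clause half of
   the tolerance goes to [coding_full] and half to the choice of indices. *)
pose n := (Num.truncn C).+1.
have Cn : C <= n%:R by rewrite ltW// truncnS_gt.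
have ex (jm : nat * nat) : exists k, coded_at n jm.1 jm.2 k L.
  case: jm => j m /=; pose r : R := invSn m; have r0 : 0 < r := invSn_gt0 m.
  have r2 : 0 < r / 2 by lra.
  have [a ha] := F1 (ss j) _ r2; have [i1 hi1] := aaP a r2.
  have [s hs] := F2 (aa j) _ r2; have [i2 hi2] := ssP s r2.
  have [y hy Ny] := F3 (aa j) _ r2; have [i3 hi3] := aaP y r2.
  have [x hx Nx] := F4 (ss j) _ r2.
  have [||c [xc Nc]] := approx_tsum htau aaP ddP (N := fun a => L (a, 0)) x _ _ r2.
  - by move=> a'; exact: (coding_ge0 hL).
  - by move=> b b'; rewrite (rnormBC b); exact: lip1.
  exists (i1, i2, i3, c); split=> /=; rewrite -/r.
  - by have := lip1 (aa i1) a (ss j); rewrite (rnormBC (aa i1)); lra.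
  - by have := lip2 (aa j) (ss i2) s; rewrite (rnormBC (ss i2)); lra.
  - split; first by have := rnorm_triangle y (aa j) (aa i3); lra.
    by have := lip1 (aa i3) y 0; rewrite (rnormBC (aa i3)); lra.
  - have := rnorm_triangle (tsum tau x) (ss j) (tsum tau (dp c)).
    by have := ler_wpM2r (coding_ge0 hL (0, ss j)) Cn; lra.
  - by lra.
have [k hk] := choice ex.
exists (fun i => if i is i'.+1 then
  if unpickle i' is Some jm then pickle (k jm) else 0%N else n); split=> // j m.
by rewrite pickleK /decode_wit pickleK /=; exact: hk.
Qed.

Lemma le_cvgn (f g : nat -> R) (a b : R) : f n @[n --> \oo] --> a -> g n @[n --> \oo] --> b ->
  (exists M, forall n, (M <= n)%N -> f n <= g n) -> a <= b.
Proof. by move=> fa gb [M h]; apply: (ler_cvg_to fa gb); exists M => // n /h. Qed.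

(** For fixed [(j, m)] the constant and the witness are eventually frozen; what remains are
    non-strict inequalities between continuous expressions in finitely many values of [L]. *)
Lemma coded_closed (L_ : nat -> A * E -> R) (w_ : nat -> nat -> nat) L w :
  (forall n, coded (L_ n) (w_ n)) -> (forall x, L_ n x @[n --> \oo] --> L x) ->
  (forall k, exists M, forall n, (M <= n)%N -> w_ n k = w k) -> coded L w.
Proof.
move=> hc cL cw; have hL n := (hc n).1; split.
- split; first split.
  + move=> a s; apply: le_cvgn (cL _) (cvg_cst _) _; exists 0%N => n _.
    by case: (hL n) => -[].
  + move=> u v; apply: le_cvgn (cL _) (cvgD (cL u) (cL v)) _; exists 0%N => n _.
    by case: (hL n) => -[].
  + move=> c u; apply: le_cvgn (cL _) (cvgMl_tmp (cL u)) _; exists 0%N => n _.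
    by case: (hL n) => -[].
  + move=> u; apply: le_cvgn (cL _) (cL u) _; exists 0%N => n _.
    by case: (hL n) => -[].
  + move=> u v; apply: le_cvgn (cL _) (cvgD (cvgMr_tmp (cL u)) (cvgMl_tmp (cL v))) _.
    by exists 0%N => n _; case: (hL n).
  + move=> a b; apply: le_cvgn (cL _) (cvgM (cL (a, 0)) (cL (b, 0))) _.
    by exists 0%N => n _; case: (hL n).
  + move=> a; rewrite expr2; apply: le_cvgn (cvgM (cL (a, 0)) (cL (a, 0))) (cL _) _.
    by exists 0%N => n _; rewrite -expr2; case: (hL n).
  + move=> a d; apply: le_cvgn (cL _) (cvgMr_tmp (cL (a, 0))) _.
    by exists 0%N => n _; case: (hL n).
- move=> j m; set k := (pickle (j, m)).+1.
  have [M1 h1] := cw 0%N; have [M2 h2] := cw k.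
  have hn n : (maxn M1 M2 <= n)%N -> coded_at (w 0%N) j m (decode_wit (w k)) (L_ n).
    by rewrite geq_max => /andP[/h1 <- /h2 <-]; exact: (hc n).2.
  have csum (x : seq (A * D)) : (\sum_(u <- x) L_ n (u.1, 0) * rnorm u.2) @[n --> \oo]
      --> \sum_(u <- x) L (u.1, 0) * rnorm u.2.
    elim: x => [|u x IH].
      by rewrite big_nil; under eq_fun do rewrite big_nil; exact: cvg_cst.
    rewrite big_cons; under eq_fun do rewrite big_cons.
    exact: cvgD (cvgMr_tmp (cL _)) IH.
  split.
  + apply: le_cvgn (cL _) (cvg_cst _) _; exists (maxn M1 M2) => n /hn[//].
  + apply: le_cvgn (cL _) (cvg_cst _) _; exists (maxn M1 M2) => n /hn[//].
  + split.
      apply: le_cvgn (cvg_cst _) (cvgD (cL _) (cvg_cst _)) _.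
      by exists (maxn M1 M2) => n /hn[_ _ []].
    by apply: le_cvgn (cL _) (cvg_cst _) _; exists (maxn M1 M2) => n /hn[_ _ []].
  + apply: le_cvgn (cvg_cst _) (cvgD (cvgMl_tmp (cL _)) (cvg_cst _)) _.
    by exists (maxn M1 M2) => n /hn[].
  + apply: le_cvgn (csum _) (cvg_cst _) _.
    by exists (maxn M1 M2) => n /hn[].
Qed.

End Codes.

(** * From codes back to the space of ideals *)

Lemma wijsman_continuous (R : realType) (A : cstarAlgType R) (Y : topologicalType)
    (f : Y -> closed_ideal A) :
  (forall x : A, continuous (fun y => dist_to x (f y) : R)) -> continuous f.
Proof.
move=> h y; apply/cvg_sup => x.
exact: (@continuous_comp_initial _ Y R (fun K : closed_ideal A => dist_to x K) f (h x) y).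
Qed.

Lemma closed_ideal_eq (R : realType) (A : cstarAlgType R) (K K' : closed_ideal A) :
  K = K' :> set A -> K = K'.
Proof.
case: K K' => [K hK] [K' hK'] /= E; rewrite E in hK *.
by congr ClosedIdeal; exact: Prop_irrelevance.
Qed.

Theorem theorem10p3 (R : realType)
    (A : cstarAlgType R) (u : free_group nat -> A) (hA : is_full_group_cstar u)
    (D : cstarAlgType R) (hDsep : separable_space D) (hDunit : unital D)
    (hDexact : exact_cstar D) :
  analytic R [set K : closed_ideal A |
    exists (B : cstarAlgType R) (q : A -> B), is_quotient K q /\ absorbing D B].
Proof.
have uA := full_group_unital hA.
have [aa aaP] := full_group_rdense hA; have [dd ddP] := separable_rdense hDsep.
have [E [tau htau]] := min_tensor_exists A D.
have [ss ssP] : exists ss : nat -> E, rdense ss.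
  apply: (countType_rdense (F := fun c => tsum tau (@decode_pairs R A D aa dd c))) => s e e0.
  have [|x sx] := tsum_dense htau s (e := e / 2); first by lra.
  (* Only the distance in [E] is wanted here, so the weight is zero. *)
  have [//||//|c [xc _]] := approx_tsum htau aaP ddP (N := fun=> 0) (e := e / 2) x.
    by move=> a a'; rewrite add0r rnorm_ge0.
    by lra.
  by exists c => /=; have := rnorm_triangle (tsum tau x) s (tsum tau (@decode_pairs R A D aa dd c)); lra.
pose dist (x y : A * E) : R := rnorm (x.1 - y.1) + rnorm (x.2 - y.2).
pose v n : A * E := if (unpickle n : option (nat * nat)) is Some (i, j) then (aa i, ss j) else 0.
have vP x e : 0 < e -> exists n, dist x (v n) < e.
  move=> e0; have e2 : 0 < e / 2 by lra.
  have [i xi] := aaP x.1 _ e2; have [j xj] := ssP x.2 _ e2.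
  by exists (pickle (i, j)); rewrite /v pickleK /dist /=; lra.
pose W := @coded R A D E tau aa dd ss.
have W_lip L w : W L w -> forall x y, `|L x - L y| <= dist x y.
  by move=> [hL _] x y; exact: coding_lip hL x y.
have W_ideal L : (exists w, W L w) -> [/\ is_closed_ideal [set a | L (a, 0) = 0],
    forall a, dist_to a [set a | L (a, 0) = 0] = L (a, 0) &
    exists (B : cstarAlgType R) (q : A -> B),
      is_quotient [set a | L (a, 0) = 0] q /\ absorbing D B].
  move=> [w hw]; have hf := coded_coding_full aaP ssP hw.
  exact: (coding_quotient hw.1 htau hDexact (ler0n _ _) hf).
have S_code (K : closed_ideal A) :
    (exists (B : cstarAlgType R) (q : A -> B), is_quotient K q /\ absorbing D B) ->
    exists L, (exists w, W L w) /\ K = [set a | L (a, 0) = 0] :> set A.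
  move=> [B [q [hq hB]]].
  have [L [C [hL C0 hC KE]]] := quotient_coding uA hDunit htau hDexact hq hB.
  by exists L; split=> //; exact: coding_full_coded hC.
(* Library complete spaces are pointed, so the parameter space needs a base code, taken from one
   absorbing quotient; if there is none, the class is empty. *)
have [[K0 SK0]|S0] := pselect (exists K : closed_ideal A,
  exists (B : cstarAlgType R) (q : A -> B), is_quotient K q /\ absorbing D B); last first.
  by left; apply/seteqP; split=> // K SK; apply: S0; exists K.
right; have [L0 [[w0 hw0] _]] := S_code K0 SK0.
have [Y [hY sY [m mc mr]]] :=
  polish_lip_family vP W_lip (@coded_closed R A D E tau aa dd ss) (exist _ (L0, w0) hw0).
exists Y; split=> //.
have mW y : exists w, W (m y) w.
  by have h : range m (m y) by [exists y]; rewrite mr in h.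
pose f y := ClosedIdeal (let: And3 h _ _ := W_ideal _ (mW y) in h).
have fE y : ideal_set (f y) = [set a | m y (a, 0) = 0] by [].
exists f.
  apply: wijsman_continuous => x.
  suff -> : (fun y => dist_to x (f y)) = (fun y => m y (x, 0)) by exact: mc.
  by apply/funext => y; rewrite fE; have [_ -> _] := W_ideal _ (mW y).
apply/seteqP; split=> [_ [y _ <-]|K SK] /=.
  by have [_ _ h] := W_ideal _ (mW y).
have [L [hw KE]] := S_code K SK.
have : [set L | exists w, W L w] L by [].
rewrite -mr => -[y _ my]; exists y => //; apply: closed_ideal_eq.
by rewrite fE my KE.
Qed.
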